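(* Let $(\mathcal V_1,\mathcal L_1)$ and $(\mathcal V_2,\mathcal L_2)$ be quantized metric spaces. If $\mathrm{dist}_{NC}(\mathcal V_1,\mathcal V_2)=0$, then there exists a complete isometry $\Phi$ from $(\mathcal V_1,\mathcal L_1)$ onto $(\mathcal V_2,\mathcal L_2)$.
   Context: A matrix order unit space $(\mathcal V,1)$: complex vector space with conjugate-linear involution, partial orders on each $M_n(\mathcal V)$ via cones with $\gamma^*M_n(\mathcal V)^+\gamma\subseteq M_m(\mathcal V)^+$ ($\gamma\in M_{n,m}$), $\mathcal V^+$ proper with order unit $1$, each $M_n(\mathcal V)^+$ Archimedean; matrix norm $\|v\|_n=\inf\{t:\left[\begin{smallmatrix} t1_n& v\\ v^*& t1_n\end{smallmatrix}\right]\ge0\}$ (not assumed complete). $CS_n(\mathcal V)$ = unital completely positive maps $\mathcal V\to M_n$ with BW (pointwise) topology; $\ll\varphi,a\gg=[\varphi(a_{ij})]$. A matrix Lipschitz seminorm is a sequence $\mathcal L=(L_n)$ of seminorms on $M_n(\mathcal V)$ with null space $M_n(\mathbb C1)$, $L_{m+n}(v\oplus w)=\max\{L_m(v),L_n(w)\}$, $L_n(\alpha v\beta)\le\|\alpha\|L_m(v)\|\beta\|$, $L_m(v^* )=L_m(v)$; $D_{L_n}(\varphi,\psi)=\sup\{\|\ll\varphi,a\gg-\ll\psi,a\gg\|:a\in M_r(\mathcal V),L_r(a)\le1,r\in\mathbb N\}$; matrix Lip-norm: each $D_{L_n}$ induces the BW-topology; quantized metric space: $(\mathcal V,\mathcal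 L)$ with $\mathcal L$ a matrix Lip-norm. $L_{D_{L_n}}(a)=\sup\{\|\ll\varphi,a\gg-\ll\psi,a\gg\|/D_{L_r}(\varphi,\psi):\varphi\ne\psi\in CS_r(\mathcal V),r\in\mathbb N\}$. With $\bar{\mathcal V}$ the completion of $\mathcal V$, $L^c_n(a)=\inf\{t>0:a\in t\,\overline{B_n}\}$ for $a\in M_n(\bar{\mathcal V})$, $\overline{B_n}$ the norm closure of $\{a\in M_n(\mathcal V):L_{D_{L_n}}(a)\le1\}$, and $\mathcal V^c=\{a\in\bar{\mathcal V}:L^c_1(a)<\infty\}$; $(\mathcal V^c,\mathcal L^c)$ is a quantized metric space. A complete isometry from $(\mathcal V_1,\mathcal L_1)$ onto $(\mathcal V_2,\mathcal L_2)$ is a unital complete order isomorphism $\Phi:\mathcal V_1^c\to\mathcal V_2^c$ with $L^c_{1,n}=L^c_{2,n}\circ\Phi_n$ for all $n$. $\mathcal V_1\oplus\mathcal V_2$: entrywise order, unit $(1,1)$, norms $\max\{\|a\|_n,\|b\|_n\}$, projections $\pi_1,\pi_2$; a matrix Lip-norm $\mathcal L$ on it induces $\mathcal L_j$ via $\pi_j$ if $L_{j,n}(b)=\inf\{L_n(a):(\pi_j)_n(a)=b\}$; $\mathcal M(\mathcal L_1,\mathcal L_2)$: those inducing both; $CS_n(\mathcal V_j)\cong\{\varphi\circ\pi_j\}$; $\mathrm{dist}_{NC}(\mathcal V_1,\mathcal V_2)=\inf_{\mathcal L\in\mathcal M(\mathcal L_1,\mathcal L_2)}\sup_n n^{-2}\mathrm{dist}_H^{D_{L_n}}(CS_n(\mathcal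 V_1),CS_n(\mathcal V_2))$. *)

(* Defs.v *)
From mathcomp Require Import all_boot all_algebra.
From mathcomp Require Import complex.
From mathcomp Require Import all_classical reals constructive_ereal ereal.
Set Implicit Arguments.
Unset Strict Implicit.
Unset Printing Implicit Defensive.
Import GRing.Theory Num.Theory.
Local Open Scope ring_scope.
Local Open Scope complex_scope.
Local Open Scope ring_scope.

Section QMS.
Variable R : realType.
Local Notation C := (R[i]).

Definition cabs (z : C) : R := complex.Re `|z|.

Definition opn {I J : finType} (A : I -> J -> C) : R :=
  sup [set r : R | exists (x : I -> C) (y : J -> C),
        [/\ \sum_i cabs (x i) ^+ 2 <= 1, \sum_j cabs (y j) ^+ 2 <= 1 &
            r = cabs (\sum_i \sum_j (x i)^* * A i j * y j)]].

Definition mxn {m n} (A : 'M[C]_(m, n)) : R := opn (fun i j => A i j).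

Definition psd {I : finType} (A : I -> I -> C) : Prop :=
  forall x : I -> C, 0 <= \sum_i \sum_j (x i)^* * A i j * x j.

Section MatOps.
Variable V : lmodType C.

Definition mxscale {m n} (c : C) (a : 'M[V]_(m, n)) : 'M[V]_(m, n) :=
  map_mx ( *:%R c) a.
Definition scmx {m n} (g : 'M[C]_(m, n)) (e : V) : 'M[V]_(m, n) :=
  \matrix_(i, j) (g i j *: e).
Definition adjmx (inv : V -> V) {n} (a : 'M[V]_n) : 'M[V]_n :=
  \matrix_(i, j) inv (a j i).
Definition sandw {n m} (g : 'M[C]_(n, m)) (a : 'M[V]_n) : 'M[V]_m :=
  \matrix_(i, j) \sum_k \sum_l (((g k i)^* * g l j) *: a k l).
Definition lrmul {n m} (al : 'M[C]_(n, m)) (v : 'M[V]_m) (be : 'M[C]_(m, n))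
  : 'M[V]_n :=
  \matrix_(i, j) \sum_k \sum_l ((al i k * be l j) *: v k l).
End MatOps.

Record mou_data (V : lmodType C) := MOU {
  inv : V -> V;
  pos : forall n : nat, 'M[V]_n -> Prop;
  unit : V }.

Section MOU.
Variable V : lmodType C.
Variable D : mou_data V.

Definition one_mx n : 'M[V]_n := scmx (1%:M : 'M[C]_n) (unit D).

Definition is_mou : Prop :=
      (forall (c : C) (v w : V), inv D (c *: v + w) = c^* *: inv D v + inv D w) /\
      (forall v, inv D (inv D (v)) = v) /\
      (forall n (a : 'M[V]_n), pos D a -> adjmx (inv D) a = a) /\
      (forall n (a b : 'M[V]_n), pos D a -> pos D b -> pos D (a + b)) /\
      (forall n (t : R) (a : 'M[V]_n), 0 <= t -> pos D a -> pos D (mxscale t%:C a)) /\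
      (forall n (a : 'M[V]_n), pos D a -> pos D (- a) -> a = 0) /\
      (forall n m (g : 'M[C]_(n, m)) (a : 'M[V]_n), pos D a -> pos D (sandw g a)) /\
      inv D (unit D) = unit D /\
      (forall v, inv D v = v -> exists t : R, 0 < t /\
         pos D (const_mx (t%:C *: unit D - v) : 'M[V]_1) /\
         pos D (const_mx (t%:C *: unit D + v) : 'M[V]_1)) /\
      (forall n (a : 'M[V]_n), adjmx (inv D) a = a ->
         (forall eps : R, 0 < eps -> pos D (a + mxscale eps%:C (one_mx n))) ->
         pos D a).

Definition mnorm n (v : 'M[V]_n) : R :=
  inf [set t : R | pos D (block_mx (mxscale t%:C (one_mx n)) v
                                   (adjmx (inv D) v) (mxscale t%:C (one_mx n)))].

Definition ampl {n r} (phi : V -> 'M[C]_n) (a : 'M[V]_r)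
  : 'I_r * 'I_n -> 'I_r * 'I_n -> C :=
  fun p q => phi (a p.1 q.1) p.2 q.2.

Definition ampl_dist {n r} (phi psi : V -> 'M[C]_n) (a : 'M[V]_r) : R :=
  opn (fun p q => ampl phi a p q - ampl psi a p q).

Definition CS n (phi : V -> 'M[C]_n) : Prop :=
  [/\ (forall (c : C) v w, phi (c *: v + w) = c *: phi v + phi w),
      phi (unit D) = 1%:M &
      (forall r (a : 'M[V]_r), pos D a -> psd (ampl phi a))].

Definition lipT := forall n : nat, 'M[V]_n -> R.

Definition is_mlipsn (L : lipT) : Prop :=
  (forall n a, 0 <= L n a) /\
      (forall n a b, L n (a + b) <= L n a + L n b) /\
      (forall n (c : C) a, L n (mxscale c a) = cabs c * L n a) /\
      (forall n a, L n a = 0 <-> exists g : 'M[C]_n, a = scmx g (unit D)) /\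
      (forall m n (v : 'M[V]_m) (w : 'M[V]_n),
          L (m + n)%N (block_mx v 0 0 w) = Num.max (L m v) (L n w)) /\
      (forall m n (al : 'M[C]_(n, m)) (v : 'M[V]_m) (be : 'M[C]_(m, n)),
          L n (lrmul al v be) <= mxn al * L m v * mxn be) /\
      (forall m (v : 'M[V]_m), L m (adjmx (inv D) v) = L m v).

Definition DL (L : lipT) n (phi psi : V -> 'M[C]_n) : \bar R :=
  ereal_sup [set x | exists r (a : 'M[V]_r), L r a <= 1 /\
                     x = (ampl_dist phi psi a)%:E].

Definition induces_BW (L : lipT) : Prop := forall n : nat,
  (forall phi : V -> 'M[C]_n, CS phi -> forall eps : R, 0 < eps ->
     exists (s : seq V) (del : R), 0 < del /\
       forall psi, CS psi -> (forall a, a \in s -> mxn (phi a - psi a) < del) ->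
         (DL L phi psi < eps%:E)%E) /\
  (forall phi : V -> 'M[C]_n, CS phi -> forall (s : seq V) (del : R), 0 < del ->
     exists eps : R, 0 < eps /\
       forall psi, CS psi -> (DL L phi psi < eps%:E)%E ->
         forall a, a \in s -> mxn (phi a - psi a) < del).

Definition is_mlipnorm (L : lipT) : Prop := is_mlipsn L /\ induces_BW L.

Definition eratio (x : R) (d : \bar R) : \bar R :=
  match d with EFin y => (x / y)%:E | _ => 0%E end.

Definition LD (L : lipT) n (a : 'M[V]_n) : \bar R :=
  ereal_sup [set x | exists r (phi psi : V -> 'M[C]_r),
     [/\ CS phi, CS psi, phi <> psi &
         x = eratio (ampl_dist phi psi a) (DL L phi psi)]].

(* Completion: elements of M_n(completion of V) are represented by
   ||.||_n-Cauchy sequences in M_n(V). *)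
Definition mcauchy n (u : nat -> 'M[V]_n) : Prop :=
  forall eps : R, 0 < eps -> exists N, forall k l, (N <= k)%N -> (N <= l)%N ->
    mnorm (u k - u l) <= eps.
Definition mequiv n (u w : nat -> 'M[V]_n) : Prop :=
  forall eps : R, 0 < eps -> exists N, forall k, (N <= k)%N ->
    mnorm (u k - w k) <= eps.
Definition near_lim n (u : nat -> 'M[V]_n) (b : 'M[V]_n) (eps : R) : Prop :=
  exists N, forall k, (N <= k)%N -> mnorm (u k - b) <= eps.

(* lim u belongs to t * closure(B_n), B_n = {b in M_n(V) : L_{D_{L_n}}(b) <= 1} *)
Definition in_tclB (L : lipT) n (t : R) (u : nat -> 'M[V]_n) : Prop :=
  forall eps : R, 0 < eps -> exists b : 'M[V]_n,
    (LD L b <= 1%:E)%E /\ near_lim u (mxscale t%:C b) eps.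

Definition Lc (L : lipT) n (u : nat -> 'M[V]_n) : \bar R :=
  ereal_inf [set x | exists t : R, [/\ 0 < t, in_tclB L t u & x = t%:E]].

Definition seq1 (u : nat -> V) : nat -> 'M[V]_1 := fun k => const_mx (u k).
Definition seqmx n (A : 'I_n -> 'I_n -> nat -> V) : nat -> 'M[V]_n :=
  fun k => \matrix_(i, j) A i j k.

Definition in_Vc (L : lipT) (u : nat -> V) : Prop :=
  mcauchy (seq1 u) /\ (Lc L (seq1 u) < +oo)%E.

(* positivity in M_n of the completion: lim u is in the closure of M_n(V)^+ *)
Definition cpos n (u : nat -> 'M[V]_n) : Prop :=
  forall eps : R, 0 < eps -> exists p : 'M[V]_n, pos D p /\ near_lim u p eps.

Definition qms (L : lipT) : Prop := is_mou /\ is_mlipnorm L.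

End MOU.

Section Iso.
Variables V1 V2 : lmodType C.
Variables (D1 : mou_data V1) (D2 : mou_data V2).
Variables (L1 : lipT V1) (L2 : lipT V2).

(* F represents (on Cauchy-sequence representatives) a unital complete order
   isomorphism Phi : V1^c -> V2^c with L^c_{1,n} = L^c_{2,n} o Phi_n *)
Definition complete_isometry (F : (nat -> V1) -> (nat -> V2)) : Prop :=
  (forall u, in_Vc D1 L1 u -> in_Vc D2 L2 (F u)) /\
      (forall u w, in_Vc D1 L1 u -> in_Vc D1 L1 w ->
         mequiv D1 (seq1 u) (seq1 w) -> mequiv D2 (seq1 (F u)) (seq1 (F w))) /\
      (forall (c : C) u w, in_Vc D1 L1 u -> in_Vc D1 L1 w ->
         mequiv D2 (seq1 (F (fun k => c *: u k + w k)))
                   (seq1 (fun k => c *: F u k + F w k))) /\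
      (forall u w, in_Vc D1 L1 u -> in_Vc D1 L1 w ->
         mequiv D2 (seq1 (F u)) (seq1 (F w)) -> mequiv D1 (seq1 u) (seq1 w)) /\
      (forall w, in_Vc D2 L2 w -> exists u, in_Vc D1 L1 u /\
         mequiv D2 (seq1 (F u)) (seq1 w)) /\
      mequiv D2 (seq1 (F (fun _ => unit D1))) (seq1 (fun _ => unit D2)) /\
      (forall n (A : 'I_n -> 'I_n -> nat -> V1), (forall i j, in_Vc D1 L1 (A i j)) ->
         (cpos D1 (seqmx A) <-> cpos D2 (seqmx (fun i j => F (A i j)))) /\
         Lc D1 L1 (seqmx A) = Lc D2 L2 (seqmx (fun i j => F (A i j)))).

Definition sum_mou : mou_data (V1 * V2)%type :=
  @MOU _ (fun x => (inv D1 x.1, inv D2 x.2))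
      (fun n a => pos D1 (map_mx fst a) /\ pos D2 (map_mx snd a))
      (unit D1, unit D2).

Definition induces_both (L : lipT (V1 * V2)%type) : Prop :=
  (forall n (b : 'M[V1]_n),
     @L1 n b = inf [set x | exists a : 'M[(V1 * V2)%type]_n, map_mx fst a = b /\ x = L n a]) /\
  (forall n (b : 'M[V2]_n),
     @L2 n b = inf [set x | exists a : 'M[(V1 * V2)%type]_n, map_mx snd a = b /\ x = L n a]).

Definition hausdorff {T : Type} (d : T -> T -> \bar R) (A B : set T) : \bar R :=
  maxe (ereal_sup [set x | exists a, A a /\ x = ereal_inf [set y | exists b, B b /\ y = d a b]])
       (ereal_sup [set x | exists b, B b /\ x = ereal_inf [set y | exists a, A a /\ y = d a b]]).

Definition CS1img n : set ((V1 * V2)%type -> 'M[C]_n) :=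
  [set phi | exists phi1, CS D1 phi1 /\ phi = phi1 \o fst].
Definition CS2img n : set ((V1 * V2)%type -> 'M[C]_n) :=
  [set phi | exists phi2, CS D2 phi2 /\ phi = phi2 \o snd].

Definition distNC : \bar R :=
  ereal_inf [set x | exists L : lipT (V1 * V2)%type,
    [/\ is_mlipnorm sum_mou L, induces_both L &
        x = ereal_sup [set y | exists n : nat,
              y = (((n.+1)%:R ^- 2 : R)%:E *
                  hausdorff (@DL _ L n.+1) (@CS1img n.+1) (@CS2img n.+1))%E]]].

End Iso.
End QMS.

(* Main.v *)
Require Import Defs.
From mathcomp Require Import all_boot all_order all_algebra.
From mathcomp Require Import complex spectral sesquilinear.
From mathcomp Require Import all_classical reals constructive_ereal ereal.
From mathcomp Require Import ring lra.

(** By compactness of the matrix state spaces a Lip-norm ball is totally bounded modulo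
    scalars.  If the distance is 0, choose for each k a Lip-norm on V1 + V2 realising it up
    to 1/(k+1): its small-norm pairs (a, b) satisfy |b| <= |a| + O(1/k) and conversely.
    Along a free ultrafilter on the indices k, the lifts b_k of a fixed a converge in the
    completion of V2, and the limit defines the isometry.  The correspondence of matrix
    states, together with the duality between positive matrices and unital completely
    positive maps (Hahn-Banach), transports matrix positivity.  Finally L^c is transported
    because the L-ball is norm dense in the L_D-ball: this is a matrix bipolar theorem,
    proved by separating a selfadjoint a from the ball by a single functional on the cone of
    triples (z, x, y) with z >= alpha^* alpha, x >= - alpha^* b alpha, y >= alpha^* b alpha
    for some b in the ball, and turning its three components into completely positive maps. *)

Set Implicit Arguments.
Unset Strict Implicit.
Unset Printing Implicit Defensive.
Import Order.TTheory GRing.Theory Num.Theory.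
Local Open Scope ring_scope.
Local Open Scope complex_scope.
Local Open Scope ring_scope.

(** * Sesquilinear forms and operator norms *)

(** The weights n^-2 are harmless because every estimate concerns one fixed size: the norm on M_n(V)
    is computed by states of size n + n and positivity in M_n(V) by states of size n, so for fixed n
    the square of the size divided by k + 1 still tends to 0. The Lip-norms on V1 + V2 found for
    different k are unrelated to each other, and a lift is far from unique. Uniqueness in the limit
    comes from subtraction: lifts of two nearby elements differ by a pair with bounded Lip-norm and
    small first component, whose second component is then small too. The map is therefore read off a
    relation between Cauchy sequences that is symmetric in the two spaces, and exchanging the spaces
    gives injectivity and surjectivity. L1 and L2 are not assumed closed, and L^c is built from L_D,
    whereas lifting controls only L; this is where density of the L-ball in the L_D-ball enters.
    Norms and positivity are reached only through matrix states, so the cases u = 0 and n = 0, where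
    states can be missing or the infimum in the norm runs over an unbounded set, need separate
    care. *)

Section Cabs.
Variable R : realType.
Local Notation C := (R[i]).
Implicit Types z w : C.

Lemma cjM z w : (z * w)^* = z^* * w^*.
Proof. exact: rmorphM. Qed.

Lemma cjD z w : (z + w)^* = z^* + w^*.
Proof. exact: rmorphD. Qed.

Lemma cjN z : (- z)^* = - z^*.
Proof. exact: rmorphN. Qed.

Lemma cjB z w : (z - w)^* = z^* - w^*.
Proof. exact: rmorphB. Qed.

Lemma cj0 : (0 : C)^* = 0.
Proof. exact: rmorph0. Qed.

Lemma cj1 : (1 : C)^* = 1.
Proof. exact: rmorph1. Qed.

Lemma cj_nat n : (n%:R : C)^* = n%:R.
Proof. exact: rmorph_nat. Qed.

Lemma cj_sum (I : Type) (r : seq I) (P : pred I) (F : I -> C) :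
  (\sum_(i <- r | P i) F i)^* = \sum_(i <- r | P i) (F i)^*.
Proof. exact: rmorph_sum. Qed.

Lemma cabsE z : (cabs z)%:C = `|z|.
Proof. by rewrite /cabs normc_def. Qed.

Lemma cabs_ge0 z : 0 <= cabs z.
Proof. by rewrite -ler0c cabsE. Qed.

Lemma cabsM z w : cabs (z * w) = cabs z * cabs w.
Proof. by apply: complexI; rewrite rmorphM /= !cabsE normrM. Qed.

Lemma cabsD z w : cabs (z + w) <= cabs z + cabs w.
Proof. by rewrite -lecR rmorphD /= !cabsE ler_normD. Qed.

Lemma cabsN z : cabs (- z) = cabs z.
Proof. by rewrite /cabs normrN. Qed.

Lemma cabs_conj z : cabs z^* = cabs z.
Proof. by rewrite /cabs norm_conjC. Qed.

Lemma cabs0 : cabs (0 : C) = 0.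
Proof. by rewrite /cabs normr0. Qed.

Lemma cabs1 : cabs (1 : C) = 1.
Proof. by rewrite /cabs normr1. Qed.

Lemma cabs_real (t : R) : 0 <= t -> cabs t%:C = t.
Proof. by move=> t0; apply: complexI; rewrite cabsE ger0_norm ?ler0c. Qed.

Lemma cabs_eq0 z : cabs z = 0 -> z = 0.
Proof. by move=> h; apply/normr0_eq0; rewrite -cabsE h. Qed.

Lemma cabs_sum (I : finType) (F : I -> C) : cabs (\sum_i F i) <= \sum_i cabs (F i).
Proof.
elim/big_ind2: _ => [|a b c d h1 h2|//]; first by rewrite cabs0.
by apply: le_trans (cabsD _ _) _; apply: lerD.
Qed.

Lemma cabs_sqr z : (cabs z ^+ 2)%:C = z^* * z.
Proof. by rewrite rmorphXn /= cabsE normCK mulrC. Qed.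

Lemma Re_le_cabs z : complex.Re z <= cabs z.
Proof.
have := normc_ge_Re z; rewrite -cabsE lecR; exact: le_trans (ler_norm _).
Qed.

Lemma ReD z w : complex.Re (z + w) = complex.Re z + complex.Re w.
Proof. by case: z w => [a b] [c d]. Qed.

Lemma ReN z : complex.Re (- z) = - complex.Re z.
Proof. by case: z. Qed.

Lemma ReB z w : complex.Re (z - w) = complex.Re z - complex.Re w.
Proof. by rewrite ReD ReN. Qed.

Lemma Re_scale (t : R) z : complex.Re (t%:C * z) = t * complex.Re z.
Proof. by case: z => [a b] /=; rewrite mul0r subr0. Qed.

Lemma Re_cj z : complex.Re z^* = complex.Re z.
Proof. by case: z. Qed.

Lemma conj_real (t : R) : (t%:C)^* = t%:C :> C.
Proof. exact: conjc_real. Qed.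

Lemma ge0_Re z : 0 <= z -> z = (complex.Re z)%:C.
Proof. by move=> /ger0_real /RRe_real ->. Qed.

Lemma ge0_conj z : 0 <= z -> z^* = z.
Proof. by move=> /ge0_Re ->; rewrite conj_real. Qed.

(** The minus sign is chosen for [opn_le_Re], where rotating one vector by u turns the real part of
    a form into minus its modulus. *)
Lemma phase z : exists u : C, cabs u = 1 /\ u * z = - (cabs z)%:C.
Proof.
have [->|z0] := eqVneq z 0.
  by exists 1; rewrite cabs1 mulr0 cabs0 oppr0.
have cz0 : `|z| != 0 by rewrite normr_eq0.
exists (- (z^* / `|z|)); split.
  rewrite cabsN /cabs normrM normfV norm_conjC normr_id divff //.
by rewrite mulNr mulrAC -normCKC expr2 mulfK // cabsE.
Qed.

End Cabs.

Section Forms.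
Variable R : realType.
Local Notation C := (R[i]).

(** Convertible to the sums inside both [opn] and [psd], so that one set of lemmas serves the two
    definitions. *)
Definition sform {I J : finType} (A : I -> J -> C) (x : I -> C) (y : J -> C) : C :=
  \sum_i \sum_j (x i)^* * A i j * y j.

Definition vn2 {I : finType} (x : I -> C) : R := \sum_i cabs (x i) ^+ 2.

Section VN2.
Variable I : finType.
Implicit Types x : I -> C.

Lemma vn2_ge0 x : 0 <= vn2 x.
Proof. by apply: sumr_ge0 => i _; rewrite sqr_ge0. Qed.

Lemma vn2E x : (vn2 x)%:C = \sum_i (x i)^* * x i.
Proof. by rewrite /vn2 rmorph_sum /=; apply: eq_bigr => i _; exact: cabs_sqr. Qed.

Lemma vn2Z (c : C) x : vn2 (fun i => c * x i) = cabs c ^+ 2 * vn2 x.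
Proof. by rewrite /vn2 mulr_sumr; apply: eq_bigr => i _; rewrite cabsM exprMn. Qed.

Lemma vn2_coord x i : cabs (x i) ^+ 2 <= vn2 x.
Proof.
by rewrite /vn2 (bigD1 i) //= lerDl; apply: sumr_ge0 => j _; rewrite sqr_ge0.
Qed.

Lemma vn2_eq0 x : vn2 x = 0 -> forall i, x i = 0.
Proof.
move=> h i; apply: cabs_eq0; apply/eqP; rewrite -sqrf_eq0 eq_le sqr_ge0 andbT.
by rewrite -h; exact: vn2_coord.
Qed.

Lemma cabs_le1 x i : vn2 x <= 1 -> cabs (x i) <= 1.
Proof.
move=> h; rewrite -(@expr_le1 _ 2) ?cabs_ge0 //; exact: le_trans (vn2_coord _ _) h.
Qed.

Lemma vn2_delta (K : finType) (i : K) : vn2 (fun k => (k == i)%:R) = 1.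
Proof.
rewrite /vn2 (bigD1 i) //= eqxx cabs1 expr1n big1 ?addr0 // => j /negPf ->.
by rewrite cabs0 expr0n.
Qed.

End VN2.

Section SF.
Variables I J : finType.
Implicit Types (A B : I -> J -> C) (x : I -> C) (y : J -> C).

Lemma eq_sform A B x y : (forall i j, A i j = B i j) -> sform A x y = sform B x y.
Proof. by move=> h; apply: eq_bigr => i _; apply: eq_bigr => j _; rewrite h. Qed.

Lemma sformD A B x y : sform (fun i j => A i j + B i j) x y = sform A x y + sform B x y.
Proof.
rewrite /sform -big_split; apply: eq_bigr => i _ /=; rewrite -big_split.
by apply: eq_bigr => j _ /=; rewrite mulrDr mulrDl.
Qed.

Lemma sformZ (c : C) A x y : sform (fun i j => c * A i j) x y = c * sform A x y.
Proof.
rewrite /sform mulr_sumr; apply: eq_bigr => i _ /=; rewrite mulr_sumr.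
by apply: eq_bigr => j _ /=; rewrite (mulrCA _ c) -!mulrA.
Qed.

Lemma sformN A x y : sform (fun i j => - A i j) x y = - sform A x y.
Proof.
rewrite -mulN1r -sformZ; apply: eq_sform => i j; by rewrite mulN1r.
Qed.

Lemma sformB A B x y : sform (fun i j => A i j - B i j) x y = sform A x y - sform B x y.
Proof. by rewrite (sformD A (fun i j => - B i j)) sformN. Qed.

Lemma sform0 x y : sform (fun _ _ => 0) x y = 0.
Proof. by rewrite /sform big1 // => i _; rewrite big1 // => j _; rewrite mulr0 mul0r. Qed.

Lemma sform_sum (K : finType) (F : K -> I -> J -> C) x y :
  sform (fun i j => \sum_k F k i j) x y = \sum_k sform (F k) x y.
Proof.
symmetry; rewrite /sform exchange_big /=; apply: eq_bigr => i _.
rewrite exchange_big /=; apply: eq_bigr => j _.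
by rewrite mulr_sumr mulr_suml.
Qed.

Lemma sformZl (c : C) A x y : sform A (fun i => c * x i) y = c^* * sform A x y.
Proof.
rewrite /sform mulr_sumr; apply: eq_bigr => i _ /=; rewrite mulr_sumr.
by apply: eq_bigr => j _ /=; rewrite cjM -!mulrA.
Qed.

Lemma sformZr (c : C) A x y : sform A x (fun i => c * y i) = c * sform A x y.
Proof.
rewrite /sform mulr_sumr; apply: eq_bigr => i _ /=; rewrite mulr_sumr.
by apply: eq_bigr => j _ /=; rewrite mulrCA.
Qed.

Lemma sformDl A x x' y : sform A (fun i => x i + x' i) y = sform A x y + sform A x' y.
Proof.
rewrite /sform -big_split; apply: eq_bigr => i _ /=; rewrite -big_split.
by apply: eq_bigr => j _ /=; rewrite cjD !mulrDl.
Qed.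

Lemma sformDr A x y y' : sform A x (fun i => y i + y' i) = sform A x y + sform A x y'.
Proof.
rewrite /sform -big_split; apply: eq_bigr => i _ /=; rewrite -big_split.
by apply: eq_bigr => j _ /=; rewrite !mulrDr.
Qed.

Lemma sform_delta A i j :
  sform A (fun i' => (i' == i)%:R) (fun j' => (j' == j)%:R) = A i j.
Proof.
rewrite /sform (bigD1 i) //= (bigD1 j) //= !eqxx cj1 mul1r mulr1.
rewrite big1 ?addr0 => [|j' /negPf ->]; last by rewrite mulr0.
rewrite big1 ?addr0 // => i' /negPf ->; rewrite big1 // => j' _.
by rewrite cj0 !mul0r.
Qed.

Lemma vn2_0 (K : finType) : vn2 (fun _ : K => 0) = 0.
Proof. by rewrite /vn2 big1 // => k _; rewrite cabs0 expr0n. Qed.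

Lemma sform_x0 A x y : (forall i, x i = 0) -> sform A x y = 0.
Proof.
move=> h; rewrite /sform big1 // => i _; rewrite big1 // => j _.
by rewrite h cj0 !mul0r.
Qed.

Lemma sform_y0 A x y : (forall i, y i = 0) -> sform A x y = 0.
Proof.
by move=> h; rewrite /sform big1 // => i _; rewrite big1 // => j _; rewrite h mulr0.
Qed.
Lemma sform_bound A x y : vn2 x <= 1 -> vn2 y <= 1 ->
  cabs (sform A x y) <= \sum_i \sum_j cabs (A i j).
Proof.
move=> hx hy; apply: le_trans (cabs_sum _) _; apply: ler_sum => i _.
apply: le_trans (cabs_sum _) _; apply: ler_sum => j _.
rewrite !cabsM cabs_conj -[leRHS]mulr1 -[X in _ <= X * 1]mul1r.
by do 2?apply: ler_pM; rewrite ?mulr_ge0 ?cabs_ge0 ?cabs_le1.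
Qed.

Let opset A : set R := [set r : R | exists x y, [/\ vn2 x <= 1, vn2 y <= 1 &
            r = cabs (sform A x y)]].

Lemma opset_sup A : has_sup (opset A).
Proof.
split.
  exists 0; exists (fun=> 0); exists (fun=> 0).
  by rewrite !vn2_0 ler01 sform_x0 ?cabs0.
by exists (\sum_i \sum_j cabs (A i j)) => r [x [y [hx hy ->]]]; exact: sform_bound.
Qed.

Lemma opn_ub A x y : vn2 x <= 1 -> vn2 y <= 1 -> cabs (sform A x y) <= opn A.
Proof.
move=> hx hy; apply: (@ub_le_sup _ (opset A)); first by case: (opset_sup A).
by exists x, y.
Qed.

Lemma opn_lub A t : (forall x y, vn2 x <= 1 -> vn2 y <= 1 -> cabs (sform A x y) <= t) ->
  opn A <= t.
Proof.
move=> h; apply: (@ge_sup _ (opset A)); first by case: (opset_sup A).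
by move=> r [x [y [hx hy ->]]]; exact: h.
Qed.

Lemma opn_ge0 A : 0 <= opn A.
Proof.
by apply: le_trans (cabs_ge0 _) (@opn_ub A (fun=> 0) (fun=> 0) _ _); rewrite vn2_0.
Qed.

Lemma opn_le_sum A : opn A <= \sum_i \sum_j cabs (A i j).
Proof. by apply: opn_lub => x y; exact: sform_bound. Qed.

Lemma opn_entry A i j : cabs (A i j) <= opn A.
Proof. by rewrite -(sform_delta A) opn_ub ?vn2_delta. Qed.

Lemma opnD A B : opn (fun i j => A i j + B i j) <= opn A + opn B.
Proof.
apply: opn_lub => x y hx hy; rewrite sformD; apply: le_trans (cabsD _ _) _.
by apply: lerD; apply: opn_ub.
Qed.

Lemma eq_opn A B : (forall i j, A i j = B i j) -> opn A = opn B.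
Proof. by move=> h; congr (opn _); apply/funext => i; apply/funext => j. Qed.

Lemma opnZ_le (c : C) A : opn (fun i j => c * A i j) <= cabs c * opn A.
Proof.
apply: opn_lub => x y hx hy; rewrite sformZ cabsM.
by apply: ler_wpM2l; rewrite ?cabs_ge0 ?opn_ub.
Qed.

End SF.

Section SF2.
Variables I J : finType.
Implicit Types (A B : I -> J -> C) (x : I -> C) (y : J -> C).

Lemma vn2_sqrt0 (K : finType) (z : K -> C) : Num.sqrt (vn2 z) = 0 -> forall k, z k = 0.
Proof.
move=> /eqP; rewrite sqrtr_eq0 => h; apply: vn2_eq0.
by apply/eqP; rewrite eq_le h vn2_ge0.
Qed.

Lemma vn2_normalize (K : finType) (z : K -> C) : Num.sqrt (vn2 z) != 0 ->
  vn2 (fun k => ((Num.sqrt (vn2 z))^-1)%:C * z k) = 1.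
Proof.
move=> h; rewrite vn2Z cabs_real ?invr_ge0 ?sqrtr_ge0 //.
by rewrite -{2}(sqr_sqrtr (vn2_ge0 z)) -exprMn mulVf // expr1n.
Qed.

Lemma opn_CS A x y :
  cabs (sform A x y) <= opn A * (Num.sqrt (vn2 x) * Num.sqrt (vn2 y)).
Proof.
set a := Num.sqrt (vn2 x); set b := Num.sqrt (vn2 y).
have a0 : 0 <= a by exact: sqrtr_ge0.
have b0 : 0 <= b by exact: sqrtr_ge0.
have [ha|ha] := eqVneq a 0.
  by rewrite sform_x0 ?cabs0 ?mulr_ge0 ?opn_ge0 //; exact: vn2_sqrt0.
have [hb|hb] := eqVneq b 0.
  by rewrite sform_y0 ?cabs0 ?mulr_ge0 ?opn_ge0 //; exact: vn2_sqrt0.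
have := @opn_ub _ _ A (fun k => (a^-1)%:C * x k) (fun k => (b^-1)%:C * y k).
rewrite !vn2_normalize // lexx => /(_ isT isT).
rewrite sformZl sformZr !cabsM cabs_conj !cabs_real ?invr_ge0 //.
move=> h; have ab0 : 0 < a * b by rewrite mulr_gt0 // lt_def ?ha ?hb.
have := ler_wpM2r (ltW ab0) h.
suff -> : a^-1 * (b^-1 * cabs (sform A x y)) * (a * b) = cabs (sform A x y) by [].
by field; rewrite ha hb.
Qed.

(** Arithmetic-geometric mean applied to [opn_CS]. Together with [opn_le_Re] it translates an
    operator norm bound t into nonnegativity of the quadratic form of a block matrix with diagonal t
    and corner A, without square roots. *)
Lemma opn_sform A x y t : opn A <= t ->
  2 * cabs (sform A x y) <= t * (vn2 x + vn2 y).
Proof.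
move=> h; have t0 : 0 <= t by apply: le_trans h; exact: opn_ge0.
have hc := opn_CS A x y.
set a := Num.sqrt (vn2 x) in hc; set b := Num.sqrt (vn2 y) in hc.
have ab0 : 0 <= a * b by rewrite mulr_ge0 // sqrtr_ge0.
have h1 : cabs (sform A x y) <= t * (a * b).
  by apply: le_trans hc _; exact: ler_wpM2r.
rewrite -(sqr_sqrtr (vn2_ge0 x)) -(sqr_sqrtr (vn2_ge0 y)) -/a -/b.
have h2 : t * (2 * (a * b)) <= t * (a ^+ 2 + b ^+ 2).
  apply: ler_wpM2l => //; have := sqr_ge0 (a - b); rewrite sqrrB; lra.
by apply: le_trans h2; lra.
Qed.

(** Rotating y by the phase from [phase] leaves its norm unchanged and replaces the real part by
    minus the modulus of the form. *)
Lemma opn_le_Re A t : 0 <= t ->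
  (forall x y, 0 <= t * (vn2 x + vn2 y) + 2 * complex.Re (sform A x y)) -> opn A <= t.
Proof.
move=> t0 h; apply: opn_lub => x y hx hy.
have [u [u1 uz]] := phase (sform A x y).
have := h x (fun j => u * y j).
rewrite vn2Z u1 expr1n mul1r sformZr uz /= => h1.
have : t * (vn2 x + vn2 y) <= t * 2 by apply: ler_wpM2l => //; lra.
lra.
Qed.

Lemma opn_0 : opn (fun (_ : I) (_ : J) => 0 : C) = 0.
Proof.
apply/eqP; rewrite eq_le opn_ge0 andbT; apply: opn_lub => x y _ _.
by rewrite sform0 cabs0.
Qed.

Lemma opnN A : opn (fun i j => - A i j) = opn A.
Proof.
have h (B : I -> J -> C) : opn (fun i j => - B i j) <= opn B.
  apply: opn_lub => x y hx hy; rewrite sformN cabsN; exact: opn_ub.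
apply/eqP; rewrite eq_le h /=; apply: le_trans (h _).
by rewrite le_eqVlt; apply/orP; left; apply/eqP/eq_opn => i j; rewrite opprK.
Qed.
End SF2.

(** * Positive semidefinite scalar matrices *)

Section Psd.
Variable I : finType.
Implicit Types A B : I -> I -> C.

Lemma psdP A : psd A <-> forall x, 0 <= sform A x x.
Proof. by []. Qed.

Lemma sform_herm A : (forall i j, A i j = (A j i)^*) ->
  forall x y, sform A x y = (sform A y x)^*.
Proof.
move=> h x y; rewrite /sform exchange_big cj_sum; apply: eq_bigr => j _ /=.
rewrite cj_sum; apply: eq_bigr => i _ /=.
by rewrite !cjM conjCK -h mulrC mulrA mulrAC -mulrA mulrC.
Qed.

(** A nonnegative complex number is real. Evaluating the form at e_i + c e_j with c = 1 and with c =
    i gives two linear relations that identify the entry (i, j) with the conjugate of the entry (j,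
    i). *)
Lemma psd_herm A : psd A -> forall i j, A i j = (A j i)^*.
Proof.
move=> /psdP hA i j.
pose d k : I -> C := fun k' => (k' == k)%:R.
have e (c : C) : sform A (fun k => d i k + c * d j k) (fun k => d i k + c * d j k) =
    A i i + c * A i j + c^* * A j i + c^* * c * A j j.
  rewrite sformDl !sformDr !(sformZl, sformZr) !sform_delta; ring.
have r (c : C) : (c * A i j + c^* * A j i)^* = c * A i j + c^* * A j i.
  have h0 : 0 <= A i i by rewrite -(sform_delta A i i).
  have h1 : 0 <= c^* * c * A j j.
    by rewrite mulr_ge0 // 1?mulrC ?mul_conjC_ge0 // -(sform_delta A j j).
  have := ge0_conj (hA (fun k => d i k + c * d j k)).
  rewrite e 3!cjD (ge0_conj h0) (ge0_conj h1).
  rewrite -!addrA => /addrI; rewrite !addrA => /addIr; by rewrite cjD.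
have := r 1; have := r 'i.
rewrite !cjD !cjM !conjCK !conjCi !cj1 !mul1r => hi h1.
have {}hi : (A j i)^* - (A i j)^* = A i j - A j i.
  apply: (mulfI (neq0Ci _)); rewrite !mulrBr; move: hi; rewrite !mulNr => hi.
  by rewrite addrC.
have : (A i j) *+ 2 = (A j i)^* *+ 2.
  rewrite !mulr2n; have -> : A i j + A i j = (A i j - A j i) + (A i j + A j i) by ring.
  by rewrite -hi -h1; ring.
by move=> /eqP; rewrite -subr_eq0 -mulrnBl mulrn_eq0 /= subr_eq0 => /eqP.
Qed.

Lemma psdD A B : psd A -> psd B -> psd (fun i j => A i j + B i j).
Proof. by move=> /psdP hA /psdP hB; apply/psdP => x; rewrite sformD addr_ge0. Qed.

Lemma psdZ (c : C) A : 0 <= c -> psd A -> psd (fun i j => c * A i j).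
Proof. by move=> c0 /psdP hA; apply/psdP => x; rewrite sformZ mulr_ge0. Qed.

Lemma psd_sum (K : finType) (F : K -> I -> I -> C) :
  (forall k, psd (F k)) -> psd (fun i j => \sum_k F k i j).
Proof.
by move=> h; apply/psdP => x; rewrite sform_sum sumr_ge0 // => k _; exact: (h k).
Qed.

Lemma eq_psd A B : (forall i j, A i j = B i j) -> psd A -> psd B.
Proof. by move=> h /psdP hA; apply/psdP => x; rewrite -(eq_sform _ _ h). Qed.
End Psd.

Lemma sform_ext (I J : finType) (A : I -> J -> C) x x' y y' :
  (forall i, x i = x' i) -> (forall j, y j = y' j) -> sform A x y = sform A x' y'.
Proof.
by move=> hx hy; apply: eq_bigr => i _; apply: eq_bigr => j _; rewrite hx hy.
Qed.

Lemma sform_scalar n (c : C) (x y : 'I_n -> C) :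
  sform (fun i j => (c%:M : 'M_n) i j) x y = c * \sum_i (x i)^* * y i.
Proof.
rewrite /sform mulr_sumr; apply: eq_bigr => i _; rewrite (bigD1 i) //= !mxE eqxx.
rewrite big1 ?addr0 => [|j ji]; last by rewrite !mxE eq_sym (negPf ji) mulr0 mul0r.
by rewrite mulr1n -mulrA mulrCA.
Qed.

Definition ctr {m n} (T : 'M[C]_(m, n)) : 'M[C]_(n, m) := \matrix_(i, j) (T j i)^*.

Lemma ctrM m n p (S : 'M[C]_(m, n)) (T : 'M_(n, p)) : ctr (S *m T) = ctr T *m ctr S.
Proof.
apply/matrixP => i j; rewrite !mxE cj_sum; apply: eq_bigr => k _.
by rewrite !mxE cjM mulrC.
Qed.

Lemma ctrK m n (S : 'M[C]_(m, n)) : ctr (ctr S) = S.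
Proof. by apply/matrixP => i j; rewrite !mxE conjCK. Qed.

Lemma ctr1 n : ctr (1%:M : 'M[C]_n) = 1%:M.
Proof. by apply/matrixP => i j; rewrite !mxE cj_nat eq_sym. Qed.

Lemma sform_mx m n (S : 'M[C]_(m, n)) x y : sform (fun i j => S i j) x y =
  (ctr (\col_i x i) *m S *m \col_j y j) 0 0.
Proof.
rewrite /sform -mulmxA !mxE; apply: eq_bigr => i _; rewrite !mxE mulr_sumr.
by apply: eq_bigr => j _; rewrite !mxE mulrA.
Qed.

Lemma psd_ctrM m n (T : 'M[C]_(m, n)) : psd (fun i j => (ctr T *m T) i j).
Proof.
apply/psdP => x; rewrite sform_mx -[_ *m _ *m _]mulmxA -mulmxA mulmxA -ctrM mxE.
by apply: sumr_ge0 => i _; rewrite !mxE mulrC mul_conjC_ge0.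
Qed.

(** By the spectral theorem, T can be taken as the diagonal matrix of square roots of the
    eigenvalues times the unitary U. *)
Lemma psd_factor n (P : 'M[C]_n) : psd (fun i j => P i j) ->
  exists T : 'M[C]_n, P = ctr T *m T.
Proof.
move=> hP; have Ph := psd_herm hP.
have PH : P \is hermsymmx.
  apply/is_hermitianmxP; rewrite expr0 scale1r; apply/matrixP => i j.
  by rewrite !mxE Ph.
have /hermitian_normalmx/orthomx_spectralP := PH.
set U := spectralmx P; set d := spectral_diag P => PE.
have Uu : U \in unitmx by exact: spectral_unit.
have UE : invmx U = ctr U.
  by rewrite invmx_unitary ?spectral_unitarymx //; apply/matrixP => i j; rewrite !mxE.
have d0 i : 0 <= d 0 i.
  have -> : d 0 i = (U *m P *m ctr U) i i.
    rewrite -UE PE !mulmxA mulmxV // mul1mx mulmxK // mxE eqxx mulr1n //.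
  have -> : (U *m P *m ctr U) i i = sform (fun i j => P i j) (fun k => (U i k)^*) (fun k => (U i k)^*).
    rewrite sform_mx -!mulmxA mxE [in RHS]mxE; apply: eq_bigr => k _.
    rewrite !mxE conjCK; congr (_ * _); apply: eq_bigr => l _; by rewrite !mxE.
  exact: hP.
pose r := \row_i sqrtC (d 0 i).
exists (diag_mx r *m U); rewrite ctrM mulmxA {1}PE UE; congr (_ *m _).
rewrite -mulmxA; congr (_ *m _); apply/matrixP => i j.
rewrite mul_mx_diag !mxE; case: eqVneq => [->|]; last by rewrite !mulr0n cj0 mul0r.
rewrite !mulr1n ge0_conj ?sqrtC_ge0 //; by rewrite -expr2 sqrtCK.
Qed.

(** A vector in the kernel of T makes the form equal to - del times its squared norm, so it
    vanishes. *)
Lemma unit_ctrM n (T : 'M[C]_n) (del : R) : 0 < del ->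
  psd (fun i j => (ctr T *m T - del%:C%:M) i j) -> T \in unitmx.
Proof.
move=> d0 h; rewrite -unitmx_tr -row_free_unit; apply/inj_row_free => v hv.
have Tv : T *m v^T = 0 by rewrite -[RHS]trmx0 -hv trmx_mul trmxK.
have := h (fun i => v 0 i); rewrite -/(sform _ _ _) sform_mx.
have -> : \col_j v 0 j = v^T by apply/matrixP => i j; rewrite !mxE ord1.
rewrite mulmxBr mulmxBl -!mulmxA Tv !mulmx0 sub0r mxE oppr_ge0.
rewrite mul_scalar_mx -scalemxAr mxE pmulr_rle0 ?ltcR //.
rewrite mxE => le0; apply/rowP => i; rewrite mxE.
have : (vn2 (fun i => v 0 i))%:C <= 0.
  rewrite vn2E; apply: le_trans le0; rewrite le_eqVlt; apply/orP; left; apply/eqP.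
  by apply: eq_bigr => k _; rewrite !mxE.
rewrite lecR => h0; apply: (@vn2_eq0 _ (fun i => v 0 i)).
by apply/eqP; rewrite eq_le h0 vn2_ge0.
Qed.
End Forms.

(** * Separation of a point from a cone with an order unit *)

Section ConeSep.
Variables (R : realType) (E : zmodType) (sc : R -> E -> E).
Hypothesis scDl : forall a b x, sc (a + b) x = sc a x + sc b x.
Hypothesis scDr : forall a x y, sc a (x + y) = sc a x + sc a y.
Hypothesis scA : forall a b x, sc a (sc b x) = sc (a * b) x.
Hypothesis sc1 : forall x, sc 1 x = x.

Let sc0l x : sc 0 x = 0.
Proof. by apply: (addrI (sc 0 x)); rewrite -scDl !addr0. Qed.

Let sc0r a : sc a 0 = 0.
Proof. by apply: (addrI (sc a 0)); rewrite -scDr !addr0. Qed.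

Let scNl a x : sc (- a) x = - sc a x.
Proof. by apply: (addrI (sc a x)); rewrite -scDl !subrr sc0l. Qed.

Let scNr a x : sc a (- x) = - sc a x.
Proof. by apply: (addrI (sc a x)); rewrite -scDr !subrr sc0r. Qed.

Definition is_cone (K : E -> Prop) :=
  (forall x y, K x -> K y -> K (x + y)) /\ (forall t x, 0 <= t -> K x -> K (sc t x)).

Variables (K : E -> Prop) (e z : E).
Hypothesis Kcone : is_cone K.
Hypothesis Kunit : forall x, exists t, K (sc t e + x).
Hypothesis Kz : ~ K z.

(** M is maximal among the cones that contain K and avoid z. If x is outside M, the cone spanned by
    M and x contains z; if - x is outside as well, a positive combination of the two expressions for
    z puts z into M. *)
Lemma maximal_cone : exists M : E -> Prop,
  [/\ is_cone M, (forall x, K x -> M x), ~ M z & forall x, M x \/ M (- x)].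
Proof.
pose good (A : set E) := [/\ is_cone A, (forall x, K x -> A x) & ~ A z].
have [|M [PM Mmax]] := @Zorn_bigcup E (fun A => A = set0 \/ good A).
  move=> F FP Ftot.
  have [[A [FA [x Ax]]]|nA] := pselect (exists A, F A /\ exists x, A x); last first.
    left; apply/seteqP; split=> // x [A FA Ax]; apply: nA; exists A; split=> //.
    by exists x.
  have gA B y : F B -> B y -> good B.
    by move=> FB By; case: (FP _ FB) => // B0; move: By; rewrite B0.
  right; split.
  - split.
      move=> u v [B FB Bu] [B' FB' Bv].
      have [[Badd _] _ _] := gA _ _ FB Bu; have [[Badd' _] _ _] := gA _ _ FB' Bv.
      have [BB|BB] := Ftot _ _ FB FB'.
        by exists B' => //; apply: Badd' => //; exact: BB.
      by exists B => //; apply: Badd => //; exact: BB.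
    move=> t u t0 [B FB Bu]; exists B => //.
    by have [[_ Bsc] _ _] := gA _ _ FB Bu; exact: Bsc.
  - move=> y Ky; exists A => //; have [_ KA _] := gA _ _ FA Ax; exact: KA.
  - by move=> [B FB Bz]; have [_ _ nz] := gA _ _ FB Bz.
have gM : good M.
  case: PM => // M0; exfalso; apply: (Mmax K); last by right; split.
  split=> [x|]; first by rewrite M0.
  move=> h; have [t Kt] := Kunit 0; by have := h _ Kt; rewrite M0.
have [[Madd Msc] KM Mz] := gM.
have M0 : M 0.
  by have [t Kt] := Kunit 0; have := Msc 0 _ (lexx 0) (KM _ Kt); rewrite sc0l.
have ext x : ~ M x -> exists m s, [/\ M m, 0 < s & z = m + sc s x].
  move=> Mx.
  pose B : set E := fun y => exists m s, [/\ M m, 0 <= s & y = m + sc s x].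
  have BM : (M `<` B)%classic.
    split=> [y My|h]; first by exists y, 0; rewrite sc0l addr0.
    apply: Mx; apply: h; exists 0, 1; rewrite sc1 add0r; split=> //.
  have [Bz|Bz] := pselect (B z).
    have [m [s [Mm s0 zE]]] := Bz; exists m, s; split=> //.
    rewrite lt_def s0 andbT; apply/eqP => s00; apply: Mz.
    by rewrite zE s00 sc0l addr0.
  exfalso; apply: (Mmax B) => //; right; split=> //.
    split.
      move=> _ _ [m [s [Mm s0 ->]]] [m' [s' [Mm' s0' ->]]].
      exists (m + m'), (s + s'); rewrite scDl addrACA addr_ge0 //; split=> //.
      exact: Madd.
    move=> t _ t0 [m [s [Mm s0 ->]]]; exists (sc t m), (t * s).
    by rewrite scDr scA mulr_ge0 //; split=> //; exact: Msc.
  by move=> y Ky; exists y, 0; rewrite sc0l addr0; split=> //; exact: KM.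
exists M; split=> // x.
have [|/ext [m [s [Mm s0 zE]]]] := pselect (M x); first by left.
have [|/ext [m' [s' [Mm' s0' zE']]]] := pselect (M (- x)); first by right.
exfalso; apply: Mz.
have ss : 0 < s + s' by rewrite addr_gt0.
(* From z = m + s x and z = m' - s' x, weighting by s' and s cancels the multiples of x. *)
have -> : z = sc (s + s')^-1 (sc s' m + sc s m').
  have -> : sc s' m + sc s m' = sc (s + s') z.
    rewrite scDl {1}zE' zE !scDr !scA scNr (mulrC s' s).
    by rewrite addrACA addNr addr0 addrC.
  by rewrite scA mulVf ?sc1 // gt_eqF.
have ss0 : 0 <= (s + s')^-1 by rewrite invr_ge0 ltW.
by apply: (Msc _ _ ss0); apply: Madd; [apply: (Msc _ _ (ltW s0'))|apply: (Msc _ _ (ltW s0))].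
Qed.
End ConeSep.

Section Separation.
Variables (R : realType) (E : zmodType) (sc : R -> E -> E).
Hypothesis scDl : forall a b x, sc (a + b) x = sc a x + sc b x.
Hypothesis scDr : forall a x y, sc a (x + y) = sc a x + sc a y.
Hypothesis scA : forall a b x, sc a (sc b x) = sc (a * b) x.
Hypothesis sc1 : forall x, sc 1 x = x.

(** Totality of the maximal cone M replaces the extension step of Hahn-Banach: the t with x - t e in
    M form a Dedekind cut whose supremum is g x, and upper and lower bounds add up, so g is
    additive. The slack eps stands in for closedness of K: it yields g x0 <= - eps. The real scaling
    is abstract so that the lemma applies to matrices over V and to triples of such matrices
    alike. *)
Lemma cone_separation (K : E -> Prop) (e x0 : E) (eps : R) :
  is_cone sc K -> (forall x, exists t, 0 <= t /\ K (sc t e + x)) ->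
  0 < eps -> ~ K (x0 + sc eps e) ->
  exists g : E -> R,
    [/\ (forall x y, g (x + y) = g x + g y), (forall t x, g (sc t x) = t * g x),
        (forall x, K x -> 0 <= g x), g e = 1 & g x0 < 0].
Proof.
move=> Kc Ku eps0 Kz.
have Ku' x : exists t, K (sc t e + x) by have [t [_ Kt]] := Ku x; exists t.
have [M [[Madd Msc] KM Mz Mtot]] := maximal_cone scDl scDr scA sc1 Kc Ku' Kz.
have sc0l x : sc 0 x = 0 by apply: (addrI (sc 0 x)); rewrite -scDl !addr0.
have sc0r a : sc a 0 = 0 by apply: (addrI (sc a 0)); rewrite -scDr !addr0.
have scNl a x : sc (- a) x = - sc a x.
  by apply: (addrI (sc a x)); rewrite -scDl !subrr sc0l.
have scNr a x : sc a (- x) = - sc a x.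
  by apply: (addrI (sc a x)); rewrite -scDr !subrr sc0r.
have Me : M e.
  have [t [t0 /KM]] := Ku e; rewrite -[X in _ + X](sc1 e) -scDl => h.
  have t1 : 0 < t + 1 by rewrite ltr_wpDl.
  have := Msc (t + 1)^-1 _ _ h; rewrite scA mulVf ?gt_eqF // sc1; apply.
  by rewrite invr_ge0 ltW.
have Mne : ~ M (- e).
  move=> h; apply: Mz; have [t [t0 /KM Kt]] := Ku (x0 + sc eps e).
  have := Madd _ _ (Msc _ _ t0 h) Kt.
  by rewrite scNr addrA addNr add0r.
have Mte s t x : M (x - sc s e) -> M (sc t e - x) -> s <= t.
  move=> h1 h2; rewrite leNgt; apply/negP => ts; apply: Mne.
  have st : 0 < s - t by rewrite subr_gt0.
  have := Madd _ _ h1 h2; rewrite addrC addrA addrNK -scNl -scDl => h.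
  have := Msc (s - t)^-1 _ _ h; rewrite scA invr_ge0 ltW // => /(_ isT).
  by rewrite -(opprB s t) mulrN mulVf ?gt_eqF // scNl sc1.
pose S x : set R := fun t => M (x - sc t e).
have Sne x : (S x !=set0)%classic.
  have [t [_ /KM Kt]] := Ku x; exists (- t); by rewrite /S scNl opprK addrC.
have Sub x : has_ubound (S x).
  have [t [_ /KM Kt]] := Ku (- x); exists t => s Ss; exact: Mte Ss Kt.
pose g x := sup (S x).
have below t x : t < g x -> M (x - sc t e).
  move=> tg; have tg0 : 0 < g x - t by rewrite subr_gt0.
  have [s Ss ts] := sup_adherent tg0 (conj (Sne x) (Sub x)).
  move: ts; rewrite -/(g x) opprB addrCA subrr addr0 => ts.
  have := Madd _ _ Ss (Msc (s - t) _ _ Me); rewrite scDl scNl addrA addrNK; apply.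
  by rewrite subr_ge0 ltW.
have above t x : g x < t -> M (sc t e - x).
  move=> gt; case: (Mtot (x - sc t e)); last by rewrite opprB.
  by move=> h; have := ub_le_sup (Sub x) (h : S x t); rewrite leNgt gt.
have gle t x : M (sc t e - x) -> g x <= t.
  by move=> h; apply: ge_sup => // s Ss; exact: Mte Ss h.
have gge t x : M (x - sc t e) -> t <= g x by move=> h; exact: (ub_le_sup (Sub x)).
have gD x y : g (x + y) = g x + g y.
  apply/eqP; rewrite eq_le; apply/andP; split; apply/ler_addgt0Pr => d d0.
    apply: gle; have h1 : g x < g x + d / 2 by rewrite ltrDl divr_gt0.
    have h2 : g y < g y + d / 2 by rewrite ltrDl divr_gt0.
    have := Madd _ _ (above _ _ h1) (above _ _ h2).
    rewrite addrACA -scDl -opprD; congr (M (sc _ _ - _)); lra.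
  rewrite -lerBlDr; apply: gge; have h1 : g x - d / 2 < g x by rewrite ltrBlDr ltrDl divr_gt0.
  have h2 : g y - d / 2 < g y by rewrite ltrBlDr ltrDl divr_gt0.
  have := Madd _ _ (below _ _ h1) (below _ _ h2).
  rewrite addrACA -opprD -scDl; congr (M (_ - sc _ _)); lra.
have g0 : g 0 = 0 by apply: (addrI (g 0)); rewrite -gD !addr0.
have gN x : g (- x) = - g x by apply: (addrI (g x)); rewrite -gD !subrr g0.
have gpos x : M x -> 0 <= g x by move=> h; apply: gge; rewrite sc0l subr0.
have gZp t x : 0 < t -> g (sc t x) = t * g x.
  move=> t0; apply/eqP; rewrite eq_le; apply/andP; split.
    apply/ler_addgt0Pr => d d0; apply: gle.
    have h1 : g x < g x + d / t by rewrite ltrDl divr_gt0.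
    have := Msc t _ (ltW t0) (above _ _ h1).
    rewrite scDr scNr scA; congr (M (sc _ _ - _)).
    by rewrite mulrDr mulrCA divff ?mulr1 // gt_eqF.
  apply/ler_addgt0Pr => d d0; rewrite -lerBlDr; apply: gge.
  have h1 : g x - d / t < g x by rewrite ltrBlDr ltrDl divr_gt0.
  have := Msc t _ (ltW t0) (below _ _ h1).
  rewrite scDr scNr scA; congr (M (_ - sc _ _)).
  by rewrite mulrBr mulrCA divff ?mulr1 // gt_eqF.
have ge1 : g e = 1.
  have M0 : M 0 by have := Msc 0 _ (lexx 0) Me; rewrite sc0l.
  by apply/eqP; rewrite eq_le; apply/andP; split; [apply: gle|apply: gge]; rewrite sc1 subrr.
exists g; split=> //.
- move=> t x; have [t0|t0|<-] := ltgtP 0 t; first exact: gZp.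
    by rewrite -[X in sc X]opprK scNl gN gZp ?oppr_gt0 // mulNr opprK.
  by rewrite sc0l g0 mul0r.
- by move=> x /KM; exact: gpos.
- have : M (- (x0 + sc eps e)) by case: (Mtot (x0 + sc eps e)).
  move=> /gpos; rewrite gN gD gZp // ge1; lra.
Qed.
End Separation.

(** * Matrices over a complex module *)

Section MatrixOverModule.
Variable R : realType.
Local Notation C := (R[i]).
Variable V : lmodType C.

Lemma mxscaleDl m n (c d : C) (a : 'M[V]_(m, n)) :
  mxscale (c + d) a = mxscale c a + mxscale d a.
Proof. by apply/matrixP => i j; rewrite !mxE scalerDl. Qed.

Lemma mxscaleDr m n (c : C) (a b : 'M[V]_(m, n)) :
  mxscale c (a + b) = mxscale c a + mxscale c b.
Proof. by apply/matrixP => i j; rewrite !mxE scalerDr. Qed.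

Lemma mxscaleA m n (c d : C) (a : 'M[V]_(m, n)) :
  mxscale c (mxscale d a) = mxscale (c * d) a.
Proof. by apply/matrixP => i j; rewrite !mxE scalerA. Qed.

Lemma mxscale1 m n (a : 'M[V]_(m, n)) : mxscale 1 a = a.
Proof. by apply/matrixP => i j; rewrite !mxE scale1r. Qed.

Lemma mxscale0 m n (a : 'M[V]_(m, n)) : mxscale 0 a = 0.
Proof. by apply/matrixP => i j; rewrite !mxE scale0r. Qed.

Lemma mxscale_0r m n (c : C) : mxscale c (0 : 'M[V]_(m, n)) = 0.
Proof. by apply/matrixP => i j; rewrite !mxE scaler0. Qed.

Lemma mxscaleN m n (c : C) (a : 'M[V]_(m, n)) : mxscale c (- a) = - mxscale c a.
Proof. by apply/matrixP => i j; rewrite !mxE scalerN. Qed.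

Lemma mxscaleNl m n (c : C) (a : 'M[V]_(m, n)) : mxscale (- c) a = - mxscale c a.
Proof. by apply/matrixP => i j; rewrite !mxE scaleNr. Qed.

Lemma mxscaleB m n (c : C) (a b : 'M[V]_(m, n)) :
  mxscale c (a - b) = mxscale c a - mxscale c b.
Proof. by rewrite mxscaleDr mxscaleN. Qed.

Lemma mxscale2 m n (a : 'M[V]_(m, n)) : mxscale 2 a = a + a.
Proof. by rewrite -[2]/(1 + 1) mxscaleDl mxscale1. Qed.

Lemma scmxD m n (S T : 'M[C]_(m, n)) (e : V) : scmx (S + T) e = scmx S e + scmx T e.
Proof. by apply/matrixP => i j; rewrite !mxE scalerDl. Qed.

Lemma scmxDr m n (S : 'M[C]_(m, n)) (e f : V) : scmx S (e + f) = scmx S e + scmx S f.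
Proof. by apply/matrixP => i j; rewrite !mxE scalerDr. Qed.

Lemma scmxN m n (S : 'M[C]_(m, n)) (e : V) : scmx (- S) e = - scmx S e.
Proof. by apply/matrixP => i j; rewrite !mxE scaleNr. Qed.

Lemma scmxNr m n (S : 'M[C]_(m, n)) (e : V) : scmx S (- e) = - scmx S e.
Proof. by apply/matrixP => i j; rewrite !mxE scalerN. Qed.

Lemma scmxB m n (S T : 'M[C]_(m, n)) (e : V) : scmx (S - T) e = scmx S e - scmx T e.
Proof. by rewrite scmxD scmxN. Qed.

Lemma scmxZ m n (c : C) (S : 'M[C]_(m, n)) (e : V) :
  scmx (c *: S) e = mxscale c (scmx S e).
Proof. by apply/matrixP => i j; rewrite !mxE scalerA. Qed.

Lemma scmxZr m n (c : C) (S : 'M[C]_(m, n)) (e : V) :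
  scmx S (c *: e) = mxscale c (scmx S e).
Proof. by apply/matrixP => i j; rewrite !mxE !scalerA mulrC. Qed.

Lemma scmx0r m n (S : 'M[C]_(m, n)) : scmx S (0 : V) = 0.
Proof. by apply/matrixP => i j; rewrite !mxE scaler0. Qed.

Lemma scmx_delta_sum m n (a : 'M[V]_(m, n)) :
  \sum_k \sum_l scmx (delta_mx k l) (a k l) = a.
Proof.
apply/matrixP => i j; rewrite summxE (bigD1 i) //= summxE (bigD1 j) //=.
rewrite !mxE !eqxx scale1r big1 ?addr0 => [|l lj]; last first.
  by rewrite !mxE eqxx eq_sym (negPf lj) scale0r.
rewrite big1 ?addr0 // => k ki; rewrite summxE big1 // => l _.
by rewrite !mxE eq_sym (negPf ki) scale0r.
Qed.

Lemma lrmulZ m n (a : 'M[C]_(n, m)) (v : 'M[V]_m) (b : 'M[C]_(m, n)) c :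
  lrmul a (mxscale c v) b = mxscale c (lrmul a v b).
Proof.
apply/matrixP => i j; rewrite !mxE scaler_sumr; apply: eq_bigr => k _ /=.
rewrite scaler_sumr; apply: eq_bigr => l _ /=; rewrite !mxE !scalerA.
by congr (_ *: _); ring.
Qed.

Lemma lrmul1 n (v : 'M[V]_n) : lrmul 1%:M v 1%:M = v.
Proof.
apply/matrixP => i j; rewrite !mxE (bigD1 i) //= (bigD1 j) //= !mxE !eqxx.
rewrite mulr1 scale1r big1 ?addr0 => [|l /negPf lj]; last first.
  by rewrite !mxE lj mulr0 scale0r.
rewrite big1 ?addr0 // => k ki; rewrite big1 // => l _.
by rewrite !mxE eq_sym (negPf ki) mul0r scale0r.
Qed.

Lemma lrmul_scmx m n (a : 'M[C]_(n, m)) (S : 'M[C]_m) (b : 'M[C]_(m, n)) (e : V) :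
  lrmul a (scmx S e) b = scmx (a *m S *m b) e.
Proof.
apply/matrixP => i j; rewrite !mxE exchange_big scaler_suml /=; apply: eq_bigr => l _.
rewrite !mxE mulr_suml scaler_suml; apply: eq_bigr => k _.
by rewrite !mxE scalerA; congr (_ *: _); ring.
Qed.

Lemma sandwE n m (g : 'M[C]_(n, m)) (a : 'M[V]_n) : sandw g a = lrmul (ctr g) a g.
Proof.
apply/matrixP => i j; rewrite !mxE; apply: eq_bigr => k _; apply: eq_bigr => l _.
by rewrite !mxE.
Qed.

Lemma sandwZ n m (g : 'M[C]_(n, m)) (a : 'M[V]_n) c :
  sandw g (mxscale c a) = mxscale c (sandw g a).
Proof. by rewrite !sandwE lrmulZ. Qed.

Lemma sandw1 n (a : 'M[V]_n) : sandw 1%:M a = a.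
Proof. by rewrite sandwE ctr1 lrmul1. Qed.

Lemma sandw_scmx n m (g : 'M[C]_(n, m)) (S : 'M[C]_n) (e : V) :
  sandw g (scmx S e) = scmx (ctr g *m S *m g) e.
Proof. by rewrite sandwE lrmul_scmx. Qed.

Lemma sandwZl n m (g : 'M[C]_(n, m)) (a : 'M[V]_n) c :
  sandw (c *: g) a = mxscale (c^* * c) (sandw g a).
Proof.
apply/matrixP => i j; rewrite !mxE scaler_sumr; apply: eq_bigr => k _.
rewrite scaler_sumr; apply: eq_bigr => l _; rewrite !mxE cjM scalerA.
by congr (_ *: _); ring.
Qed.

Lemma sandw_const m (g : 'M[C]_(1, m)) (v : V) :
  sandw g (const_mx v) = scmx (ctr g *m g) v.
Proof.
apply/matrixP => i j; rewrite !mxE !big_ord1 !mxE; by congr (_ *: _).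
Qed.

(** Stacking the coefficients turns compression of a direct sum into a sum of compressions. This is
    what makes [ball_cone] closed under addition. *)
Lemma sandw_col n1 n2 m (g1 : 'M[C]_(n1, m)) (g2 : 'M[C]_(n2, m))
    (a : 'M[V]_n1) (b : 'M[V]_n2) :
  sandw (col_mx g1 g2) (block_mx a 0 0 b) = sandw g1 a + sandw g2 b.
Proof.
apply/matrixP => i j; rewrite !mxE big_split_ord /=; congr (_ + _).
  apply: eq_bigr => k _; rewrite big_split_ord /= [X in _ + X]big1 ?addr0.
    by apply: eq_bigr => l _; rewrite block_mxEul !col_mxEu.
  by move=> l _; rewrite block_mxEur [X in _ *: X]mxE scaler0.
apply: eq_bigr => k _; rewrite big_split_ord /= [X in X + _]big1 ?add0r.
  by apply: eq_bigr => l _; rewrite block_mxEdr !col_mxEd.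
by move=> l _; rewrite block_mxEdl [X in _ *: X]mxE scaler0.
Qed.

Lemma sandw_row n m1 m2 (g1 : 'M[C]_(n, m1)) (g2 : 'M[C]_(n, m2)) (a : 'M[V]_n) :
  sandw (row_mx g1 g2) a = block_mx (sandw g1 a)
    (\matrix_(i, j) \sum_k \sum_l (((g1 k i)^* * g2 l j) *: a k l))
    (\matrix_(i, j) \sum_k \sum_l (((g2 k i)^* * g1 l j) *: a k l)) (sandw g2 a).
Proof.
apply/matrixP => i j.
case: (split_ordP i) => i' ->; case: (split_ordP j) => j' ->;
  rewrite ?(block_mxEul, block_mxEur, block_mxEdl, block_mxEdr) !mxE;
  apply: eq_bigr => k _; apply: eq_bigr => l _;
  by rewrite ?(row_mxEl, row_mxEr).
Qed.

End MatrixOverModule.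

(** * Matrix order unit spaces *)

Section Mou.
Variable R : realType.
Local Notation C := (R[i]).
Variable V : lmodType C.
Variable D : mou_data V.
Hypothesis H : is_mou D.
Local Notation inv := (Defs.inv D).
Local Notation u := (Defs.unit D).
Local Notation pos := (Defs.pos D).
Local Notation one := (one_mx D).
Local Notation adj := (adjmx inv).

Lemma inv_lin (c : C) (v w : V) : inv (c *: v + w) = c^* *: inv v + inv w.
Proof. by case: H. Qed.

Lemma inv_invol (v : V) : inv (inv v) = v.
Proof. by case: H => _ []. Qed.

Lemma pos_herm n (a : 'M[V]_n) : pos a -> adj a = a.
Proof. by case: H => _ [_ [h _]]; exact: h. Qed.

Lemma posD n (a b : 'M[V]_n) : pos a -> pos b -> pos (a + b).
Proof. by case: H => _ [_ [_ [h _]]]; exact: h. Qed.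

Lemma posZ n (t : R) (a : 'M[V]_n) : 0 <= t -> pos a -> pos (mxscale t%:C a).
Proof. by case: H => _ [_ [_ [_ [h _]]]]; exact: h. Qed.

Lemma pos_proper n (a : 'M[V]_n) : pos a -> pos (- a) -> a = 0.
Proof. by case: H => _ [_ [_ [_ [_ [h _]]]]]; exact: h. Qed.

Lemma pos_sandw n m (g : 'M[C]_(n, m)) (a : 'M[V]_n) : pos a -> pos (sandw g a).
Proof. by case: H => _ [_ [_ [_ [_ [_ [h _]]]]]]; exact: h. Qed.

Lemma inv_unit : inv u = u.
Proof. by case: H => _ [_ [_ [_ [_ [_ [_ [h _]]]]]]]. Qed.

Lemma unit_order (v : V) : inv v = v -> exists t : R, 0 < t /\
  pos (const_mx (t%:C *: u - v) : 'M[V]_1) /\ pos (const_mx (t%:C *: u + v) : 'M[V]_1).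
Proof. by case: H => _ [_ [_ [_ [_ [_ [_ [_ [h _]]]]]]]]; exact: h. Qed.

Lemma pos_arch n (a : 'M[V]_n) : adj a = a ->
  (forall eps : R, 0 < eps -> pos (a + mxscale eps%:C (one n))) -> pos a.
Proof. by case: H => _ [_ [_ [_ [_ [_ [_ [_ [_ h]]]]]]]]; exact: h. Qed.

Lemma inv_0 : inv 0 = 0.
Proof.
have := inv_lin 1 0 0; rewrite cj1 !scale1r addr0 => h.
by apply: (addrI (inv 0)); rewrite -h addr0.
Qed.

Lemma inv_D (v w : V) : inv (v + w) = inv v + inv w.
Proof. by rewrite -{1}[v]scale1r inv_lin cj1 scale1r. Qed.

Lemma inv_Z (c : C) (v : V) : inv (c *: v) = c^* *: inv v.
Proof. by rewrite -[c *: v]addr0 inv_lin inv_0 addr0. Qed.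

Lemma inv_N (v : V) : inv (- v) = - inv v.
Proof. by rewrite -scaleN1r inv_Z cjN cj1 scaleN1r. Qed.

Lemma adjmxD n (a b : 'M[V]_n) : adj (a + b) = adj a + adj b.
Proof. by apply/matrixP => i j; rewrite !mxE inv_D. Qed.

Lemma adjmxZ n (c : C) (a : 'M[V]_n) : adj (mxscale c a) = mxscale c^* (adj a).
Proof. by apply/matrixP => i j; rewrite !mxE inv_Z. Qed.

Lemma adjmxZr n (t : R) (a : 'M[V]_n) : adj (mxscale t%:C a) = mxscale t%:C (adj a).
Proof. by rewrite adjmxZ conj_real. Qed.

Lemma adjmxN n (a : 'M[V]_n) : adj (- a) = - adj a.
Proof. by rewrite -[in LHS](mxscale1 a) -mxscaleNl adjmxZ cjN cj1 mxscaleNl mxscale1. Qed.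

Lemma adjmxB n (a b : 'M[V]_n) : adj (a - b) = adj a - adj b.
Proof. by rewrite adjmxD adjmxN. Qed.

Lemma adjmxK n (a : 'M[V]_n) : adj (adj a) = a.
Proof. by apply/matrixP => i j; rewrite !mxE inv_invol. Qed.

Lemma adj_scmx n (S : 'M[C]_n) (v : V) : adj (scmx S v) = scmx (ctr S) (inv v).
Proof. by apply/matrixP => i j; rewrite !mxE inv_Z. Qed.

Lemma adj_one n : adj (one n) = one n.
Proof. by rewrite /one_mx adj_scmx ctr1 inv_unit. Qed.

Lemma inv_sum (I : Type) (r : seq I) (P : pred I) (F : I -> V) :
  inv (\sum_(i <- r | P i) F i) = \sum_(i <- r | P i) inv (F i).
Proof. by apply: (big_morph inv inv_D inv_0). Qed.

Lemma adj_sandw n m (g : 'M[C]_(n, m)) (a : 'M[V]_n) : adj (sandw g a) = sandw g (adj a).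
Proof.
apply/matrixP => i j; rewrite !mxE inv_sum.
under eq_bigr => k _ do rewrite inv_sum.
rewrite exchange_big; apply: eq_bigr => k _; apply: eq_bigr => l _.
by rewrite !mxE inv_Z cjM conjCK mulrC.
Qed.

Lemma one1 : one 1 = const_mx u.
Proof. by apply/matrixP => i j; rewrite !mxE !ord1 eqxx scale1r. Qed.

(** Positivity of 0 is not an axiom: a positive element exists at size 1 because 0 is dominated by a
    multiple of the unit, it is scaled to 0, and a compression reaches every size. *)
Lemma pos0 n : pos (0 : 'M[V]_n).
Proof.
have [t [t0 [h _]]] := unit_order inv_0.
have h0 : pos (0 : 'M[V]_1) by have := posZ (lexx 0) h; rewrite mxscale0.
have := pos_sandw (0 : 'M_(1, n)) h0.
by rewrite -[X in sandw _ X](mxscale0 0) sandwZ mxscale0.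
Qed.

Lemma pos_one1 : pos (one 1).
Proof.
have [t [t0 [h _]]] := unit_order inv_0.
have ti : 0 <= t^-1 by rewrite invr_ge0 ltW.
have := posZ ti h; rewrite one1; congr (pos _).
apply/matrixP => i j; rewrite !mxE subr0 scalerA -rmorphM mulVf ?gt_eqF //.
by rewrite scale1r.
Qed.

Lemma pos_sum (I : finType) n (F : I -> 'M[V]_n) :
  (forall i, pos (F i)) -> pos (\sum_i F i).
Proof. by move=> h; elim/big_ind: _ => [|a b|//]; [exact: pos0|exact: posD]. Qed.

Lemma delta_ctr n (k : 'I_n) :
  ctr (delta_mx 0 k : 'M[C]_(1, n)) *m delta_mx 0 k = delta_mx k k.
Proof.
have -> : ctr (delta_mx 0 k : 'M[C]_(1, n)) = delta_mx k 0.
  by apply/matrixP => i j; rewrite !mxE cj_nat andbC.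
by rewrite mul_delta_mx.
Qed.

Lemma pos_scalar1 n (v : V) : pos (const_mx v : 'M_1) -> pos (scmx (1%:M : 'M[C]_n) v).
Proof.
move=> pv; have -> : scmx (1%:M : 'M[C]_n) v =
    \sum_k sandw (delta_mx 0 k : 'M[C]_(1, n)) (const_mx v).
  rewrite -[LHS]scmx_delta_sum; apply: eq_bigr => k _; rewrite sandw_const delta_ctr.
  rewrite (bigD1 k) //= big1 ?addr0 => [|l lk]; first by rewrite !mxE eqxx scale1r.
  by rewrite !mxE eq_sym (negPf lk) scale0r scmx0r.
by apply: pos_sum => k; exact: pos_sandw.
Qed.

Lemma pos_one n : pos (one n).
Proof. by apply: pos_scalar1; rewrite -one1; exact: pos_one1. Qed.

(** Writing S as the adjoint of T times T presents S tensor v as the compression by T of the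
    diagonal matrix with entries v. *)
Lemma pos_psd n (S : 'M[C]_n) (v : V) : pos (const_mx v : 'M_1) -> psd (fun i j => S i j) ->
  pos (scmx S v).
Proof.
move=> pv /psd_factor [T ->].
have := pos_sandw T (@pos_scalar1 n _ pv); by rewrite sandw_scmx mulmx1.
Qed.

Lemma herm_bound n (S : 'M[C]_n) : ctr S = S ->
  exists2 c : R, 0 <= c & psd (fun i j => (c%:C%:M - S) i j).
Proof.
move=> hS; exists (opn (fun i j => S i j)); first exact: opn_ge0.
have hS' i j : S i j = (S j i)^* by rewrite -{1}hS mxE.
apply/psdP => x; set c := opn _.
have -> : sform (fun i j => (c%:C%:M - S) i j) x x =
    (c * vn2 x)%:C - sform (fun i j => S i j) x x.
  rewrite rmorphM /= vn2E -sform_scalar -sformB; apply: eq_sform => i j.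
  by rewrite mxE [X in _ + X]mxE.
have := sform_herm hS' x x; move: (opn_sform x x (lexx c)).
set z := sform _ x x => h1 h2.
have {h2} : z = (complex.Re z)%:C.
  case: z h2 {h1} => a b [] /= /eqP; rewrite -subr_eq0 opprK -mulr2n mulrn_eq0 /=.
  by move=> /eqP ->.
move=> ->; rewrite -rmorphB ler0c; have := Re_le_cabs z; lra.
Qed.

Lemma herm_split (v : V) : exists h1 h2, [/\ inv h1 = h1, inv h2 = h2 & v = h1 + 'i *: h2].
Proof.
exists (2^-1 *: (v + inv v)), (2^-1 *: (- ('i *: (v - inv v)))).
have h2 : (2^-1)^* = 2^-1 :> C by rewrite -[2^-1]div1r rmorphM rmorph1 fmorphV rmorph_nat.
split.
- by rewrite inv_Z inv_D inv_invol h2 addrC.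
- rewrite !(inv_Z, inv_N) h2 conjCi inv_D inv_N inv_invol -[inv v - v]opprB.
  by congr (_ *: - _); rewrite scaleNr scalerN opprK.
rewrite scalerA mulrC -scalerA scalerN scalerA -expr2 sqrCi scaleN1r opprK -scalerDr.
by rewrite addrACA subrr addr0 -(mulr2n v) -(scaler_nat 2 v) scalerA mulVf ?scale1r // pnatr_eq0.
Qed.

Let bdd n (a : 'M[V]_n) := exists2 t : R, 0 <= t & pos (mxscale t%:C (one n) + a).

Let bddD n (a b : 'M[V]_n) : bdd a -> bdd b -> bdd (a + b).
Proof.
move=> [t t0 ha] [s s0 hb]; exists (t + s); first exact: addr_ge0.
by rewrite rmorphD mxscaleDl addrACA; exact: posD.
Qed.

Let bdd_pos n (a : 'M[V]_n) : pos a -> bdd a.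
Proof. by move=> h; exists 0 => //; rewrite mxscale0 add0r. Qed.

Let bdd_const n (s : R) (v : V) : 0 <= s -> inv v = v -> bdd (scmx (s%:C%:M : 'M[C]_n) v).
Proof.
move=> s0 hv; have [t [t0 [_ h]]] := unit_order hv.
exists (s * t); first by rewrite mulr_ge0 // ltW.
have := posZ s0 (@pos_scalar1 n _ h); congr (pos _).
rewrite scmxDr scmxZr mxscaleDr mxscaleA -rmorphM; congr (_ + _).
by rewrite -scmxZ scalemx1.
Qed.

Let bdd_psd n (S : 'M[C]_n) (v : V) : inv v = v -> psd (fun i j => S i j) -> bdd (scmx S v).
Proof.
move=> hv hS; have [t [t0 [_ h]]] := unit_order hv.
have hp := pos_psd h hS.
have hS' : ctr S = S by apply/matrixP => i j; rewrite mxE -(psd_herm hS).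
have [c c0 hc] := herm_bound hS'.
have h1 := pos_psd _ hc; have := h1 u; rewrite -one1 => /(_ pos_one1) h2.
exists (t * c); first by rewrite mulr_ge0 // ltW.
have := posD hp (posZ (ltW t0) h2); congr (pos _).
rewrite scmxB mxscaleB scmxDr scmxZr addrC addrA addrNK; congr (_ + _).
by rewrite -(scalemx1 _ c%:C) scmxZ mxscaleA -rmorphM.
Qed.

Let bdd_herm n (S : 'M[C]_n) (v : V) : inv v = v -> ctr S = S -> bdd (scmx S v).
Proof.
move=> hv hS; have hN : ctr (- S) = - S.
  by rewrite -[in RHS]hS; apply/matrixP => i j; rewrite !mxE cjN.
have [c c0] := herm_bound hN; rewrite opprK => hc.
have hnv : inv (- v) = - v by rewrite inv_N hv.
have := bddD (bdd_psd hv hc) (bdd_const n c0 hnv).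
by rewrite scmxNr scmxD addrAC subrr add0r.
Qed.

(** The axioms give an order unit only at size 1. Since a is selfadjoint, a + a is a sum of terms S
    tensor h with S a hermitian scalar matrix and h selfadjoint in V: E_kl + E_lk goes with the real
    part of the entry, i E_kl - i E_lk with its imaginary part. Each such term is bounded below by a
    multiple of the unit. *)
Lemma order_unit n (a : 'M[V]_n) : adj a = a ->
  exists2 t : R, 0 <= t & pos (mxscale t%:C (one n) + a).
Proof.
move=> ha; have : bdd (a + a).
  have -> : a + a = \sum_k \sum_l (scmx (delta_mx k l) (a k l) + scmx (delta_mx l k) (inv (a k l))).
    under eq_bigr => k _ do rewrite big_split /=.
    rewrite big_split /= scmx_delta_sum exchange_big /= -[in LHS]ha.
    rewrite -{1}[adj a]scmx_delta_sum {2}ha addrC; congr (_ + _).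
    by apply: eq_bigr => k _; apply: eq_bigr => l _; rewrite mxE.
  have bsum (F : 'I_n -> 'M[V]_n) : (forall k, bdd (F k)) -> bdd (\sum_k F k).
    move=> h; elim/big_ind: _ => [|x y|//]; [exact/bdd_pos/pos0|exact: bddD].
  apply: (bsum) => k; apply: (bsum) => l.
  have [h1 [h2 [e1 e2 ->]]] := herm_split (a k l).
  have -> : scmx (delta_mx k l) (h1 + 'i *: h2) + scmx (delta_mx l k) (inv (h1 + 'i *: h2)) =
      scmx (delta_mx k l + delta_mx l k : 'M[C]_n) h1
      + scmx ('i *: delta_mx k l - 'i *: delta_mx l k : 'M[C]_n) h2.
    rewrite inv_D inv_Z e1 e2 conjCi !scmxDr !scmxD scmxN !scmxZr !scmxZ mxscaleNl.
    by rewrite addrACA.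
  apply: bddD; apply: bdd_herm => //; apply/matrixP => i j; rewrite !mxE.
    by rewrite cjD !cj_nat addrC ![(j == _) && _]andbC.
  rewrite cjB !cjM !cj_nat !conjCi !mulNr opprK addrC.
  by rewrite ![(j == _) && _]andbC.
move=> [t t0 ht]; have h2 : 0 <= 2^-1 :> R by rewrite invr_ge0.
exists (2^-1 * t); first by rewrite mulr_ge0.
have := posZ h2 ht; congr (pos _); rewrite mxscaleDr mxscaleA -rmorphM; congr (_ + _).
rewrite -mxscale2 mxscaleA -[X in _ * X](rmorph_nat (real_complex R)) -rmorphM.
by rewrite /= mulVf ?mxscale1 // pnatr_eq0.
Qed.
End Mou.

(** * Completely positive maps *)

Section LinearMaps.
Variable R : realType.
Local Notation C := (R[i]).
Variable V : lmodType C.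

Definition lin {n} (phi : V -> 'M[C]_n) :=
  forall (c : C) v w, phi (c *: v + w) = c *: phi v + phi w.

Section Lin.
Variables (n : nat) (phi : V -> 'M[C]_n).
Hypothesis L : lin phi.

Lemma lin0 : phi 0 = 0.
Proof.
have := L 1 0 0; rewrite !scale1r addr0 => h.
by apply: (addrI (phi 0)); rewrite -h addr0.
Qed.

Lemma linD v w : phi (v + w) = phi v + phi w.
Proof. by rewrite -[v in LHS]scale1r L scale1r. Qed.

Lemma linZ c v : phi (c *: v) = c *: phi v.
Proof. by rewrite -[_ *: v]addr0 L lin0 addr0. Qed.

Lemma linN v : phi (- v) = - phi v.
Proof. by rewrite -scaleN1r linZ scaleN1r. Qed.

Lemma linB v w : phi (v - w) = phi v - phi w.
Proof. by rewrite linD linN. Qed.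

Lemma amplD r (a b : 'M[V]_r) p q : ampl phi (a + b) p q = ampl phi a p q + ampl phi b p q.
Proof. by rewrite /ampl mxE linD mxE. Qed.

Lemma amplB r (a b : 'M[V]_r) p q : ampl phi (a - b) p q = ampl phi a p q - ampl phi b p q.
Proof. by rewrite /ampl !mxE linB !mxE. Qed.

Lemma amplZ r c (a : 'M[V]_r) p q : ampl phi (mxscale c a) p q = c * ampl phi a p q.
Proof. by rewrite /ampl mxE linZ mxE. Qed.

Lemma ampl_scmx r (S : 'M[C]_r) v p q : ampl phi (scmx S v) p q = S p.1 q.1 * phi v p.2 q.2.
Proof. by rewrite /ampl mxE linZ mxE. Qed.

Lemma sform_amplZ r c (a : 'M[V]_r) x y :
  sform (ampl phi (mxscale c a)) x y = c * sform (ampl phi a) x y.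
Proof. by rewrite -sformZ; apply: eq_sform => p q; rewrite amplZ. Qed.

End Lin.

Lemma pair_sum (W : nmodType) (I J : finType) (F : I * J -> W) :
  \sum_p F p = \sum_i \sum_j F (i, j).
Proof. by rewrite pair_bigA; apply: eq_bigr => -[i j]. Qed.

Lemma big_split_pair n1 n2 m (F : 'I_(n1 + n2) * 'I_m -> C) :
  \sum_p F p = \sum_p F (lshift n2 p.1, p.2) + \sum_p F (rshift n1 p.1, p.2).
Proof.
by rewrite !pair_sum big_split_ord.
Qed.

Section Block.
Variables (n1 n2 m : nat).
Definition lpart (x : 'I_(n1 + n2) * 'I_m -> C) p := x (lshift n2 p.1, p.2).
Definition rpart (x : 'I_(n1 + n2) * 'I_m -> C) p := x (rshift n1 p.1, p.2).
Definition gluev (x : 'I_n1 * 'I_m -> C) (y : 'I_n2 * 'I_m -> C) (p : 'I_(n1 + n2) * 'I_m) :=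
  match fintype.split p.1 with inl i => x (i, p.2) | inr i => y (i, p.2) end.

Lemma lpart_gluev x y p : lpart (gluev x y) p = x p.
Proof. by rewrite /lpart /gluev /= (unsplitK (inl _)); case: p. Qed.

Lemma rpart_gluev x y p : rpart (gluev x y) p = y p.
Proof. by rewrite /rpart /gluev /= (unsplitK (inr _)); case: p. Qed.

End Block.

Lemma vn2_parts n1 n2 m (x : 'I_(n1 + n2) * 'I_m -> C) : vn2 x = vn2 (lpart x) + vn2 (rpart x).
Proof.
apply: complexI; rewrite rmorphD /= !vn2E; exact: big_split_pair.
Qed.

Lemma vn2_gluev n1 n2 m (x : 'I_n1 * 'I_m -> C) (y : 'I_n2 * 'I_m -> C) :
  vn2 (gluev x y) = vn2 x + vn2 y.
Proof.
rewrite vn2_parts; congr (_ + _); apply: eq_bigr => p _.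
  by rewrite lpart_gluev.
by rewrite rpart_gluev.
Qed.

Lemma sform_block m (phi : V -> 'M[C]_m) n (a b c d : 'M[V]_n) x y :
  sform (ampl phi (block_mx a b c d)) x y =
   sform (ampl phi a) (lpart x) (lpart y) + sform (ampl phi b) (lpart x) (rpart y) +
   (sform (ampl phi c) (rpart x) (lpart y) + sform (ampl phi d) (rpart x) (rpart y)).
Proof.
rewrite {1}/sform big_split_pair; congr (_ + _); rewrite -big_split /=;
  apply: eq_bigr => p _; rewrite big_split_pair /=; congr (_ + _);
  apply: eq_bigr => q _; rewrite /ampl /=.
- by rewrite block_mxEul.
- by rewrite block_mxEur.
- by rewrite block_mxEdl.
- by rewrite block_mxEdr.
Qed.

End LinearMaps.

Section CP.
Variable R : realType.
Local Notation C := (R[i]).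
Variable V : lmodType C.
Variable D : mou_data V.
Hypothesis H : is_mou D.
Local Notation inv := (Defs.inv D).
Local Notation u := (Defs.unit D).
Local Notation pos := (Defs.pos D).
Local Notation one := (one_mx D).
Local Notation adj := (adjmx inv).

Definition cp {n} (phi : V -> 'M[C]_n) :=
  lin phi /\ (forall r (a : 'M[V]_r), pos a -> psd (ampl phi a)).

Lemma CS_cp n (phi : V -> 'M[C]_n) : CS D phi <-> cp phi /\ phi u = 1%:M.
Proof. by split=> [[h1 h2 h3]|[[h1 h2] h3]]; split. Qed.

Lemma sform_const n (phi : V -> 'M[C]_n) v x y :
  sform (ampl phi (const_mx v : 'M_1)) x y =
  sform (fun k l => phi v k l) (fun k => x (ord0, k)) (fun l => y (ord0, l)).
Proof.
rewrite /sform pair_sum big_ord1; apply: eq_bigr => k _.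
by rewrite pair_sum big_ord1; apply: eq_bigr => l _; rewrite /ampl mxE.
Qed.

Lemma cp_psd1 n (phi : V -> 'M[C]_n) v : cp phi -> pos (const_mx v : 'M_1) ->
  psd (fun k l => phi v k l).
Proof.
move=> [_ h] /h /psdP hp; apply/psdP => x.
by have := hp (fun p => x p.2); rewrite sform_const.
Qed.

Lemma cp_unit_psd n (phi : V -> 'M[C]_n) : cp phi -> psd (fun k l => phi u k l).
Proof. by move=> h; apply: cp_psd1 => //; rewrite -one1; exact: pos_one1. Qed.

(** A selfadjoint h is the difference of the positive elements t u + h and t u, whose images are
    hermitian; the general case follows by splitting v into real and imaginary parts. *)
Lemma cp_inv n (phi : V -> 'M[C]_n) v : cp phi -> phi (inv v) = ctr (phi v).
Proof.
move=> hphi; have [L _] := hphi.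
have herm h : inv h = h -> ctr (phi h) = phi h.
  move=> hh; have [t [t0 [_ hp]]] := unit_order H hh.
  have h1 := psd_herm (cp_psd1 hphi hp); have h2 := psd_herm (cp_unit_psd hphi).
  apply/matrixP => i j; rewrite mxE.
  have := h1 i j; rewrite (L _ _ h) !mxE cjD cjM conj_real -h2 => /addrI.
  by move=> ->.
have [h1 [h2 [e1 e2 ->]]] := herm_split H v.
rewrite (inv_D H) (inv_Z H) e1 e2 !(linD L) !(linZ L) -{1}(herm _ e1) -{1}(herm _ e2).
by apply/matrixP => i j; rewrite !mxE cjD cjM.
Qed.

Lemma cp_adj n (phi : V -> 'M[C]_n) r (a : 'M[V]_r) p q : cp phi ->
  ampl phi (adj a) p q = (ampl phi a q p)^*.
Proof. by move=> h; rewrite /ampl mxE cp_inv // mxE. Qed.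

Lemma sform_adj n (phi : V -> 'M[C]_n) r (a : 'M[V]_r) x y : cp phi ->
  sform (ampl phi (adj a)) x y = (sform (ampl phi a) y x)^*.
Proof.
move=> h; rewrite /sform exchange_big cj_sum; apply: eq_bigr => j _ /=.
rewrite cj_sum; apply: eq_bigr => i _; rewrite cp_adj // !cjM conjCK; ring.
Qed.

Lemma cp_add n (phi psi : V -> 'M[C]_n) : cp phi -> cp psi -> cp (fun v => phi v + psi v).
Proof.
move=> [L1 h1] [L2 h2]; split=> [c v w|r a pa].
  by rewrite L1 L2 scalerDr addrACA.
apply: eq_psd (psdD (h1 _ _ pa) (h2 _ _ pa)) => p q; by rewrite /ampl mxE.
Qed.

Lemma cp_scale n (t : R) (phi : V -> 'M[C]_n) : 0 <= t -> cp phi ->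
  cp (fun v => t%:C *: phi v).
Proof.
move=> t0 [L1 h1]; split=> [c v w|r a pa].
  by rewrite L1 scalerDr !scalerA mulrC.
have t0' : 0 <= t%:C :> C by rewrite ler0c.
apply: eq_psd (psdZ t0' (h1 _ _ pa)) => p q; by rewrite /ampl mxE.
Qed.

Lemma cp_sum (I : finType) n (F : I -> V -> 'M[C]_n) : (forall i, cp (F i)) ->
  cp (fun v => \sum_i F i v).
Proof.
move=> h; split=> [c v w|r a pa].
  by rewrite scaler_sumr -big_split; apply: eq_bigr => i _; have [L _] := h i; rewrite L.
have hp i := (h i).2 _ _ pa.
by apply: eq_psd (psd_sum hp) => p q; rewrite /ampl summxE.
Qed.

Definition vmul n m r (T : 'M[C]_(n, m)) (x : 'I_r * 'I_m -> C) : 'I_r * 'I_n -> C :=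
  fun p => \sum_l T p.2 l * x (p.1, l).

Lemma sform_conj n m r (phi : V -> 'M[C]_n) (T : 'M[C]_(n, m)) (a : 'M[V]_r) x y :
  sform (ampl (fun v => ctr T *m phi v *m T) a) x y =
  sform (ampl phi a) (vmul T x) (vmul T y).
Proof.
transitivity (\sum_i \sum_j sform (fun k l => (ctr T *m phi (a i j) *m T) k l)
   (fun k => x (i, k)) (fun l => y (j, l))).
  rewrite /sform pair_sum.
  apply: eq_bigr => i _ /=; rewrite [RHS]exchange_big /=; apply: eq_bigr => k _.
  by rewrite pair_sum.
transitivity (\sum_i \sum_j sform (fun k l => phi (a i j) k l)
   (fun k => vmul T x (i, k)) (fun l => vmul T y (j, l))); last first.
  symmetry.
  rewrite /sform pair_sum.
  apply: eq_bigr => i _ /=; rewrite [RHS]exchange_big /=; apply: eq_bigr => k _.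
  by rewrite pair_sum.
apply: eq_bigr => i _; apply: eq_bigr => j _; rewrite !sform_mx.
have e (z : 'I_r * 'I_m -> C) i0 : \col_k vmul T z (i0, k) = T *m \col_k z (i0, k).
  by apply/matrixP => k l; rewrite !mxE; apply: eq_bigr => s _; rewrite !mxE.
by rewrite !e ctrM !mulmxA.
Qed.

Lemma cp_conj n m (phi : V -> 'M[C]_n) (T : 'M[C]_(n, m)) : cp phi ->
  cp (fun v => ctr T *m phi v *m T).
Proof.
move=> [L h]; split=> [c v w|r a pa].
  by rewrite L mulmxDr mulmxDl -scalemxAr -scalemxAl.
by apply/psdP => x; rewrite sform_conj; exact: h.
Qed.

(** The map is a sum of compressions by the matrix units. Its value at the unit is a scalar matrix,
    which makes it the perturbation used whenever an image of the unit has to become invertible. *)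
Lemma cp_trace n m (phi : V -> 'M[C]_n) : cp phi -> cp (fun v => (\tr (phi v))%:M : 'M[C]_m).
Proof.
move=> h; have := @cp_sum _ _ (fun (kl : 'I_n * 'I_m) v =>
  ctr (delta_mx kl.1 kl.2 : 'M[C]_(n, m)) *m phi v *m delta_mx kl.1 kl.2)
  (fun kl => cp_conj _ h).
congr cp; apply/funext => v.
rewrite pair_sum /=.
apply/matrixP => i j; rewrite summxE !mxE /mxtrace.
transitivity (\sum_k (phi v k k *+ (i == j))); last by rewrite -sumrMnl.
apply: eq_bigr => k _; rewrite summxE (bigD1 i) //= big1 ?addr0 => [|l li].
  rewrite !mxE (bigD1 k) //= big1 ?addr0 => [|s sk]; last by rewrite [X in _ * X]mxE (negPf sk) mulr0.
  rewrite !mxE eqxx /= (bigD1 k) //= big1 ?addr0 => [|s sk].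
    by rewrite !mxE !eqxx cj1 mul1r eq_sym mulr_natr.
  by rewrite !mxE (negPf sk) cj0 mul0r.
rewrite !mxE big1 // => s _; rewrite !mxE big1 ?mul0r // => t _.
by rewrite !mxE [i == l]eq_sym (negPf li) andbF cj0 mul0r.
Qed.
End CP.

(** * Positivity and norms via matrix states *)

Section Duality.
Variable R : realType.
Local Notation C := (R[i]).
Variable V : lmodType C.
Variable D : mou_data V.
Hypothesis H : is_mou D.
Local Notation inv := (Defs.inv D).
Local Notation u := (Defs.unit D).
Local Notation pos := (Defs.pos D).
Local Notation one := (one_mx D).
Local Notation adj := (adjmx inv).

(** Reads a vector of C^r tensor C^n as an r by n matrix, so that the form of an amplified map at xi
    becomes a functional at the compression by [gam xi]. *)
Definition gam n r (xi : 'I_r * 'I_n -> C) : 'M[C]_(r, n) := \matrix_(i, k) xi (i, k).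
(** The vectorised identity, that is, the sum of the e_i tensor e_i. At this vector the form of the
    map built from a functional returns the functional itself. *)
Definition eta (n : nat) : 'I_n * 'I_n -> C := fun p => (p.1 == p.2)%:R.

Arguments eta : clear implicits.

Lemma gam_eta n : gam (eta n) = 1%:M.
Proof. by apply/matrixP => i j; rewrite !mxE. Qed.

Lemma sform_eta n (phi : V -> 'M[C]_n) (a : 'M[V]_n) :
  sform (ampl phi a) (eta n) (eta n) = \sum_k \sum_l phi (a k l) k l.
Proof.
rewrite /sform pair_sum; apply: eq_bigr => i _; rewrite (bigD1 i) //=.
rewrite [X in _ + X]big1 ?addr0 => [|k ki]; last first.
  by apply: big1 => q _; rewrite /eta /= eq_sym (negPf ki) cj0 !mul0r.
rewrite pair_sum; apply: eq_bigr => j _; rewrite (bigD1 j) //=.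
rewrite [X in _ + X]big1 ?addr0 => [|k kj]; last by rewrite /eta /= [j == k]eq_sym (negPf kj) mulr0.
by rewrite /eta /= !eqxx cj1 mul1r mulr1.
Qed.

Section Functional.
Variables (n : nat) (g : 'M[V]_n -> R).
Hypothesis gD : forall x y, g (x + y) = g x + g y.
Hypothesis gZ : forall (t : R) x, g (mxscale t%:C x) = t * g x.
Hypothesis gpos : forall x, pos x -> 0 <= g x.
Hypothesis ganti : forall x, adj x = - x -> g x = 0.

Let f (y : 'M[V]_n) : C := Complex (g y) (- g (mxscale 'i y)).

Let fD x y : f (x + y) = f x + f y.
Proof. by rewrite /f mxscaleDr !gD opprD. Qed.

Let f0 : f 0 = 0.
Proof. by apply: (addrI (f 0)); rewrite -fD !addr0. Qed.

Let fsum (I : finType) (F : I -> 'M[V]_n) : f (\sum_i F i) = \sum_i f (F i).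
Proof. by apply: (big_morph f fD f0). Qed.

Let fZ c y : f (mxscale c y) = c * f y.
Proof.
have e : mxscale c y = mxscale (complex.Re c)%:C y + mxscale (complex.Im c)%:C (mxscale 'i y).
  by rewrite mxscaleA -mxscaleDl mulrC -complexiE -complexE.
rewrite /f e gD !gZ mxscaleDr gD !mxscaleA ![_ * _%:C]mulrC -!mxscaleA !gZ.
have -> : mxscale 'i (mxscale 'i y) = mxscale (-1)%:C y.
  by rewrite mxscaleA -expr2 sqrCi rmorphN rmorph1.
rewrite gZ; case: c {e} => a b /=; congr Complex; ring.
Qed.

(** For positive y the matrix i y is skew-adjoint, so the imaginary part of f vanishes at y. *)
Let fpos y : pos y -> 0 <= f y.
Proof.
move=> py; rewrite /f (ganti (x := mxscale 'i y)).
  by rewrite oppr0 complexr0 ler0c gpos.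
by rewrite (adjmxZ H) conjCi (pos_herm H py) mxscaleNl.
Qed.

(* phi v has (k, l) entry f (E_kl v), with f the complexification of g. *)
Lemma functional_cp : exists2 phi : V -> 'M[C]_n, cp D phi &
  forall r (x : 'M[V]_r) xi, complex.Re (sform (ampl phi x) xi xi) = g (sandw (gam xi) x).
Proof.
pose phi v : 'M[C]_n := \matrix_(k, l) f (scmx (delta_mx k l) v).
have key r (x : 'M[V]_r) xi : sform (ampl phi x) xi xi = f (sandw (gam xi) x).
  have -> : sandw (gam xi) x = \sum_p \sum_q
      mxscale ((xi p)^* * xi q) (scmx (delta_mx p.2 q.2) (x p.1 q.1)).
    apply/matrixP => k l; rewrite !mxE summxE pair_sum; apply: eq_bigr => i _.
    rewrite (bigD1 k) //= [X in _ + X]big1 ?addr0 => [|k' kk]; last first.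
      by rewrite summxE big1 // => q _; rewrite !mxE eq_sym (negPf kk) scale0r scaler0.
    rewrite summxE pair_sum; apply: eq_bigr => j _.
    rewrite (bigD1 l) //= [X in _ + X]big1 ?addr0 => [|l' ll]; last first.
      by rewrite !mxE [l == _]eq_sym (negPf ll) andbF scale0r scaler0.
    by rewrite !mxE !eqxx scale1r.
  rewrite fsum; apply: eq_bigr => p _; rewrite fsum; apply: eq_bigr => q _.
  by rewrite fZ /ampl mxE mulrAC.
exists phi.
  split=> [c v w|r a pa].
    by apply/matrixP => k l; rewrite !mxE scmxDr scmxZr fD fZ.
  by apply/psdP => x; rewrite key fpos //; exact: pos_sandw.
by move=> r x xi; rewrite key.
Qed.
End Functional.

Lemma cp_normalize n (phi : V -> 'M[C]_n) (Q : 'M[C]_n) : cp D phi -> Q \in unitmx ->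
  phi u = ctr Q *m Q -> CS D (fun v => ctr (invmx Q) *m phi v *m invmx Q).
Proof.
move=> hphi Qu e; apply/CS_cp; split; first exact: cp_conj.
by rewrite e !mulmxA -ctrM mulmxV // ctr1 mul1mx mulmxV.
Qed.

Lemma vmul_inv n r (Q : 'M[C]_n) (x : 'I_r * 'I_n -> C) p : Q \in unitmx ->
  vmul (invmx Q) (vmul Q x) p = x p.
Proof.
move=> Qu; rewrite /vmul /=.
transitivity (((invmx Q *m Q) *m \col_k x (p.1, k)) p.2 0).
  rewrite -mulmxA mxE; apply: eq_bigr => k _; congr (_ * _); rewrite mxE.
  by apply: eq_bigr => l _; rewrite mxE.
by rewrite mulVmx // mul1mx mxE; case: p.
Qed.

Lemma psd_perturb n (P : 'M[C]_n) (del : R) : psd (fun i j => P i j) -> 0 < del ->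
  exists2 Q : 'M[C]_n, Q \in unitmx & P + del%:C%:M = ctr Q *m Q.
Proof.
move=> hP d0; have d0' : 0 <= del%:C :> C by rewrite ler0c ltW.
have h1 : psd (fun i j => (P + del%:C%:M) i j).
  have := psdD hP (psdZ d0' (@psd_ctrM _ _ _ (1%:M : 'M[C]_n))).
  apply: eq_psd => i j; rewrite ctr1 mulmx1 [RHS]mxE; congr (_ + _).
  by rewrite !mxE mulr_natr.
have [Q e] := psd_factor h1; exists Q => //.
by apply: (unit_ctrM d0); rewrite -e addrK.
Qed.

Lemma sform_one n m (phi : V -> 'M[C]_m) x y : lin phi -> 
  sform (ampl phi (one n)) x y = \sum_i sform (fun k l => phi u k l)
    (fun k => x (i, k)) (fun k => y (i, k)).
Proof.
move=> L; rewrite /sform pair_sum; apply: eq_bigr => i _; apply: eq_bigr => k _.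
rewrite pair_sum (bigD1 i) //= [X in _ + X]big1 ?addr0 => [|j ji]; last first.
  by rewrite big1 // => l _; rewrite ampl_scmx //= mxE eq_sym (negPf ji) mul0r mulr0 mul0r.
by apply: eq_bigr => l _; rewrite ampl_scmx //= mxE eqxx mul1r.
Qed.

Lemma sform_one_CS n m (phi : V -> 'M[C]_m) (x : 'I_n * 'I_m -> C) : CS D phi ->
  sform (ampl phi (one n)) x x = (vn2 x)%:C.
Proof.
move=> [L e _]; rewrite sform_one // e vn2E pair_sum; apply: eq_bigr => i _.
rewrite (sform_scalar 1) mul1r //.
Qed.

Let mxs n (t : R) (x : 'M[V]_n) := mxscale t%:C x.

Lemma mxsDl n (a b : R) (x : 'M[V]_n) : mxs (a + b) x = mxs a x + mxs b x.
Proof. by rewrite /mxs rmorphD mxscaleDl. Qed.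
Lemma mxsA n (a b : R) (x : 'M[V]_n) : mxs a (mxs b x) = mxs (a * b) x.
Proof. by rewrite /mxs rmorphM mxscaleA. Qed.
Lemma mxs1 n (x : 'M[V]_n) : mxs 1 x = x.
Proof. exact: mxscale1. Qed.

(** Twice the selfadjoint part. Cones defined through it live in all of M_n(V) and contain every
    skew-adjoint matrix with both signs, so a functional nonnegative on them vanishes on
    skew-adjoint matrices, and no separate type of selfadjoint matrices is needed. *)
Definition re2 n (x : 'M[V]_n) := x + adj x.

Lemma re2D n (x y : 'M[V]_n) : re2 (x + y) = re2 x + re2 y.
Proof. by rewrite /re2 adjmxD // addrACA. Qed.

Lemma re2Z n (t : R) (x : 'M[V]_n) : re2 (mxscale t%:C x) = mxscale t%:C (re2 x).
Proof. by rewrite /re2 adjmxZr // mxscaleDr. Qed.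

Lemma re2_herm n (x : 'M[V]_n) : adj x = x -> re2 x = mxscale 2%:R%:C x.
Proof. by move=> h; rewrite /re2 h rmorph_nat mxscale2. Qed.

Lemma adj_re2 n (x : 'M[V]_n) : adj (re2 x) = re2 x.
Proof. by rewrite /re2 adjmxD // adjmxK // addrC. Qed.

Lemma pos_half n (x : 'M[V]_n) : pos (mxscale 2%:R%:C x) -> pos x.
Proof.
move=> h; have h2 : 0 <= 2^-1 :> R by rewrite invr_ge0.
have := posZ H h2 h; rewrite mxscaleA -rmorphM mulVf ?mxscale1 //.
Qed.

Lemma sform_real n m (phi : V -> 'M[C]_m) (a : 'M[V]_n) x : cp D phi -> adj a = a ->
  sform (ampl phi a) x x = (complex.Re (sform (ampl phi a) x x))%:C.
Proof.
move=> hphi ha; have := sform_adj H a x x hphi; rewrite ha.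
move: (sform _ x x) => z; case: z => r s [] /= /eqP; rewrite -subr_eq0 opprK -mulr2n mulrn_eq0 /=.
by move=> /eqP ->.
Qed.

(** A functional on M_n(V) is a completely positive map into M_n evaluated at [eta n], so states of
    the single size n suffice. The Archimedean axiom provides the slack that [cone_separation] asks
    for. *)
Theorem pos_CS n (a : 'M[V]_n) : adj a = a ->
  (forall phi : V -> 'M[C]_n, CS D phi -> psd (ampl phi a)) -> pos a.
Proof.
move=> ha hpsd; apply: pos_arch => // eps eps0; apply: contrapT => npos.
pose K (x : 'M[V]_n) := pos (re2 x).
have Kc : is_cone (@mxs n) K.
  split=> [x y|t x t0] h; rewrite /K ?re2D; first exact: posD.
  by rewrite re2Z; exact: posZ.
have Ku x : exists t, 0 <= t /\ K (mxs t (one n) + x).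
  have [t t0 ht] := order_unit H (adj_re2 x).
  exists t; split=> //; rewrite /K re2D re2_herm ?adjmxZr ?adj_one //.
  rewrite rmorph_nat mxscale2 -addrA; apply: posD => //.
  by apply: posZ => //; exact: pos_one.
have Kz : ~ K (a + mxs eps (one n)).
  by rewrite /K re2_herm => [/pos_half //|]; rewrite adjmxD // adjmxZr // adj_one // ha.
have [g [gD gZ gK g1 ga]] := cone_separation (@mxsDl n) (fun t => @mxscaleDr _ _ _ _ t%:C)
  (@mxsA n) (@mxs1 n) Kc Ku eps0 Kz.
have gpos x : pos x -> 0 <= g x.
  move=> px; apply: gK; rewrite /K re2_herm; last exact: pos_herm.
  by apply: posZ.
have ganti x : adj x = - x -> g x = 0.
  have hh y : adj y = - y -> 0 <= g y.
    by move=> hy; apply: gK; rewrite /K /re2 hy subrr; exact: pos0.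
  have g0 : g 0 = 0 by apply: (addrI (g 0)); rewrite -gD !addr0.
  have gN y : g (- y) = - g y by apply: (addrI (g y)); rewrite -gD !subrr g0.
  move=> hx; apply/eqP; rewrite eq_le hh // andbT -oppr_ge0 -gN hh //.
  by rewrite adjmxN // hx.
have [phi hphi phig] := functional_cp gD gZ gpos ganti.
have tr1 : \tr (phi u) = 1.
  have h := cp_unit_psd H hphi.
  have e : complex.Re (\tr (phi u)) = 1.
    rewrite -g1 -[X in g X]sandw1 -gam_eta -phig; congr complex.Re.
    rewrite sform_eta; apply: eq_bigr => k _; rewrite (bigD1 k) //= big1 ?addr0.
      by rewrite !mxE eqxx scale1r.
    by move=> l lk; rewrite !mxE eq_sym (negPf lk) scale0r lin0 ?mxE //; case: hphi.
  rewrite (ge0_Re (z := \tr (phi u))) ?e // sumr_ge0 // => k _.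
  by have /psdP/(_ (fun k' => (k' == k)%:R)) := h; rewrite sform_delta.
(* Adding a small multiple of the state tau makes the image of the unit invertible, so that
   it can be normalised to 1. *)
pose tau v : 'M[C]_n := (\tr (phi v))%:M.
have htau : cp D tau by exact: cp_trace.
set z := complex.Re (sform (ampl tau a) (eta n) (eta n)).
(* Small enough that e2 * z stays below - g a / 2, so the perturbed value is still negative; the
   [+ 1] covers z = 0. *)
pose e2 := - g a / (2 * (`|z| + 1)).
have z1 : 0 < `|z| + 1 by rewrite ltr_wpDl.
have e20 : 0 < e2 by rewrite divr_gt0 ?oppr_gt0 // mulr_gt0.
have [Q Qu QE] := psd_perturb (cp_unit_psd H hphi) e20.
pose phi' v := phi v + e2%:C *: tau v.
have hphi' : cp D phi' by apply: cp_add => //; apply: cp_scale => //; exact: ltW.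
have e' : phi' u = ctr Q *m Q by rewrite -QE /phi' /tau tr1 scalemx1.
(* Testing the normalised map at Q applied to [eta n] undoes the conjugation by the inverse of Q and
   gives back the value of [phi'] at [eta n]. *)
have /hpsd/psdP/(_ (vmul Q (eta n))) := cp_normalize hphi' Qu e'.
rewrite sform_conj (@sform_ext _ _ _ _ _ (eta n) _ (eta n)); last 2 first.
- by move=> p; exact: vmul_inv.
- by move=> p; exact: vmul_inv.
have -> : sform (ampl phi' a) (eta n) (eta n) = sform (ampl phi a) (eta n) (eta n) +
    e2%:C * sform (ampl tau a) (eta n) (eta n).
  rewrite -sformZ -sformD; apply: eq_sform => p q; by rewrite /ampl !mxE.
rewrite lecE ReD Re_scale phig gam_eta sandw1 -/z => /andP[_]; apply/negP.
rewrite -ltNge /=.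
have h : e2 * (2 * (`|z| + 1)) = - g a by rewrite /e2 divfK // gt_eqF // mulr_gt0.
have := ler_norm z; nra.
Qed.

Lemma CS_pos n m (phi : V -> 'M[C]_m) (a : 'M[V]_n) x : CS D phi -> pos a ->
  0 <= complex.Re (sform (ampl phi a) x x).
Proof. by move=> [_ _ h] /h /psdP/(_ x); rewrite lecE => /andP[_]. Qed.

Definition blk n (t : R) (v : 'M[V]_n) :=
  block_mx (mxscale t%:C (one n)) v (adj v) (mxscale t%:C (one n)).

Lemma adj_block n1 n2 (a : 'M[V]_n1) b c (d : 'M[V]_n2) :
  adj (block_mx a b c d) = block_mx (adj a) (\matrix_(i, j) inv (c j i))
     (\matrix_(i, j) inv (b j i)) (adj d).
Proof.
apply/matrixP => i j; case: (split_ordP i) => i' ->; case: (split_ordP j) => j' ->;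
by rewrite ?(block_mxEul, block_mxEur, block_mxEdl, block_mxEdr, mxE).
Qed.

Lemma adj_blk n t (v : 'M[V]_n) : adj (blk t v) = blk t v.
Proof.
rewrite /blk adj_block adjmxZr // adj_one //; congr block_mx.
by apply/matrixP => i j; rewrite !mxE inv_invol.
Qed.

Lemma mxscale_block n1 n2 c (a : 'M[V]_n1) b b' (d : 'M[V]_n2) :
  mxscale c (block_mx a b b' d) =
  block_mx (mxscale c a) (mxscale c b) (mxscale c b') (mxscale c d).
Proof. exact: map_block_mx. Qed.

Lemma one_block n m : one (n + m) = block_mx (one n) 0 0 (one m).
Proof.
rewrite /one_mx scalar_mx_block; apply/matrixP => i j.
case: (split_ordP i) => i' ->; case: (split_ordP j) => j' ->;
by rewrite ?(block_mxEul, block_mxEur, block_mxEdl, block_mxEdr, mxE) ?scale0r.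
Qed.

Lemma blkD n t s (v : 'M[V]_n) : blk t v + mxscale s%:C (one (n + n)) = blk (t + s) v.
Proof.
by rewrite one_block mxscale_block add_block_mx !mxscale_0r !addr0 -mxscaleDl -rmorphD.
Qed.

Lemma Re_sform_blk n m (phi : V -> 'M[C]_m) t (v : 'M[V]_n) x : CS D phi ->
  complex.Re (sform (ampl phi (blk t v)) x x) =
  t * (vn2 (lpart x) + vn2 (rpart x)) + 2 * complex.Re (sform (ampl phi v) (lpart x) (rpart x)).
Proof.
move=> h; have /CS_cp [hcp _] := h; have [L _ _] := h.
have e (y : 'I_n * 'I_m -> C) : sform (ampl phi (mxscale t%:C (one n))) y y = (t * vn2 y)%:C.
  rewrite rmorphM /= -(sform_one_CS _ h) -sformZ.
  by apply: eq_sform => p q; rewrite amplZ.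
rewrite sform_block !e sform_adj // !ReD Re_cj /=; ring.
Qed.

Lemma blk_opn n m (phi : V -> 'M[C]_m) t (v : 'M[V]_n) : CS D phi -> 0 <= t ->
  pos (blk t v) -> opn (ampl phi v) <= t.
Proof.
move=> h t0 hp; apply: opn_le_Re => // x y.
have := CS_pos (gluev x y) h hp; rewrite Re_sform_blk //; congr (0 <= _ * _ + _ * complex.Re _).
  by rewrite -vn2_parts vn2_gluev.
by apply: sform_ext => p; rewrite ?lpart_gluev ?rpart_gluev.
Qed.

(** The states have size n + n because the block matrix whose positivity is tested lies in
    M_(n+n)(V). *)
Lemma opn_blk n t (v : 'M[V]_n) : 
  (forall phi : V -> 'M[C]_(n + n), CS D phi -> opn (ampl phi v) <= t) -> pos (blk t v).
Proof.
move=> h; apply: pos_CS; first exact: adj_blk.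
move=> phi hphi; apply/psdP => x; have /CS_cp [hcp _] := hphi.
rewrite sform_real // ?adj_blk // ler0c Re_sform_blk //.
have := opn_sform (lpart x) (rpart x) (h _ hphi).
have := Re_le_cabs (- sform (ampl phi v) (lpart x) (rpart x)).
rewrite ReN cabsN; lra.
Qed.

Let bset n (v : 'M[V]_n) : set R := fun t => pos (blk t v).

Lemma blk_ex n (v : 'M[V]_n) : exists2 t, 0 <= t & pos (blk t v).
Proof.
have [t t0 h] := order_unit H (adj_blk 0 v); exists t => //.
by rewrite -[t]add0r -blkD addrC.
Qed.

(** Covers the degenerate cases, such as n = 0 or V = 0, in which a negative t is admissible. Then
    every s is, the set in the definition of the norm is unbounded below, and [inf] takes its
    default value 0. *)
Lemma blk_neg n t s (v : 'M[V]_n) : t < 0 -> pos (blk t v) -> pos (blk s v).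
Proof.
move=> t0 ht; apply: pos_CS; first exact: adj_blk.
move=> phi hphi; apply/psdP => x; have /CS_cp [hcp _] := hphi.
rewrite sform_real // ?adj_blk // ler0c Re_sform_blk //.
have l0 : vn2 (lpart x) = 0.
  apply/eqP; rewrite eq_le vn2_ge0 andbT.
  have := CS_pos (gluev (lpart x) (fun=> 0)) hphi ht; rewrite Re_sform_blk //.
  rewrite -vn2_parts vn2_gluev vn2_0 addr0 sform_y0 => [|p]; last by rewrite rpart_gluev.
  by rewrite mulr0 addr0 nmulr_rge0.
have r0 : vn2 (rpart x) = 0.
  apply/eqP; rewrite eq_le vn2_ge0 andbT.
  have := CS_pos (gluev (fun=> 0) (rpart x)) hphi ht; rewrite Re_sform_blk //.
  rewrite -vn2_parts vn2_gluev vn2_0 add0r sform_x0 => [|p]; last by rewrite lpart_gluev.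
  by rewrite mulr0 addr0 nmulr_rge0.
by rewrite l0 r0 addr0 sform_x0 ?mulr0 ?addr0 //; exact: vn2_eq0.
Qed.

Lemma bset_lb n (v : 'M[V]_n) : has_lbound (bset v) -> lbound (bset v) 0.
Proof.
move=> [w hw] t ht; rewrite leNgt; apply/negP => tn.
have := hw (w - 1) (blk_neg (w - 1) tn ht); lra.
Qed.

Lemma mnorm_ge0 n (v : 'M[V]_n) : 0 <= mnorm D v.
Proof.
have [hl|hl] := pselect (has_lbound (bset v)); last first.
  by rewrite /mnorm inf_out // => -[].
have [t0 _ h0] := blk_ex v.
by apply: lb_le_inf => [|t ht]; [exists t0 | exact: (bset_lb hl ht)].
Qed.

(** With [opn_mnorm] this describes the norm as a bound on amplified states of size n + n. The
    seminorm laws below are inherited from [opn] in this way. *)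
Lemma mnorm_le n t (v : 'M[V]_n) : 0 <= t ->
  (forall phi : V -> 'M[C]_(n + n), CS D phi -> opn (ampl phi v) <= t) -> mnorm D v <= t.
Proof.
move=> t0 /opn_blk h.
have [hl|hl] := pselect (has_lbound (bset v)); last first.
  by rewrite /mnorm inf_out // => -[].
exact: (ge_inf hl h).
Qed.

Lemma opn_mnorm n m (phi : V -> 'M[C]_m) (v : 'M[V]_n) : CS D phi ->
  opn (ampl phi v) <= mnorm D v.
Proof.
move=> h; have [t0 t00 h0] := blk_ex v.
have [hl|hl] := pselect (has_lbound (bset v)); last first.
  (* The set has no lower bound, so some negative t is admissible, and by [blk_neg] so is 0. *)
  apply: le_trans (mnorm_ge0 v); apply: (blk_opn h) => //.
  have [t ht tn] : exists2 t, bset v t & t < 0.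
    apply: contrapT => hn; apply: hl; exists 0 => t ht; rewrite leNgt; apply/negP => tn.
    by apply: hn; exists t.
  exact: blk_neg tn ht.
apply/ler_addgt0Pr => e e0.
have hi : has_inf (bset v) by split=> //; exists t0.
have [t ht te] := inf_adherent e0 hi.
apply: le_trans (ltW te); apply: (blk_opn h) => //; exact: (bset_lb hl ht).
Qed.
End Duality.
Arguments eta {R} n _.

(** * Properties of the matrix norm *)

Section MnormLemmas.
Variable R : realType.
Local Notation C := (R[i]).
Variable V : lmodType C.
Variable D : mou_data V.
Hypothesis H : is_mou D.
Local Notation inv := (Defs.inv D).
Local Notation u := (Defs.unit D).
Local Notation pos := (Defs.pos D).
Local Notation one := (one_mx D).
Local Notation adj := (adjmx inv).

Lemma CS_lin n (phi : V -> 'M[C]_n) : CS D phi -> lin phi.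
Proof. by case. Qed.

Lemma mnormD n (a b : 'M[V]_n) : mnorm D (a + b) <= mnorm D a + mnorm D b.
Proof.
apply: mnorm_le => //; first by rewrite addr_ge0 // mnorm_ge0.
move=> phi h; apply: le_trans (lerD (opn_mnorm H a h) (opn_mnorm H b h)).
apply: le_trans (opnD _ _); rewrite le_eqVlt; apply/orP; left; apply/eqP.
by apply: eq_opn => p q; rewrite amplD //; exact: CS_lin h.
Qed.

Lemma mnormZ n (c : C) (a : 'M[V]_n) : mnorm D (mxscale c a) <= cabs c * mnorm D a.
Proof.
apply: mnorm_le => //; first by rewrite mulr_ge0 // ?mnorm_ge0 // cabs_ge0.
move=> phi h; apply: le_trans (ler_wpM2l (cabs_ge0 _) (opn_mnorm H a h)).
apply: le_trans (opnZ_le _ _); rewrite le_eqVlt; apply/orP; left; apply/eqP.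
by apply: eq_opn => p q; rewrite amplZ //; exact: CS_lin h.
Qed.

Lemma mnormN n (a : 'M[V]_n) : mnorm D (- a) = mnorm D a.
Proof.
have h (b : 'M[V]_n) : mnorm D (- b) <= mnorm D b.
  have := mnormZ (- 1) b; by rewrite cabsN cabs1 mul1r mxscaleNl mxscale1.
by apply/eqP; rewrite eq_le h -{1}[a]opprK h.
Qed.

Lemma mnormB n (a b : 'M[V]_n) : mnorm D (a - b) <= mnorm D a + mnorm D b.
Proof. by rewrite -(mnormN b) mnormD. Qed.

Lemma mnorm_distC n (a b : 'M[V]_n) : mnorm D (a - b) = mnorm D (b - a).
Proof. by rewrite -mnormN opprB. Qed.

Lemma mnorm_triangle n (b a c : 'M[V]_n) :
  mnorm D (a - c) <= mnorm D (a - b) + mnorm D (b - c).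
Proof. by have := mnormD (a - b) (b - c); rewrite addrA addrNK. Qed.

Lemma mnorm0 n : mnorm D (0 : 'M[V]_n) = 0.
Proof.
apply/eqP; rewrite eq_le mnorm_ge0 // andbT; have := mnormZ 0 (0 : 'M[V]_n).
by rewrite cabs0 mul0r mxscale0.
Qed.

Lemma mnorm_sum (I : finType) n (F : I -> 'M[V]_n) :
  mnorm D (\sum_i F i) <= \sum_i mnorm D (F i).
Proof.
elim/big_ind2: _ => [|a b c d h1 h2|//]; first by rewrite mnorm0.
by apply: le_trans (mnormD _ _) _; apply: lerD.
Qed.

Lemma sform_hadj n (phi : V -> 'M[C]_n) r (a : 'M[V]_r) x y :
  (forall v, phi (inv v) = ctr (phi v)) ->
  sform (ampl phi (adj a)) x y = (sform (ampl phi a) y x)^*.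
Proof.
move=> h; rewrite /sform exchange_big cj_sum; apply: eq_bigr => j _ /=.
rewrite cj_sum; apply: eq_bigr => i _.
by rewrite /ampl mxE h mxE !cjM conjCK; ring.
Qed.

Lemma mnorm_adj n (a : 'M[V]_n) : mnorm D (adj a) = mnorm D a.
Proof.
have h (b : 'M[V]_n) : mnorm D (adj b) <= mnorm D b.
  apply: mnorm_le => //; first exact: mnorm_ge0.
  move=> phi h; apply: opn_lub => x y hx hy; rewrite sform_hadj ?cabs_conj.
    by apply: le_trans (opn_mnorm H b h); exact: opn_ub.
  by move=> v; apply: (cp_inv H); case/CS_cp: h.
by apply/eqP; rewrite eq_le h -{1}[a](adjmxK H) h.
Qed.

Lemma mnorm_ursub n (x : 'M[V]_(n + n)) : mnorm D (ursubmx x) <= mnorm D x.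
Proof.
apply: mnorm_le => //; first exact: mnorm_ge0.
move=> phi h; apply: le_trans (opn_mnorm H x h); apply: opn_lub => y z hy hz.
have := @opn_ub _ _ _ (ampl phi x) (gluev y (fun=> 0)) (gluev (fun=> 0) z).
rewrite !vn2_gluev !vn2_0 addr0 add0r => /(_ hy hz); congr (cabs _ <= _).
rewrite -{1}[x]submxK sform_block.
rewrite (@sform_y0 _ _ _ _ _ (lpart _)) => [|p]; last exact: lpart_gluev.
rewrite [X in _ + (X + _)]sform_x0 => [|p]; last exact: rpart_gluev.
rewrite [X in _ + (_ + X)]sform_x0 => [|p]; last exact: rpart_gluev.
rewrite add0r !addr0; apply: sform_ext => p; rewrite ?lpart_gluev ?rpart_gluev //.
Qed.

Lemma mnorm_delta n i j v : mnorm D (scmx (delta_mx i j : 'M[C]_n) v) <= mnorm D (const_mx v : 'M_1).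
Proof.
apply: mnorm_le => //; first exact: mnorm_ge0.
move=> phi h; apply: le_trans (opn_mnorm H (const_mx v : 'M_1) h); apply: opn_lub => x y hx hy.
have e : sform (ampl phi (scmx (delta_mx i j) v)) x y =
    sform (ampl phi (const_mx v : 'M_1)) (fun p => x (i, p.2)) (fun p => y (j, p.2)).
  rewrite sform_const /sform pair_sum (bigD1 i) //= [X in _ + X]big1 ?addr0.
    apply: eq_bigr => k _; rewrite pair_sum (bigD1 j) //= [X in _ + X]big1 ?addr0.
      apply: eq_bigr => l _; rewrite ampl_scmx; last exact: CS_lin h.
      by rewrite !mxE !eqxx mul1r.
    move=> j' jj; apply: big1 => l _; rewrite ampl_scmx; last exact: CS_lin h.
    by rewrite !mxE (negPf jj) andbF mul0r mulr0 mul0r.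
  move=> i' ii; apply: big1 => k _; apply: big1 => q _; rewrite ampl_scmx; last exact: CS_lin h.
  by rewrite !mxE (negPf ii) mul0r mulr0 mul0r.
have red (i0 : 'I_n) (z : 'I_n * 'I_(n + n) -> C) : vn2 z <= 1 ->
    vn2 (fun p : 'I_1 * 'I_(n + n) => z (i0, p.2)) <= 1.
  apply: le_trans; rewrite /vn2 !pair_sum big_ord1 [leRHS](bigD1 i0) //= lerDl.
  by apply: sumr_ge0 => k _; apply: sumr_ge0 => l _; exact: sqr_ge0.
by rewrite e; apply: opn_ub; apply: red.
Qed.

Lemma mnorm_entries n (a : 'M[V]_n) :
  mnorm D a <= \sum_i \sum_j mnorm D (const_mx (a i j) : 'M_1).
Proof.
rewrite -{1}[a]scmx_delta_sum; apply: le_trans (mnorm_sum _) _; apply: ler_sum => i _.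
apply: le_trans (mnorm_sum _) _; apply: ler_sum => j _; exact: mnorm_delta.
Qed.

(** Twice the block matrix with diagonal t and corners h is the compression of t + h by the row (1,
    1) plus the compression of t - h by the row (1, -1). *)
Lemma mnorm_herm n (t : R) (h : 'M[V]_n) : 0 <= t -> adj h = h ->
  pos (mxscale t%:C (one n) + h) -> pos (mxscale t%:C (one n) - h) -> mnorm D h <= t.
Proof.
move=> t0 hh h1 h2; apply: mnorm_le => // phi hphi; apply: (blk_opn H) => //.
apply: (pos_half H).
pose S (a : R) : 'M[C]_n := a%:C *: 1%:M.
have := posD H (pos_sandw H (row_mx (S 1) (S 1)) h1) (pos_sandw H (row_mx (S 1) (S (- 1))) h2).
congr (pos _); rewrite !sandw_row add_block_mx /blk mxscale_block hh.
set T := mxscale t%:C (one n).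
have sel (a b : R) (X : 'M[V]_n) :
    \matrix_(i, j) (\sum_k \sum_l ((S a k i)^* * S b l j) *: X k l)
    = mxscale (a * b)%:C X.
  apply/matrixP => i j; rewrite !mxE (bigD1 i) //= [X in _ + X]big1 ?addr0 => [|k ki].
    rewrite (bigD1 j) //= [X in _ + X]big1 ?addr0 => [|l lj].
      by rewrite !mxE !eqxx !mulr1 conj_real rmorphM.
    by rewrite !mxE (negPf lj) !mulr0 scale0r.
  by apply: big1 => l _; rewrite !mxE (negPf ki) mulr0 cj0 mul0r scale0r.
rewrite /sandw !sel !mulr1 !mul1r mulrNN mulr1 !rmorphN !rmorph1.
rewrite !mxscaleNl !mxscale1 opprB rmorph_nat !mxscale2.
have ee (X Y : 'M[V]_n) : X + Y + (X - Y) = X + X by rewrite addrACA subrr addr0.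
have ee' (X Y : 'M[V]_n) : X + Y + (Y - X) = Y + Y by rewrite [X + Y]addrC addrACA subrr addr0.
by rewrite ee ee'.
Qed.

Lemma unit0_trivial : u = 0 -> forall v : V, v = 0.
Proof.
move=> u0; have hz v : inv v = v -> v = 0.
  move=> hv; have [t [_ []]] := unit_order H hv.
  rewrite u0 scaler0 !add0r => hn hp.
  have := pos_proper H hp.
  have -> : - (const_mx v : 'M[V]_1) = const_mx (- v) by apply/matrixP => i j; rewrite !mxE.
  by move=> /(_ hn) /matrixP /(_ 0 0); rewrite !mxE.
move=> v; have [h1 [h2 [/hz -> /hz -> ->]]] := herm_split H v.
by rewrite scaler0 addr0.
Qed.

(** Compressing to size 1 makes each value z of the form satisfy z u >= 0. If z were not real,
    selfadjointness would force u = 0; if z were negative, - u would be positive and properness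
    would force u = 0. *)
Lemma scmx_psd n (S : 'M[C]_n) : u <> 0 -> pos (scmx S u) -> psd (fun i j => S i j).
Proof.
move=> u0 hS; apply/psdP => x; rewrite sform_mx.
have := pos_sandw H (\col_i x i) hS; rewrite sandw_scmx.
set M := ctr _ *m _ *m _; set z := M 0 0 => hp.
have e : scmx M u = const_mx (z *: u) by apply/matrixP => i j; rewrite [LHS]mxE [RHS]mxE !ord1.
move: z hp e => z hp e.
have /matrixP/(_ 0 0) := pos_herm H hp; rewrite e !mxE inv_Z // inv_unit // => hz.
have {}hz : z^* = z.
  apply/eqP; rewrite -subr_eq0; apply/eqP; apply: contrapT => hne; apply: u0.
  have /eqP := hz; rewrite -subr_eq0 -scalerBl => /eqP hz'.
  have := congr1 ( *:%R (z^* - z)^-1) hz'.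
  by rewrite scalerA mulVf ?scale1r ?scaler0 //; apply/eqP.
have zr : z = (complex.Re z)%:C.
  move: hz; case: (z) => a b [] /= /eqP; rewrite -subr_eq0 -opprD oppr_eq0 -mulr2n mulrn_eq0 /=.
  by move=> /eqP ->.
rewrite zr ler0c leNgt; apply/negP => rn; apply: u0.
have rn' : 0 <= - (complex.Re z)^-1 by rewrite oppr_ge0 invr_le0 ltW.
have := posZ H rn' hp; rewrite e => hp'.
have := pos_proper H (pos_one1 H); rewrite one1 => h.
have /matrixP/(_ 0 0) : const_mx u = 0 :> 'M[V]_1.
  apply: h; move: hp'; congr (pos _); apply/matrixP => i j; rewrite !mxE zr scalerA.
  by rewrite -rmorphM mulNr mulVf ?lt_eqF // rmorphN rmorph1 scaleN1r.
by rewrite !mxE.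
Qed.
End MnormLemmas.

(** * Contractive scalar matrices *)

Section Contractions.
Variable R : realType.
Local Notation C := (R[i]).

Lemma mxn_ctr m n (T : 'M[C]_(m, n)) : mxn (ctr T) = mxn T.
Proof.
have h p q (S : 'M[C]_(p, q)) : mxn (ctr S) <= mxn S.
  apply: opn_lub => x y hx hy.
  have -> : sform (fun i j => ctr S i j) x y = (sform (fun i j => S i j) y x)^*.
    rewrite /sform exchange_big cj_sum; apply: eq_bigr => j _ /=.
    by rewrite cj_sum; apply: eq_bigr => i _; rewrite mxE !cjM conjCK; ring.
  by rewrite cabs_conj; exact: opn_ub.
by apply/eqP; rewrite eq_le h -{1}[T]ctrK h.
Qed.

Lemma mxn_le1 m n (T : 'M[C]_(m, n)) :
  psd (fun i j => (1%:M - ctr T *m T) i j) -> mxn T <= 1.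
Proof.
move=> /psdP hT; apply: opn_lub => x y hx hy.
pose z i := \sum_j T i j * y j.
have hz : vn2 z <= vn2 y.
  have := hT y; rewrite sform_mx.
  have -> : (ctr (\col_i y i) *m (1%:M - ctr T *m T) *m \col_j y j) 0 0 = (vn2 y)%:C - (vn2 z)%:C.
    rewrite mulmxBr mulmxBl mulmx1 mxE [X in _ + X]mxE !vn2E; congr (_ - _).
      by rewrite mxE; apply: eq_bigr => i _; rewrite !mxE.
    rewrite mulmxA -mulmxA -ctrM mxE; apply: eq_bigr => i _; rewrite !mxE.
    have -> : \sum_j T i j * (\col_i0 y i0) j 0 = z i by apply: eq_bigr => j _; rewrite mxE.
    by [].
  by rewrite -rmorphB ler0c subr_ge0.
have -> : sform (fun i j => T i j) x y = \sum_i (x i)^* * z i.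
  by apply: eq_bigr => i _; rewrite mulr_sumr; apply: eq_bigr => j _; rewrite mulrA.
apply: le_trans (cabs_sum _) _.
have : \sum_i 2 * cabs ((x i)^* * z i) <= vn2 x + vn2 z.
  rewrite -big_split; apply: ler_sum => i _; rewrite cabsM cabs_conj.
  have := sqr_ge0 (cabs (x i) - cabs (z i)); rewrite sqrrB /=; lra.
rewrite -mulr_sumr; lra.
Qed.

Lemma mxn_delta m n (i : 'I_m) (j : 'I_n) : mxn (delta_mx i j : 'M[C]_(m, n)) <= 1.
Proof.
apply: mxn_le1; apply/psdP => x.
have -> : ctr (delta_mx i j : 'M[C]_(m, n)) *m delta_mx i j = delta_mx j j.
  have -> : ctr (delta_mx i j : 'M[C]_(m, n)) = delta_mx j i.
    by apply/matrixP => k l; rewrite !mxE cj_nat andbC.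
  by rewrite mul_delta_mx.
rewrite /sform; apply: sumr_ge0 => k _; rewrite (bigD1 k) //= big1 ?addr0 => [|l lk].
  rewrite !mxE eqxx; case: (k == j) => /=.
    by rewrite subrr mulr0 mul0r.
  by rewrite subr0 mulr1 mulrC mul_conjC_ge0.
rewrite !mxE [k == l]eq_sym (negPf lk) sub0r; case: eqVneq => [kj|]; last first.
  by rewrite oppr0 mulr0 mul0r.
by rewrite -kj (negPf lk) oppr0 mulr0 mul0r.
Qed.
End Contractions.

(** * The matrix bipolar theorem *)

Section Bipolar.
Variable R : realType.
Local Notation C := (R[i]).
Variable V : lmodType C.
Variable D : mou_data V.
Hypothesis H : is_mou D.
Local Notation inv := (Defs.inv D).
Local Notation u := (Defs.unit D).
Local Notation pos := (Defs.pos D).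
Local Notation one := (one_mx D).
Local Notation adj := (adjmx inv).
Variable L : lipT V.
Hypothesis HL : is_mlipsn D L.

Lemma L_ge0 n (a : 'M[V]_n) : 0 <= L a.
Proof. by case: HL. Qed.
Lemma L_add n (a b : 'M[V]_n) : L (a + b) <= L a + L b.
Proof. by case: HL => _ []. Qed.
Lemma L_scale n c (a : 'M[V]_n) : L (mxscale c a) = cabs c * L a.
Proof. by case: HL => _ [_ []]. Qed.
Lemma L_null n (a : 'M[V]_n) : L a = 0 <-> exists g : 'M[C]_n, a = scmx g u.
Proof. by case: HL => _ [_ [_ []]]. Qed.
Lemma L_block m n (v : 'M[V]_m) (w : 'M[V]_n) :
  L (block_mx v 0 0 w) = Num.max (L v) (L w).
Proof. by case: HL => _ [_ [_ [_ []]]]. Qed.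
Lemma L_lrmul m n (al : 'M[C]_(n, m)) (v : 'M[V]_m) (be : 'M[C]_(m, n)) :
  L (lrmul al v be) <= mxn al * L v * mxn be.
Proof. by case: HL => _ [_ [_ [_ [_ []]]]]. Qed.
Lemma L_adj m (v : 'M[V]_m) : L (adj v) = L v.
Proof. by case: HL => _ [_ [_ [_ [_ []]]]]. Qed.

Lemma L_scmx n (g : 'M[C]_n) : L (scmx g u) = 0.
Proof. by apply/L_null; exists g. Qed.

Lemma L_0 n : L (0 : 'M[V]_n) = 0.
Proof. by rewrite -(mxscale0 0) L_scale cabs0 mul0r. Qed.

Lemma L_contract m n (al : 'M[C]_(n, m)) (v : 'M[V]_m) (be : 'M[C]_(m, n)) :
  mxn al <= 1 -> mxn be <= 1 -> L (lrmul al v be) <= L v.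
Proof.
move=> h1 h2; apply: le_trans (L_lrmul _ _ _) _; rewrite -[leRHS]mulr1 -[X in _ <= X * _]mul1r.
by do 2?apply: ler_pM => //; rewrite ?mulr_ge0 ?L_ge0 ?opn_ge0.
Qed.

Lemma lrmul_delta m n (v : 'M[V]_m) (i : 'I_n) k l (j : 'I_n) :
  lrmul (delta_mx i k) v (delta_mx l j) = scmx (delta_mx i j) (v k l).
Proof.
apply/matrixP => s t; rewrite !mxE (bigD1 k) //= (bigD1 l) //= !mxE !eqxx andbT.
rewrite big1 ?addr0 => [|l' ll]; last by rewrite !mxE (negPf ll) mulr0 scale0r.
rewrite big1 ?addr0 => [|k' kk]; first by rewrite /= -natrM mulnb.
by apply: big1 => l' _; rewrite !mxE (negPf kk) andbF mul0r scale0r.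
Qed.

Lemma L_delta n (i j : 'I_n) v : L (scmx (delta_mx i j) v) <= L (const_mx v : 'M_1).
Proof.
have -> : scmx (delta_mx i j) v = lrmul (delta_mx i 0) (const_mx v : 'M_1) (delta_mx 0 j).
  by rewrite lrmul_delta mxE.
by apply: L_contract; exact: mxn_delta.
Qed.

Lemma L_sum (I : finType) n (F : I -> 'M[V]_n) : L (\sum_i F i) <= \sum_i L (F i).
Proof.
elim/big_ind2: _ => [|a b c d h1 h2|//]; first by rewrite L_0.
by apply: le_trans (L_add _ _) _; apply: lerD.
Qed.

Lemma L_entries n (a : 'M[V]_n) : L a <= \sum_i \sum_j L (const_mx (a i j) : 'M_1).
Proof.
rewrite -{1}[a]scmx_delta_sum; apply: le_trans (L_sum _) _; apply: ler_sum => i _.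
apply: le_trans (L_sum _) _; apply: ler_sum => j _; exact: L_delta.
Qed.

(** Embeds an arbitrary b as the corner of a selfadjoint matrix of twice the size. This reduces the
    bipolar theorem to selfadjoint elements, for which separation produces positive functionals. *)
Definition offd n (b : 'M[V]_n) : 'M[V]_(n + n) := block_mx 0 b (adj b) 0.

Lemma adj_offd n (b : 'M[V]_n) : adj (offd b) = offd b.
Proof.
rewrite /offd adj_block; congr block_mx; apply/matrixP => i j; rewrite !mxE ?inv_0 //.
by rewrite (inv_invol H).
Qed.

Lemma sum_delta n (F : 'I_n -> V) j : \sum_l ((1%:M : 'M[C]_n) l j) *: F l = F j.
Proof.
rewrite (bigD1 j) //= big1 ?addr0; first by rewrite mxE eqxx scale1r.
by move=> l lj; rewrite mxE (negPf lj) scale0r.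
Qed.

(** The matrix is the direct sum of b and its adjoint multiplied on the right by the contraction
    that swaps the two blocks. *)
Lemma L_offd n (b : 'M[V]_n) : L (offd b) <= L b.
Proof.
pose sw : 'M[C]_(n + n) := block_mx 0 1%:M 1%:M 0.
have bE := (block_mxEul, block_mxEur, block_mxEdl, block_mxEdr).
have e : offd b = lrmul 1%:M (block_mx b 0 0 (adj b)) sw.
  apply/matrixP => i j; rewrite [RHS]mxE.
  have -> : \sum_k \sum_l ((1%:M : 'M[C]_(n + n)) i k * sw l j) *: block_mx b 0 0 (adj b) k l =
     \sum_l sw l j *: block_mx b 0 0 (adj b) i l.
    rewrite (bigD1 i) //= [X in _ + X]big1 ?addr0 => [|k ki].
      by apply: eq_bigr => l _; rewrite mxE eqxx mul1r.
    by apply: big1 => l _; rewrite mxE eq_sym (negPf ki) mul0r scale0r.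
  rewrite big_split_ord /=; case: (split_ordP i) => i' ->; case: (split_ordP j) => j' ->;
    rewrite /offd ?(block_mxEul, block_mxEur, block_mxEdl, block_mxEdr).
  - by rewrite !big1 ?addr0 ?mxE // => l _; rewrite /sw ?bE mxE ?mxE ?scale0r ?scaler0.
  - rewrite [X in _ + X]big1 ?addr0 => [|l _].
      by under eq_bigr => l _ do rewrite /sw !bE; rewrite sum_delta.
    by rewrite bE [X in _ *: X]mxE scaler0.
  - rewrite [X in X + _]big1 ?add0r => [|l _].
      by under eq_bigr => l _ do rewrite /sw !bE; rewrite sum_delta.
    by rewrite bE [X in _ *: X]mxE scaler0.
  - by rewrite !big1 ?addr0 ?mxE // => l _; rewrite /sw ?bE mxE ?mxE ?scale0r ?scaler0.
have m1 k : mxn (1%:M : 'M[C]_k) <= 1.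
  apply: mxn_le1; rewrite ctr1 mulmx1 subrr; apply/psdP => x.
  by rewrite (@eq_sform _ _ _ _ (fun _ _ => 0)) ?sform0 // => ? ?; rewrite mxE.
have msw : mxn sw <= 1.
  apply: mxn_le1; have -> : ctr sw *m sw = 1%:M.
    have -> : ctr sw = sw.
      apply/matrixP => i j; case: (split_ordP i) => i' ->; case: (split_ordP j) => j' ->;
      rewrite mxE /sw ?(block_mxEul, block_mxEur, block_mxEdl, block_mxEdr) !mxE ?cj0 //;
      by rewrite cj_nat eq_sym.
    by rewrite /sw mulmx_block !mul0mx !mulmx0 !mulmx1 !addr0 !add0r -scalar_mx_block.
  rewrite subrr; apply/psdP => x.
  by rewrite (@eq_sform _ _ _ _ (fun _ _ => 0)) ?sform0 // => ? ?; rewrite mxE.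
rewrite e; apply: le_trans (L_contract _ (m1 _) msw) _.
by rewrite L_block L_adj maxxx.
Qed.

Lemma sform_offd n m (phi : V -> 'M[C]_m) (b : 'M[V]_n) x y :
  phi 0 = 0 -> (forall v, phi (inv v) = ctr (phi v)) ->
  sform (ampl phi (offd b)) x y =
  sform (ampl phi b) (lpart x) (rpart y) + (sform (ampl phi b) (lpart y) (rpart x))^*.
Proof.
move=> p0 hphi; rewrite sform_block sform_hadj //.
have z x' y' : sform (ampl phi (0 : 'M[V]_n)) x' y' = 0.
  by rewrite (@eq_sform _ _ _ _ (fun _ _ => 0)) ?sform0 // => p q; rewrite /ampl mxE p0 mxE.
by rewrite !z add0r addr0.
Qed.

(** Only linearity at 0 and compatibility with the involution are assumed, because the lemma is
    applied to a difference of two states. The two corners act on complementary halves of the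
    vectors, so their bounds add up to t and not to 2 t. *)
Lemma opn_offd n m (phi : V -> 'M[C]_m) (b : 'M[V]_n) :
  phi 0 = 0 -> (forall v, phi (inv v) = ctr (phi v)) ->
  opn (ampl phi (offd b)) <= opn (ampl phi b).
Proof.
move=> p0 hphi; apply: opn_lub => x y hx hy; rewrite sform_offd //.
apply: le_trans (cabsD _ _) _; rewrite cabs_conj.
set t := opn _.
have t0 : 0 <= t by exact: opn_ge0.
have := opn_sform (lpart x) (rpart y) (lexx t).
have := opn_sform (lpart y) (rpart x) (lexx t).
move: hx hy; rewrite !vn2_parts => hx hy.
have : t * (vn2 (lpart x) + vn2 (rpart x) + (vn2 (lpart y) + vn2 (rpart y))) <= t * 2.
  by apply: ler_wpM2l => //; lra.
lra.
Qed.

Lemma re2_functional n (g : 'M[V]_n -> R) : (forall x y, g (x + y) = g x + g y) ->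
  (forall x, pos (re2 D x) -> 0 <= g x) ->
  (forall x, pos x -> 0 <= g x) /\ (forall x, adj x = - x -> g x = 0).
Proof.
move=> gD gK; split=> [x px|].
  by apply: gK; rewrite re2_herm //; [exact: posZ|exact: pos_herm].
have hh y : adj y = - y -> 0 <= g y.
  by move=> hy; apply: gK; rewrite /re2 hy subrr; exact: pos0.
have g0 : g 0 = 0 by apply: (addrI (g 0)); rewrite -gD !addr0.
have gN y : g (- y) = - g y by apply: (addrI (g y)); rewrite -gD !subrr g0.
move=> x hx; apply/eqP; rewrite eq_le hh // andbT -oppr_ge0 -gN hh //.
by rewrite adjmxN // hx.
Qed.

(** A vanishing form makes both A and i A positive semidefinite, hence both hermitian, which leaves
    only A = 0. *)
Lemma sform_zero n (A : 'M[C]_n) : (forall x, sform (fun i j => A i j) x x = 0) -> A = 0.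
Proof.
move=> h; have h1 : psd (fun i j => A i j) by apply/psdP => x; rewrite h.
have h2 : psd (fun i j => 'i * A i j) by apply/psdP => x; rewrite sformZ h mulr0.
apply/matrixP => i j; have := psd_herm h1 i j; have := psd_herm h2 i j.
rewrite cjM conjCi mulNr => e e1; rewrite mxE; move: e; rewrite -e1 => /eqP.
rewrite -subr_eq0 opprK -mulr2n mulrn_eq0 /=.
by rewrite mulf_eq0 (negPf (neq0Ci _)) /= => /eqP.
Qed.

Lemma trace_unit n (phi : V -> 'M[C]_n) : cp D phi ->
  \tr (phi u) = (complex.Re (sform (ampl phi (one n)) (eta n) (eta n)))%:C.
Proof.
move=> hphi; have h := cp_unit_psd H hphi.
have -> : sform (ampl phi (one n)) (eta n) (eta n) = \tr (phi u).
  rewrite sform_eta; apply: eq_bigr => k _; rewrite (bigD1 k) //= big1 ?addr0.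
    by rewrite !mxE eqxx scale1r.
  by move=> l lk; rewrite !mxE eq_sym (negPf lk) scale0r lin0 ?mxE //; case: hphi.
apply: ge0_Re; apply: sumr_ge0 => k _.
by have /psdP/(_ (fun k' => (k' == k)%:R)) := h; rewrite sform_delta.
Qed.

(* (1, -a, a) is close to this cone exactly when a is close to the unit ball of L, and a
   functional that is nonnegative on the cone is a triple of positive functionals. *)
Section Cone.
Variable n : nat.
Let E := ('M[V]_n * 'M[V]_n * 'M[V]_n)%type.
Definition scale3 (t : R) (w : E) : E :=
  (mxscale t%:C w.1.1, mxscale t%:C w.1.2, mxscale t%:C w.2).

Definition ball_cone (w : E) := exists r (b : 'M[V]_r) (al : 'M[C]_(r, n)),
  [/\ adj b = b, L b <= 1, pos (re2 D w.1.1 - sandw al (one r)),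
      pos (re2 D w.1.2 + sandw al b) & pos (re2 D w.2 - sandw al b)].

(** Sums are witnessed by the direct sum of the two b and the stacked coefficients; the ball of L is
    stable under direct sums, and this is why the size r is left existential. Scaling by t
    multiplies the coefficient matrix by the square root of t. *)
Lemma ball_cone_cone : is_cone scale3 ball_cone.
Proof.
split=> [w w' [r [b [al [hb Lb h0 h1 h2]]]] [r' [b' [al' [hb' Lb' h0' h1' h2']]]]|t w t0 [r [b [al [hb Lb h0 h1 h2]]]]].
  exists (r + r')%N, (block_mx b 0 0 b'), (col_mx al al'); split.
  - by rewrite adj_block hb hb'; congr block_mx; apply/matrixP => i j; rewrite !mxE inv_0.
  - by rewrite L_block ge_max Lb Lb'.
  - by rewrite /= re2D // one_block sandw_col opprD addrACA; exact: posD.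
  - by rewrite /= re2D // sandw_col addrACA; exact: posD.
  - by rewrite /= re2D // sandw_col opprD addrACA; exact: posD.
exists r, b, ((Num.sqrt t)%:C *: al).
have e (x : 'M[V]_r) : sandw ((Num.sqrt t)%:C *: al) x = mxscale t%:C (sandw al x).
  by rewrite sandwZl conj_real -rmorphM -expr2 sqr_sqrtr.
by split=> //=; rewrite e re2Z // -?mxscaleB -?mxscaleDr; exact: posZ.
Qed.

Lemma ball_cone_simple (w : E) : pos (re2 D w.1.1) -> pos (re2 D w.1.2) -> pos (re2 D w.2) ->
  ball_cone w.
Proof.
(* The empty matrix, r = 0, makes every term in b vanish. *)
move=> h0 h1 h2; exists 0%N, 0, 0.
have e (x : 'M[V]_0) : sandw (0 : 'M[C]_(0, n)) x = 0.
  by apply/matrixP => i j; rewrite !mxE big_ord0.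
split; rewrite ?e ?subr0 ?addr0 ?L_0 //.
by apply/matrixP => -[].
Qed.

Lemma ball_cone_unit (w : E) : exists t, 0 <= t /\
  ball_cone (scale3 t (one n, one n, one n) + w).
Proof.
have [t0 t00 h0] := order_unit H (adj_re2 H w.1.1).
have [t1 t10 h1] := order_unit H (adj_re2 H w.1.2).
have [t2 t20 h2] := order_unit H (adj_re2 H w.2).
exists (t0 + t1 + t2); split; first by rewrite !addr_ge0.
have hm s (x : 'M[V]_n) : s <= t0 + t1 + t2 -> 0 <= t0 + t1 + t2 -> pos (mxscale s%:C (one n) + re2 D x) ->
    pos (re2 D (mxscale (t0 + t1 + t2)%:C (one n) + x)).
  set T := t0 + t1 + t2 => sT T0 h; rewrite re2D // re2_herm ?adjmxZr ?adj_one //.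
  rewrite mxscaleA -rmorphM.
  have -> : 2 * T = s + (2 * T - s) by rewrite addrC subrK.
  rewrite rmorphD mxscaleDl addrAC; apply: posD => //; apply: posZ => //; last exact: pos_one.
  lra.
by apply: ball_cone_simple => /=; [apply: hm h0|apply: hm h1|apply: hm h2]; lra.
Qed.

(** The factor 2 of [re2] gives the bound s = 2 (1 + eps) for the first component, so [al] divided
    by the square root of s is a contraction T and the compression of b by T stays in the ball. With
    c the compression of b by [al], the other components say that 2 a - c lies between - 2 eps and 2
    eps, and c / 2 is 1 + eps times the compression by T. Dropping that factor costs at most eps
    (|a| + eps). *)
Lemma ball_cone_near (a : 'M[V]_n) (eps : R) : u <> 0 -> adj a = a -> 0 < eps ->
  ball_cone ((one n, - a, a) + scale3 eps (one n, one n, one n)) ->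
  exists2 b : 'M[V]_n, L b <= 1 & mnorm D (a - b) <= eps * (1 + mnorm D a + eps).
Proof.
move=> u0 ha e0 [r [b [al [hb Lb]]]]; set s := 2 * (1 + eps).
have s0 : 0 < s by rewrite /s; lra.
have e10 : 0 < 1 + eps by lra.
have hs2 : (1 + eps) * s^-1 = 2^-1 by rewrite /s invfM mulrCA mulfV ?mulr1 // gt_eqF.
have hinv : (1 + eps)^-1 <= 1 by rewrite invf_le1 // lerDl ltW.
have e1 : one n + mxscale eps%:C (one n) = mxscale (1 + eps)%:C (one n).
  by rewrite rmorphD mxscaleDl mxscale1.
rewrite /= e1 re2_herm ?adjmxZr ?adj_one // mxscaleA -rmorphM -/s.
rewrite {2}/one_mx sandw_scmx mulmx1 /one_mx -scmxZ -scmxB scalemx1 => /(scmx_psd H u0) hal.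
rewrite !re2_herm ?adjmxD ?adjmxN ?adjmxZr ?adj_one ?ha // => h1 h2.
pose T := (Num.sqrt s^-1)%:C *: al.
have sT (x : 'M[V]_r) : sandw T x = mxscale (s^-1)%:C (sandw al x).
  by rewrite sandwZl conj_real -rmorphM -expr2 sqr_sqrtr // invr_ge0 ltW.
have Tn : mxn T <= 1.
  apply: mxn_le1; have si : 0 <= (s^-1)%:C :> C by rewrite ler0c invr_ge0 ltW.
  have -> : 1%:M - ctr T *m T = (s^-1)%:C *: (s%:C%:M - ctr al *m al).
    rewrite scalerBr scale_scalar_mx -rmorphM mulVf ?gt_eqF //; congr (_ - _).
    have -> : ctr T = (Num.sqrt s^-1)%:C *: ctr al.
      by apply/matrixP => k l; rewrite !mxE cjM conj_real.
    rewrite -scalemxAl -scalemxAr scalerA -rmorphM -expr2 sqr_sqrtr ?invr_ge0 ?ltW //.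
  by apply: eq_psd (psdZ si hal) => i j; rewrite [RHS]mxE.
exists (sandw T b).
  rewrite sandwE; apply: le_trans (L_contract _ _ Tn) Lb; by rewrite mxn_ctr.
have aE : adj (sandw al b) = sandw al b by rewrite adj_sandw // hb.
set c := sandw al b in h1 h2 aE.
have hn : mnorm D (mxscale 2%:C a - c) <= 2 * eps.
  apply: mnorm_herm => //; first by rewrite mulr_ge0 // ltW.
  - by rewrite adjmxB // adjmxZr // ha aE.
  - move: h2; rewrite /= mxscaleDr mxscaleA -rmorphM; congr (pos _).
    by rewrite addrAC addrC.
  - move: h1; rewrite /= mxscaleDr mxscaleA -rmorphM mxscaleN opprB; congr (pos _).
    by rewrite addrC addrA addrC.
have hn' : mnorm D (a - mxscale (1 + eps)%:C (sandw T b)) <= eps.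
  have -> : a - mxscale (1 + eps)%:C (sandw T b) = mxscale (2^-1)%:C (mxscale 2%:C a - c).
    rewrite mxscaleB mxscaleA -rmorphM mulVf ?pnatr_eq0 // mxscale1 sT -/c mxscaleA -rmorphM.
    by rewrite hs2.
  apply: le_trans (mnormZ H _ _) _; by rewrite cabs_real ?invr_ge0 // ler_pdivrMl.
have hb' : mnorm D (sandw T b) <= mnorm D a + eps.
  have -> : sandw T b = mxscale ((1 + eps)^-1)%:C (mxscale (1 + eps)%:C (sandw T b)).
    by rewrite mxscaleA -rmorphM mulVf ?mxscale1 // gt_eqF.
  apply: le_trans (mnormZ H _ _) _; rewrite cabs_real ?invr_ge0 ?(ltW e10) //.
  have hx : mnorm D (mxscale (1 + eps)%:C (sandw T b)) <= mnorm D a + eps.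
    have -> : mxscale (1 + eps)%:C (sandw T b) = a - (a - mxscale (1 + eps)%:C (sandw T b)).
      by rewrite subKr.
    by apply: le_trans (mnormB H _ _) _; rewrite lerD2l.
  apply: le_trans hx; rewrite -[leRHS]mul1r; apply: ler_wpM2r hinv; exact: mnorm_ge0.
have -> : a - sandw T b = (a - mxscale (1 + eps)%:C (sandw T b)) + mxscale eps%:C (sandw T b).
  by rewrite rmorphD mxscaleDl mxscale1 opprD addrA addrNK.
apply: le_trans (mnormD H _ _) _; apply: le_trans (lerD hn' (mnormZ H _ _)) _.
by rewrite cabs_real ?(ltW e0) // -{1}[eps]mulr1 -mulrDr -addrA ler_pM2l ?lerD2l.
Qed.
End Cone.
End Bipolar.

(** * Separating an element from the Lip-ball by a pair of states *)

Section BipolarMain.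
Variable R : realType.
Local Notation C := (R[i]).
Variable V : lmodType C.
Variable D : mou_data V.
Hypothesis H : is_mou D.
Local Notation inv := (Defs.inv D).
Local Notation u := (Defs.unit D).
Local Notation pos := (Defs.pos D).
Local Notation one := (one_mx D).
Local Notation adj := (adjmx inv).
Variable L : lipT V.
Hypothesis HL : is_mlipsn D L.

Lemma unbounded_slope (N x : R) : (forall t, t * x <= N) -> x = 0.
Proof.
move=> h; apply: contrapT => /eqP x0.
by have := h ((N + 1) / x); rewrite divfK //; lra.
Qed.

Lemma fixed_conj (z : C) : z^* = z -> z = (complex.Re z)%:C.
Proof.
case: z => a b [] /= /eqP; rewrite -subr_eq0 -opprD oppr_eq0 -mulr2n mulrn_eq0 /=.
by move=> /eqP ->.
Qed.

Lemma ampl_distE n r (phi psi G : V -> 'M[C]_n) (c : R) (a : 'M[V]_r) : 0 < c ->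
  (forall v, phi v - psi v = (c^-1)%:C *: G v) ->
  ampl_dist phi psi a = c^-1 * opn (ampl G a).
Proof.
move=> c0 h; have ci : 0 <= c^-1 by rewrite invr_ge0 ltW.
have e p q : ampl phi a p q - ampl psi a p q = (c^-1)%:C * ampl G a p q.
  by have /matrixP/(_ p.2 q.2) := h (a p.1 q.1); rewrite !mxE.
rewrite /ampl_dist (eq_opn e); apply/eqP; rewrite eq_le; apply/andP; split.
  by apply: le_trans (opnZ_le _ _) _; rewrite cabs_real.
rewrite ler_pdivrMl //.
have -> : opn (ampl G a) = opn (fun p q => c%:C * ((c^-1)%:C * ampl G a p q)).
  by apply: eq_opn => p q; rewrite mulrA -rmorphM mulfV ?mul1r // gt_eqF.
by apply: le_trans (opnZ_le _ _) _; rewrite cabs_real ?(ltW c0).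
Qed.

Lemma scale3Dl n (s t : R) (w : 'M[V]_n * 'M[V]_n * 'M[V]_n) :
  scale3 (s + t) w = scale3 s w + scale3 t w.
Proof. by rewrite /scale3 rmorphD !mxscaleDl. Qed.

Lemma scale3Dr n (s : R) (w w' : 'M[V]_n * 'M[V]_n * 'M[V]_n) :
  scale3 s (w + w') = scale3 s w + scale3 s w'.
Proof. by rewrite /scale3 /= !mxscaleDr. Qed.

Lemma scale3A n (s t : R) (w : 'M[V]_n * 'M[V]_n * 'M[V]_n) :
  scale3 s (scale3 t w) = scale3 (s * t) w.
Proof. by rewrite /scale3 /= !mxscaleA rmorphM. Qed.

Lemma add3 n (x y z x' y' z' : 'M[V]_n) :
  (x, y, z) + (x', y', z') = (x + x', y + y', z + z').
Proof. by []. Qed.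

Lemma scale31 n (w : 'M[V]_n * 'M[V]_n * 'M[V]_n) : scale3 1 w = w.
Proof. by case: w => [[x y] z]; rewrite /scale3 /= !mxscale1. Qed.

(** The separating functional yields positive maps f0, f1, f2 such that f1 - f2 is dominated by f0
    at the unit on the ball but not at a. Conjugation by an inverse root of the perturbed value f0 u
    turns this domination into a bound by 1 for G, the conjugated difference. G vanishes at the
    unit, so up to the common factor c it is a difference of states. *)
Lemma separating_states n (a : 'M[V]_n) (eps : R) : u <> 0 -> adj a = a -> 0 < eps ->
  (forall b : 'M[V]_n, L b <= 1 -> eps < mnorm D (a - b)) ->
  exists (phi psi : V -> 'M[C]_n) (c : R), [/\ CS D phi, CS D psi, 0 < c,
    (forall r (b : 'M[V]_r), L b <= 1 -> ampl_dist phi psi b <= c^-1) &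
    c^-1 < ampl_dist phi psi a].
Proof.
move=> u0 ha eps0 hfar.
(* Since e' <= 1, the error of [ball_cone_near] is at most e' (2 + |a|), which is at most eps. *)
pose e' := Num.min 1 (eps / (2 + mnorm D a)).
have na0 : 0 <= mnorm D a by exact: mnorm_ge0.
have e'0 : 0 < e' by rewrite lt_min ltr01 divr_gt0 // ltr_wpDr.
have nK : ~ ball_cone D L ((one n, - a, a) + scale3 e' (one n, one n, one n)).
  move=> /(ball_cone_near H HL u0 ha e'0) [b Lb]; apply/negP; rewrite -ltNge.
  apply: le_lt_trans (hfar b Lb).
  have h1 : e' <= 1 by rewrite ge_min lexx.
  have h2 : e' <= eps / (2 + mnorm D a) by rewrite ge_min lexx orbT.
  apply: (@le_trans _ _ (e' * (2 + mnorm D a))).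
    by rewrite ler_pM2l // -(addrA 1) [mnorm D a + _]addrC addrA lerD2r (addrC 1) lerD2r.
  by rewrite -ler_pdivlMr // ltr_wpDr.
have [g [gD gZ gK ge gx]] := cone_separation (@scale3Dl n) (@scale3Dr n) (@scale3A n)
  (@scale31 n) (@ball_cone_cone _ _ _ H _ HL n) (@ball_cone_unit _ _ _ H _ HL n) e'0 nK.
pose g0 x := g (x, 0, 0); pose g1 x := g (0, x, 0); pose g2 x := g (0, 0, x).
have gE x y z : g (x, y, z) = g0 x + g1 y + g2 z.
  by rewrite /g0 /g1 /g2 -!gD !add3 !addr0 !add0r.
have g0D x y : g0 (x + y) = g0 x + g0 y by rewrite /g0 -gD add3 !addr0.
have g1D x y : g1 (x + y) = g1 x + g1 y by rewrite /g1 -gD add3 !addr0.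
have g2D x y : g2 (x + y) = g2 x + g2 y by rewrite /g2 -gD add3 !addr0.
have g0Z (t : R) x : g0 (mxscale t%:C x) = t * g0 x by rewrite /g0 -gZ /scale3 /= !mxscale_0r.
have g1Z (t : R) x : g1 (mxscale t%:C x) = t * g1 x by rewrite /g1 -gZ /scale3 /= !mxscale_0r.
have g2Z (t : R) x : g2 (mxscale t%:C x) = t * g2 x by rewrite /g2 -gZ /scale3 /= !mxscale_0r.
have p0 : pos (re2 D (0 : 'M[V]_n)).
  have -> : re2 D (0 : 'M[V]_n) = 0 by apply/matrixP => i j; rewrite !mxE (inv_0 H) addr0.
  exact: pos0.
have [g0p g0a] := re2_functional H g0D (fun x h => gK _ (ball_cone_simple HL (w := (x, 0, 0)) h p0 p0)).
have [g1p g1a] := re2_functional H g1D (fun x h => gK _ (ball_cone_simple HL (w := (0, x, 0)) p0 h p0)).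
have [g2p g2a] := re2_functional H g2D (fun x h => gK _ (ball_cone_simple HL (w := (0, 0, x)) p0 p0 h)).
have [f0 f0cp f0E] := functional_cp H g0D g0Z g0p g0a.
have [f1 f1cp f1E] := functional_cp H g1D g1Z g1p g1a.
have [f2 f2cp f2E] := functional_cp H g2D g2Z g2p g2a.
(* Obtained from the extreme triple of the cone, where the three positivity conditions hold with
   equality; the factors 1/2 below compensate for [re2]. *)
have ball r (b : 'M[V]_r) xi : adj b = b -> L b <= 1 ->
    complex.Re (sform (ampl f1 b) xi xi) - complex.Re (sform (ampl f2 b) xi xi)
    <= complex.Re (sform (ampl f0 (one r)) xi xi).
  move=> hb Lb; rewrite f0E f1E f2E; set al := gam xi.
  have h2 (x : 'M[V]_n) : adj x = x -> re2 D (mxscale (2^-1)%:C x) = x.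
    move=> hx; rewrite /re2 (adjmxZr H) hx -mxscaleDl -rmorphD.
    have -> : 2^-1 + 2^-1 = 1 :> R by field.
    by rewrite mxscale1.
  have ho : adj (sandw al (one r)) = sandw al (one r) by rewrite adj_sandw // adj_one.
  have hbb : adj (sandw al b) = sandw al b by rewrite adj_sandw // hb.
  have : 0 <= g (mxscale (2^-1)%:C (sandw al (one r)), mxscale (2^-1)%:C (- sandw al b),
                 mxscale (2^-1)%:C (sandw al b)).
    apply: gK; exists r, b, al; split=> //=; rewrite h2 ?adjmxN ?hbb // ?subrr ?addNr;
    exact: pos0.
  rewrite gE g0Z g1Z g2Z.
  have -> : g1 (- sandw al b) = - g1 (sandw al b).
    apply: (addrI (g1 (sandw al b))); rewrite -g1D !subrr.
    by apply: (addrI (g1 0)); rewrite -g1D !addr0.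
  lra.
have fa : complex.Re (sform (ampl f0 (one n)) (eta n) (eta n)) <
   complex.Re (sform (ampl f1 a) (eta n) (eta n)) - complex.Re (sform (ampl f2 a) (eta n) (eta n)).
  rewrite f0E f1E f2E gam_eta !sandw1; move: gx; rewrite gE.
  have -> : g1 (- a) = - g1 a.
    apply: (addrI (g1 a)); rewrite -g1D !subrr.
    by apply: (addrI (g1 0)); rewrite -g1D !addr0.
  lra.
pose F v := f0 v + f1 v + f2 v.
have Fcp : cp D F by apply: cp_add => //; exact: cp_add.
have trF : \tr (F u) = 1.
  rewrite /F !mxtraceD !(trace_unit H) // f0E f1E f2E gam_eta sandw1 -!rmorphD -gE.
  by rewrite ge.
(* The value of g at the triple of units is 1, which is the trace of F u. Hence tau is unital. *)
pose tau v : 'M[C]_n := (\tr (F v))%:M.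
have taucp : cp D tau by exact: cp_trace.
have tauu : tau u = 1%:M by rewrite /tau trF.
set z1 := complex.Re (sform (ampl tau (one n)) (eta n) (eta n)).
pose gap := complex.Re (sform (ampl f1 a) (eta n) (eta n)) -
  complex.Re (sform (ampl f2 a) (eta n) (eta n)) -
  complex.Re (sform (ampl f0 (one n)) (eta n) (eta n)).
have gap0 : 0 < gap by rewrite /gap subr_gt0.
(* Keeps the strict inequality at a after f0 is perturbed: del * z1 < gap. *)
pose del := gap / (2 * (`|z1| + 1)).
have zz : 0 < 2 * (`|z1| + 1) by rewrite mulr_gt0 // ltr_wpDl.
have del0 : 0 < del by rewrite divr_gt0.
have delz : del * z1 < gap.
  have h : del * (2 * (`|z1| + 1)) = gap by rewrite /del divfK // gt_eqF.
  have := ler_norm z1; have := normr_ge0 z1; nra.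
have [Q Qu QE] := psd_perturb (cp_unit_psd H f0cp) del0.
pose f0' v := f0 v + del%:C *: tau v.
have f0'cp : cp D f0' by apply: cp_add => //; apply: cp_scale => //; exact: ltW.
have f0'u : f0' u = ctr Q *m Q by rewrite -QE /f0' tauu scalemx1.
pose cj (f : V -> 'M[C]_n) v := ctr (invmx Q) *m f v *m invmx Q.
have k0CS : CS D (cj f0') by exact: cp_normalize.
have k1cp : cp D (cj f1) by exact: cp_conj.
have k2cp : cp D (cj f2) by exact: cp_conj.
pose G v := cj f1 v - cj f2 v.
have GE r (b : 'M[V]_r) x y : sform (ampl G b) x y =
    sform (ampl f1 b) (vmul (invmx Q) x) (vmul (invmx Q) y)
    - sform (ampl f2 b) (vmul (invmx Q) x) (vmul (invmx Q) y).
  by rewrite -!sform_conj -sformB; apply: eq_sform => p q; rewrite /ampl !mxE.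
(* Unitality of the conjugated f0' rewrites the squared norm of x as the value of f0' at the unit,
   so the domination by f0 becomes a bound by the squared norm. *)
have oneE r x : vn2 x = complex.Re (sform (ampl f0 (one r)) (vmul (invmx Q) x) (vmul (invmx Q) x))
    + del * complex.Re (sform (ampl tau (one r)) (vmul (invmx Q) x) (vmul (invmx Q) x)).
  have := sform_one_CS x k0CS; rewrite sform_conj.
  move=> /(congr1 (@complex.Re R)) /= <-; rewrite -Re_scale -ReD -sformZ -sformD.
  by congr complex.Re; apply: eq_sform => p q; rewrite /ampl !mxE.
have taupos r (x : 'I_r * 'I_n -> C) : 0 <= complex.Re (sform (ampl tau (one r)) x x).
  have /psdP/(_ x) := taucp.2 _ _ (pos_one H r); by rewrite lecE => /andP[_].
have Gball r (b : 'M[V]_r) x : adj b = b -> L b <= 1 ->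
    complex.Re (sform (ampl G b) x x) <= vn2 x.
  move=> hb Lb; rewrite GE ReB oneE; apply: le_trans (ball _ _ _ hb Lb) _.
  by rewrite lerDl mulr_ge0 // ltW.
have Ginv v : G (inv v) = ctr (G v).
  rewrite /G !(cp_inv H) //; apply/matrixP => i j; by rewrite !mxE cjB.
have Glin : lin G.
  move=> c v w; rewrite /G k1cp.1 k2cp.1 scalerBr opprD; exact: addrACA.
(* All real multiples of the unit have L = 0 and lie in the ball. The form of G at t times the unit
   is thus bounded above for every real t, which forces slope 0. *)
have Gu : G u = 0.
  apply: sform_zero => y; pose x (p : 'I_1 * 'I_n) := y p.2.
  have -> : sform (fun i j => G u i j) y y = sform (ampl G (one 1)) x x.
    by rewrite one1 sform_const.
  have hz := sform_hadj (one 1) x x Ginv; rewrite adj_one // in hz.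
  have hr : complex.Re (sform (ampl G (one 1)) x x) = 0.
    apply: (@unbounded_slope (vn2 x)) => t.
    rewrite -Re_scale -(sform_amplZ Glin); apply: Gball; first by rewrite adjmxZr // adj_one.
    by rewrite (L_scale HL) (L_scmx HL) mulr0 ler01.
  by rewrite (fixed_conj (esym hz)) hr.
have [c0 c00 hc0] : exists2 c : R, 0 <= c & psd (fun i j => (c%:C%:M - cj f1 u) i j).
  apply: herm_bound; apply/matrixP => i j; rewrite mxE.
  by rewrite -(psd_herm (cp_unit_psd H k1cp)).
pose c := c0 + 1; have c_gt0 : 0 < c by rewrite ltr_wpDl.
have hc : psd (fun i j => (c%:C%:M - cj f1 u) i j).
  have := psdD hc0 (@psd_ctrM _ _ _ (1%:M : 'M[C]_n)).
  have -> : c%:C%:M - cj f1 u = (c0%:C%:M - cj f1 u) + 1%:M.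
    by rewrite /c rmorphD rmorph1 raddfD /= addrAC.
  by apply: eq_psd => i j; rewrite ctr1 mulmx1 [RHS]mxE.
have [T TE] := psd_factor hc.
(* G = cj f1 - cj f2 vanishes at the unit; padding both terms with the same multiple of tau
   makes them unital up to the factor c. *)
pose mk (f : V -> 'M[C]_n) v := (c^-1)%:C *: (cj f v + ctr T *m tau v *m T).
have mkCS f : cp D (cj f) -> cj f u = cj f1 u -> CS D (mk f).
  move=> fcp fu; apply/CS_cp; split.
    apply: cp_scale; first by rewrite invr_ge0 ltW.
    by apply: cp_add => //; exact: cp_conj.
  rewrite /mk fu tauu mulmx1 -TE addrC subrK scale_scalar_mx -rmorphM mulVf ?rmorph1 //.
  by rewrite gt_eqF.
have f2u : cj f2 u = cj f1 u by apply/esym/eqP; rewrite -subr_eq0; apply/eqP.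
have diff v : mk f1 v - mk f2 v = (c^-1)%:C *: G v.
  rewrite /mk -scalerBr; congr (_ *: _); rewrite opprD addrACA subrr addr0 //.
(* The bound on selfadjoint elements is applied to [offd D b] at the vector (x, - y), whose form is
   minus twice the real part of the form of G at b. *)
have Gopn r (b : 'M[V]_r) : L b <= 1 -> opn (ampl G b) <= 1.
  move=> Lb; apply: opn_le_Re => // x y.
  have := Gball _ (offd D b) (gluev x (fun p => - 1 * y p)) (adj_offd H b) (le_trans (L_offd HL b) Lb).
  rewrite vn2_gluev vn2Z cabsN cabs1 expr1n mul1r sform_offd ?lin0 //.
  have -> : sform (ampl G b) (lpart (gluev x (fun p => - 1 * y p))) (rpart (gluev x (fun p => - 1 * y p)))
     = - sform (ampl G b) x y.
    rewrite -[RHS]mulN1r -sformZr; apply: sform_ext => p; rewrite ?lpart_gluev ?rpart_gluev //.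
  rewrite ReD Re_cj ReN; lra.
exists (mk f1), (mk f2), c; split=> //; [exact: mkCS|exact: mkCS| |].
  move=> r b /Gopn h; rewrite (ampl_distE _ c_gt0 diff) -[leRHS]mulr1.
  by rewrite ler_pM2l // invr_gt0.
rewrite (ampl_distE _ c_gt0 diff) -[ltLHS]mulr1 ltr_pM2l ?invr_gt0 //.
rewrite ltNge; apply/negP => h.
(* At Q applied to [eta n] the squared norm equals f0 of the unit plus del * z1, which is strictly
   below f1 a - f2 a; a bound by 1 is impossible. *)
have := opn_sform (vmul Q (eta n)) (vmul Q (eta n)) h; rewrite mul1r.
have := Re_le_cabs (sform (ampl G a) (vmul Q (eta n)) (vmul Q (eta n))).
rewrite GE ReB (oneE n).
have ee (f : V -> 'M[C]_n) (b : 'M[V]_n) : sform (ampl f b) (vmul (invmx Q) (vmul Q (eta n))) (vmul (invmx Q) (vmul Q (eta n))) = sform (ampl f b) (eta n) (eta n).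
  by apply: sform_ext => p; exact: vmul_inv.
rewrite !ee -/z1; move: delz; rewrite /gap; lra.
Qed.
End BipolarMain.

(** * The seminorm of the state metric *)

Section LipDistance.
Variable R : realType.
Local Notation C := (R[i]).
Variable V : lmodType C.
Variable D : mou_data V.
Hypothesis H : is_mou D.
Local Notation inv := (Defs.inv D).
Local Notation u := (Defs.unit D).
Local Notation pos := (Defs.pos D).
Local Notation one := (one_mx D).
Local Notation adj := (adjmx inv).
Variable L : lipT V.
Hypothesis HL : is_mlipsn D L.

Lemma DL_ge n (phi psi : V -> 'M[C]_n) r (b : 'M[V]_r) : L b <= 1 ->
  ((ampl_dist phi psi b)%:E <= DL L phi psi)%E.
Proof. by move=> Lb; apply: ereal_sup_ubound; exists r, b. Qed.

Lemma DL_le n (phi psi : V -> 'M[C]_n) (t : R) :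
  (forall r (b : 'M[V]_r), L b <= 1 -> ampl_dist phi psi b <= t) -> (DL L phi psi <= t%:E)%E.
Proof. by move=> h; apply: ge_ereal_sup => _ [r [b [Lb ->]]]; rewrite lee_fin h. Qed.

Lemma ampl_dist_ge0 n (phi psi : V -> 'M[C]_n) r (b : 'M[V]_r) : 0 <= ampl_dist phi psi b.
Proof. exact: opn_ge0. Qed.

Lemma DL_ge0 n (phi psi : V -> 'M[C]_n) : (0 <= DL L phi psi)%E.
Proof.
have h : L (0 : 'M[V]_0) <= 1 by rewrite (L_0 HL).
by apply: le_trans (DL_ge phi psi h); rewrite lee_fin ampl_dist_ge0.
Qed.

Lemma ampl_dist_scale n (phi psi : V -> 'M[C]_n) r (b : 'M[V]_r) (c : R) : lin phi -> lin psi ->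
  0 <= c -> ampl_dist phi psi (mxscale c%:C b) <= c * ampl_dist phi psi b.
Proof.
move=> l1 l2 c0; rewrite -[X in X * _](cabs_real c0); apply: le_trans (opnZ_le _ _).
by rewrite le_eqVlt; apply/orP; left; apply/eqP; apply: eq_opn => p q; rewrite !amplZ // mulrBr.
Qed.

Lemma ampl_dist_lt n (phi psi : V -> 'M[C]_n) r (x : 'M[V]_r) (K d : R) : lin phi -> lin psi ->
  0 < K -> L x <= K -> (DL L phi psi < d%:E)%E -> ampl_dist phi psi x <= K * d.
Proof.
move=> l1 l2 K0 Lx hd; have Ki : 0 <= K^-1 by rewrite invr_ge0 ltW.
have Lb : L (mxscale (K^-1)%:C x) <= 1.
  by rewrite (L_scale HL) cabs_real // ler_pdivrMl // mulr1.
have := le_lt_trans (DL_ge phi psi Lb) hd; rewrite lte_fin => h.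
have := ampl_dist_scale (mxscale (K^-1)%:C x) l1 l2 (ltW K0).
rewrite mxscaleA -rmorphM mulfV ?gt_eqF // mxscale1 => /le_trans; apply.
by rewrite ler_pM2l // ltW.
Qed.

Lemma LD_le1 n (b : 'M[V]_n) : L b <= 1 -> (LD D L b <= 1%:E)%E.
Proof.
move=> Lb; apply: ge_ereal_sup => _ [r [phi [psi [h1 h2 _ ->]]]].
have := DL_ge phi psi Lb; have := DL_ge0 phi psi.
(* An infinite distance gives ratio 0 by the definition of [eratio], and a zero distance gives ratio
   0 since the inverse of 0 is 0. *)
case: (DL L phi psi) => [y|_ _|//] /=; last by rewrite lee_fin.
rewrite !lee_fin => y0 h; have [->|y0'] := eqVneq y 0; first by rewrite invr0 mulr0.
by rewrite ler_pdivrMr ?mul1r // lt_def y0' y0.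
Qed.

Hypothesis HB : induces_BW D L.

(** The metric controls pointwise convergence, so distance 0 puts the states within every e of each
    other at each v. It is needed because a ratio with zero denominator carries no information. *)
Lemma DL_eq0 n (phi psi : V -> 'M[C]_n) : CS D phi -> CS D psi -> DL L phi psi = 0%E -> phi = psi.
Proof.
move=> h1 h2 h0; apply/funext => v; have [_ hb] := HB n.
have small e : 0 < e -> mxn (phi v - psi v) < e.
  move=> e0; have [d [d0 h]] := hb phi h1 [:: v] e e0.
  by apply: (h psi h2); rewrite ?mem_head // h0 lte_fin.
have z : mxn (phi v - psi v) <= 0 by apply/ler_addgt0Pr => e /small /ltW; rewrite add0r.
apply/matrixP => i j; apply/eqP; rewrite -subr_eq0; apply/eqP/cabs_eq0/eqP.
rewrite eq_le cabs_ge0 andbT; apply: le_trans z.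
by have := opn_entry (fun i j => (phi v - psi v) i j) i j; rewrite !mxE.
Qed.

(** If a were far from the ball, the states of [separating_states] would have D_L-distance at most
    1/c but move a by more than 1/c, contradicting L_D a <= 1. *)
Lemma LD_approx_herm n (a : 'M[V]_n) (eps : R) : adj a = a -> (LD D L a <= 1%:E)%E -> 0 < eps ->
  exists2 b : 'M[V]_n, L b <= 1 & mnorm D (a - b) <= eps.
Proof.
move=> ha hLD eps0; have [u0|u0] := pselect (u = 0).
  exists 0; first by rewrite (L_0 HL).
  have -> : a - 0 = 0 by apply/matrixP => i j; rewrite [LHS](unit0_trivial H u0) mxE.
  by rewrite mnorm0 // ltW.
apply: contrapT => hfar.
have [phi [psi [c [h1 h2 c0 hball ha']]]] : exists (phi psi : V -> 'M[C]_n) (c : R),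
   [/\ CS D phi, CS D psi, 0 < c,
    (forall r (b : 'M[V]_r), L b <= 1 -> ampl_dist phi psi b <= c^-1) &
    c^-1 < ampl_dist phi psi a].
  apply: (separating_states H HL u0 ha eps0) => b Lb; rewrite ltNge; apply/negP => h.
  by apply: hfar; exists b.
have ci : 0 < c^-1 by rewrite invr_gt0.
have ne : phi <> psi.
  move=> e; have h : ampl_dist phi phi a = 0.
    by rewrite /ampl_dist (@eq_opn _ _ _ _ (fun _ _ => 0)) ?opn_0 // => p q; rewrite subrr.
  by move: ha'; rewrite -e h ltNge ltW.
have hDL := DL_le hball; have hDL0 := DL_ge0 phi psi.
have hne : DL L phi psi <> 0%E by move=> /(DL_eq0 h1 h2).
have : (eratio (ampl_dist phi psi a) (DL L phi psi) <= 1%:E)%E.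
  by apply: le_trans hLD; apply: ereal_sup_ubound; exists n, phi, psi.
move: hDL hDL0 hne; case: (DL L phi psi) => [y| |] //=.
rewrite !lee_fin => y1 y0 yn.
have yp : 0 < y by rewrite lt_def y0 andbT; apply/eqP => e; apply: yn; rewrite e.
rewrite ler_pdivrMr // mul1r => h; move: ha'; rewrite ltNge => /negP; apply.
exact: le_trans h y1.
Qed.

Lemma CS_inv n (phi : V -> 'M[C]_n) v : CS D phi -> phi (inv v) = ctr (phi v).
Proof. by move=> /CS_cp [h _]; exact: cp_inv. Qed.

Lemma LD_offd n (a : 'M[V]_n) : (LD D L a <= 1%:E)%E -> (LD D L (offd D a) <= 1%:E)%E.
Proof.
move=> h; apply: ge_ereal_sup => _ [r [phi [psi [h1 h2 hne ->]]]].
have : (eratio (ampl_dist phi psi a) (DL L phi psi) <= 1%:E)%E.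
  by apply: le_trans h; apply: ereal_sup_ubound; exists r, phi, psi.
have hd : ampl_dist phi psi (offd D a) <= ampl_dist phi psi a.
  pose G v := phi v - psi v.
  have e k (b : 'M[V]_k) : ampl_dist phi psi b = opn (ampl G b).
    by apply: eq_opn => p q; rewrite /ampl !mxE.
  rewrite !e; apply: opn_offd.
    by rewrite /G (lin0 (CS_lin h1)) (lin0 (CS_lin h2)) subrr.
  by move=> v; rewrite /G !CS_inv //; apply/matrixP => i j; rewrite !mxE cjB.
have := DL_ge0 phi psi; case: (DL L phi psi) => [y| |] //=.
rewrite !lee_fin => y0; apply: le_trans; apply: ler_wpM2r hd; by rewrite invr_ge0.
Qed.

(** The selfadjoint case is applied to [offd D a]. The upper right corner of the approximant is a
    product with contractions on both sides, so passing to it increases neither L nor the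
    distance. *)
Theorem LD_approx n (a : 'M[V]_n) (eps : R) : (LD D L a <= 1%:E)%E -> 0 < eps ->
  exists2 b : 'M[V]_n, L b <= 1 & mnorm D (a - b) <= eps.
Proof.
move=> /LD_offd h eps0.
have [b Lb hb] := LD_approx_herm (adj_offd H a) h eps0.
exists (ursubmx b).
  have -> : ursubmx b = lrmul (row_mx 1%:M 0) b (col_mx 0 1%:M).
    apply/matrixP => i j; rewrite !mxE (bigD1 (lshift n i)) //= [X in _ + X]big1 ?addr0.
      rewrite (bigD1 (rshift n j)) //= big1 ?addr0 => [|l ln].
        by rewrite row_mxEl col_mxEd !mxE !eqxx mulr1 scale1r.
      case: (split_ordP l) ln => l' -> ln; first by rewrite col_mxEu [X in _ * X]mxE mulr0 scale0r.
      rewrite col_mxEd [X in _ * X]mxE; case: eqVneq => [e|_]; last by rewrite mulr0 scale0r.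
      by rewrite e eqxx in ln.
    move=> k kn; apply: big1 => l _.
    case: (split_ordP k) kn => k' -> kn; last by rewrite row_mxEr [X in X * _]mxE mul0r scale0r.
    rewrite row_mxEl [X in X * _]mxE; case: eqVneq => [e|_]; last by rewrite mul0r scale0r.
    by rewrite e eqxx in kn.
  apply: le_trans Lb; apply: (L_contract HL).
    rewrite -mxn_ctr; apply: mxn_le1.
    rewrite ctrK.
    have -> : ctr (row_mx 1%:M 0 : 'M[C]_(n, n + n)) = col_mx 1%:M 0.
      apply/matrixP => i j; rewrite mxE; case: (split_ordP i) => i' ->.
        by rewrite row_mxEl col_mxEu !mxE cj_nat eq_sym.
      by rewrite row_mxEr col_mxEd !mxE cj0.
    rewrite mul_row_col mulmx1 mulmx0 addr0 subrr; apply/psdP => x.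
    by rewrite (@eq_sform _ _ _ _ (fun _ _ => 0)) ?sform0 // => ? ?; rewrite mxE.
  apply: mxn_le1.
  have -> : ctr (col_mx 0 1%:M : 'M[C]_(n + n, n)) = row_mx 0 1%:M.
    apply/matrixP => i j; rewrite mxE; case: (split_ordP j) => j' ->.
      by rewrite row_mxEl col_mxEu !mxE cj0.
    by rewrite row_mxEr col_mxEd !mxE cj_nat eq_sym.
  rewrite mul_row_col mulmx1 mul0mx add0r subrr; apply/psdP => x.
  by rewrite (@eq_sform _ _ _ _ (fun _ _ => 0)) ?sform0 // => ? ?; rewrite mxE.
have -> : a - ursubmx b = ursubmx (offd D a - b).
  rewrite -{1}[a](block_mxKur 0 a (adj a) 0) -/(offd D a).
  by apply/matrixP => i j; rewrite !mxE.
exact: le_trans (mnorm_ursub H _) hb.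
Qed.
End LipDistance.

(** * Compactness of matrix states *)

Section UltraLimits.
Variables (R : realType) (T : Type) (U : set_system T).
Local Notation C := (R[i]).
Context {UU : UltraFilter U}.

Definition uconv (f : T -> C) (l : C) := forall eps : R, 0 < eps ->
  U (fun t => cabs (f t - l) <= eps).

Lemma ultra_and (A B : set T) : U A -> U B -> U (fun t => A t /\ B t).
Proof. exact: filterI. Qed.

Lemma ultra_sub (A B : set T) : U A -> (forall t, A t -> B t) -> U B.
Proof. by move=> h hs; apply: filterS h. Qed.

Lemma ultra_ex (A : set T) : U A -> exists t, A t.
Proof. by move=> /filter_ex. Qed.

Lemma uconv_cst c : uconv (fun=> c) c.
Proof. by move=> e e0; apply: filterE => t; rewrite subrr cabs0 ltW. Qed.

Lemma uconvD f g l m : uconv f l -> uconv g m -> uconv (fun t => f t + g t) (l + m).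
Proof.
move=> hf hg e e0; have e2 : 0 < e / 2 by rewrite divr_gt0.
apply: (ultra_sub (ultra_and (hf _ e2) (hg _ e2))) => t [h1 h2].
by rewrite opprD addrACA; apply: le_trans (cabsD _ _) _; lra.
Qed.

Lemma uconvZ c f l : uconv f l -> uconv (fun t => c * f t) (c * l).
Proof.
move=> hf e e0; have c1 : 0 < cabs c + 1 by rewrite ltr_wpDl // cabs_ge0.
have e2 : 0 < e / (cabs c + 1) by rewrite divr_gt0.
apply: (ultra_sub (hf _ e2)) => t h; rewrite -mulrBr cabsM.
apply: (@le_trans _ _ ((cabs c + 1) * cabs (f t - l))).
  by apply: ler_wpM2r; [exact: cabs_ge0 | rewrite lerDl].
by rewrite mulrC -ler_pdivlMr.
Qed.

Lemma uconv_ext f g l : (forall t, f t = g t) -> uconv f l -> uconv g l.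
Proof. by move=> h hf e e0; apply: (ultra_sub (hf e e0)) => t; rewrite h. Qed.

Lemma uconv_sum (I : finType) (f : I -> T -> C) (l : I -> C) :
  (forall i, uconv (f i) (l i)) -> uconv (fun t => \sum_i f i t) (\sum_i l i).
Proof.
move=> h; suff: forall s : seq I, uconv (fun t => \sum_(i <- s) f i t) (\sum_(i <- s) l i) by [].
elim=> [|i s IH].
  by apply: (@uconv_ext (fun=> 0)) => [t|]; rewrite !big_nil //; exact: uconv_cst.
rewrite big_cons; apply: uconv_ext (uconvD (h i) IH) => t; by rewrite big_cons.
Qed.

Lemma uconv_unique f g l m : U (fun t => f t = g t) -> uconv f l -> uconv g m -> l = m.
Proof.
move=> hfg hf hg; apply/eqP; rewrite -subr_eq0; apply/eqP/cabs_eq0/eqP.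
rewrite eq_le cabs_ge0 andbT; apply/ler_addgt0Pr => e e0; rewrite add0r.
have e2 : 0 < e / 2 by rewrite divr_gt0.
have [t [[ht h1] h2]] := ultra_ex (ultra_and (ultra_and hfg (hf _ e2)) (hg _ e2)).
have -> : l - m = - (f t - l) + (g t - m) by rewrite ht; ring.
by apply: le_trans (cabsD _ _) _; rewrite cabsN; lra.
Qed.

Lemma cabs_i : cabs ('i%C : C) = 1.
Proof.
by apply: complexI; rewrite cabsE normc_def /= expr0n /= expr1n add0r sqrtr1.
Qed.

Lemma Im_le_cabs (z : C) : `|complex.Im z| <= cabs z.
Proof.
have h (w : C) : - complex.Im w <= cabs w.
  have := Re_le_cabs (w * 'i%C); rewrite ReiNIm cabsM => /le_trans; apply.
  by rewrite -[leRHS]mulr1; rewrite [X in _ * X <= _](_ : _ = 1) //; exact: cabs_i.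
rewrite ler_norml; apply/andP; split; first by have := h z; lra.
by have := h (- z); rewrite cabsN; case: (z) => a b /=; rewrite opprK.
Qed.

Lemma uconv_ge0 f l : U (fun t => 0 <= f t) -> uconv f l -> 0 <= l.
Proof.
move=> h hf; have key e : 0 < e -> - e <= complex.Re l /\ `|complex.Im l| <= e.
  move=> e0; have [t [h1 h2]] := ultra_ex (ultra_and h (hf e e0)).
  move: h1; rewrite lecE => /andP[/eqP /= im0 re0].
  have := Im_le_cabs (f t - l); have := Re_le_cabs (f t - l).
  have -> : complex.Im (f t - l) = - complex.Im l.
    by move: im0; case: (f t) (l) => a b [a' b'] /= ->; rewrite sub0r.
  rewrite ReB normrN => hr hi; split; last exact: le_trans hi h2.
  lra.
rewrite lecE; apply/andP; split.
  rewrite /= -normr_eq0 eq_le normr_ge0 andbT.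
  by apply/ler_addgt0Pr => e /key[_]; rewrite add0r.
rewrite /= -oppr_le0; apply/ler_addgt0Pr => e /key[h1 _]; rewrite add0r; lra.
Qed.

(** The limit is the supremum of the levels r with r <= f on a set of U; the ultrafilter decides
    whether f exceeds that supremum by e. *)
Lemma ultra_real_limit (f : T -> R) (M : R) : U (fun t => `|f t| <= M) ->
  exists l, forall eps, 0 < eps -> U (fun t => `|f t - l| <= eps).
Proof.
move=> hM; pose S : set R := fun r => U (fun t => r <= f t).
have S0 : S (- M) by apply: (ultra_sub hM) => t; rewrite ler_norml => /andP[].
have Sub : has_ubound S.
  exists M => r hr; have [t [h1 h2]] := ultra_ex (ultra_and hM hr).
  apply: le_trans h2 _; exact: le_trans (ler_norm _) h1.
exists (sup S) => e e0.
have [r Sr hr] := sup_adherent e0 (conj (ex_intro _ _ S0) Sub).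
have h2 : U (fun t => f t <= sup S + e).
  have [h|h] := @in_ultra_setVsetC _ _ (fun t => f t <= sup S + e) UU; first exact: h.
  have : S (sup S + e).
    by apply: (ultra_sub h) => t /negP; rewrite -ltNge => /ltW.
  by move=> /(ub_le_sup Sub) h'; lra.
apply: (ultra_sub (ultra_and Sr h2)) => t [h3 h4].
rewrite ler_distl; apply/andP; split=> //; lra.
Qed.

Lemma ultra_limit (f : T -> C) (M : R) : U (fun t => cabs (f t) <= M) -> exists l, uconv f l.
Proof.
move=> hM.
have [a ha] : exists a, forall eps, 0 < eps -> U (fun t => `|complex.Re (f t) - a| <= eps).
  apply: (@ultra_real_limit _ M); apply: (ultra_sub hM) => t h.
  rewrite ler_norml; apply/andP; split; last exact: le_trans (Re_le_cabs _) h.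
  by have := Re_le_cabs (- f t); rewrite ReN cabsN; lra.
have [b hb] : exists b, forall eps, 0 < eps -> U (fun t => `|complex.Im (f t) - b| <= eps).
  apply: (@ultra_real_limit _ M); apply: (ultra_sub hM) => t h.
  exact: le_trans (Im_le_cabs _) h.
exists (Complex a b) => e e0; have e2 : 0 < e / 2 by rewrite divr_gt0.
apply: (ultra_sub (ultra_and (ha _ e2) (hb _ e2))) => t [h1 h2].
have -> : f t - Complex a b = (complex.Re (f t) - a)%:C + (complex.Im (f t) - b)%:C * 'i%C.
  by case: (f t) => x y; apply/eqP; rewrite eq_complex /= !(mul0r, mulr0, mulr1, addr0, subr0, add0r) !eqxx.
have cr (x : R) : cabs x%:C = `|x|.
  by apply: complexI; rewrite cabsE normc_def /= expr0n addr0 sqrtr_sqr.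
apply: le_trans (cabsD _ _) _; rewrite cabsM [X in _ + _ * X <= _](_ : _ = 1); last exact: cabs_i.
by rewrite mulr1 !cr; lra.
Qed.
End UltraLimits.

(** * Pointwise limits of states and precompactness of Lip-balls *)

Section Compactness.
Variable R : realType.
Local Notation C := (R[i]).
Variable V : lmodType C.
Variable D : mou_data V.
Hypothesis H : is_mou D.
Local Notation inv := (Defs.inv D).
Local Notation u := (Defs.unit D).
Local Notation pos := (Defs.pos D).

Lemma CS_entry n (phi : V -> 'M[C]_n) v i j : CS D phi ->
  cabs (phi v i j) <= mnorm D (const_mx v : 'M_1).
Proof.
move=> h; apply: le_trans (opn_mnorm H (const_mx v) h).
by have := opn_entry (ampl phi (const_mx v : 'M_1)) (ord0, i) (ord0, j); rewrite /ampl mxE.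
Qed.

(** Entries at v are bounded by the norm of v, so ultralimits exist at each v, and linearity,
    unitality and positivity pass to the pointwise limit. *)
Lemma CS_compact n (U : set_system (V -> 'M[C]_n)) : UltraFilter U -> U (fun phi => CS D phi) ->
  exists2 phi : V -> 'M[C]_n, CS D phi & forall v i j, uconv U (fun psi => psi v i j) (phi v i j).
Proof.
move=> UU UCS.
have ex v i j : exists l, uconv U (fun psi : V -> 'M[C]_n => psi v i j) l.
  apply: (@ultra_limit _ _ _ UU _ (mnorm D (const_mx v : 'M_1))).
  by apply: (ultra_sub UCS) => psi /CS_entry.
have [phi hphi] : exists phi : V -> 'M[C]_n,
    forall v i j, uconv U (fun psi => psi v i j) (phi v i j).
  exists (fun v => \matrix_(i, j) projT1 (cid (ex v i j))) => v i j.
  by rewrite mxE; exact: projT2 (cid (ex v i j)).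
exists phi => //; split.
- move=> c v w; apply/matrixP => i j; rewrite !mxE.
  apply: uconv_unique (hphi _ i j) (uconvD (uconvZ c (hphi v i j)) (hphi w i j)).
  by apply: (ultra_sub UCS) => psi [l _ _]; rewrite l !mxE.
- apply/matrixP => i j; apply: uconv_unique (hphi u i j) (uconv_cst _).
  by apply: (ultra_sub UCS) => psi [_ -> _].
move=> r a pa; apply/psdP => x.
apply: (@uconv_ge0 _ _ _ UU (fun psi => sform (ampl psi a) x x)).
  by apply: (ultra_sub UCS) => psi [_ _ hp]; have /psdP := hp _ _ pa.
apply: uconv_sum => p; apply: uconv_sum => q.
apply: (@uconv_ext _ _ _ UU (fun psi => ((x p)^* * x q) * psi (a p.1 q.1) p.2 q.2)).
  by move=> psi; rewrite mulrAC.
by rewrite mulrAC; apply: uconvZ.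
Qed.

Variable L : lipT V.
Hypothesis HL : is_mlipsn D L.
Hypothesis HB : induces_BW D L.

Lemma uconv_mxn n (T : Type) (U : set_system T) (UU : UltraFilter U) (F : T -> 'M[C]_n) (A : 'M[C]_n)
    (del : R) : 0 < del ->
  (forall i j, uconv U (fun t => F t i j) (A i j)) -> U (fun t => mxn (A - F t) < del).
Proof.
move=> d0 h; pose g t := \sum_i \sum_j cabs (A i j - F t i j).
have : uconv U (fun t => (g t)%:C) 0.
  have h0 i j : uconv U (fun t => (cabs (A i j - F t i j))%:C) 0.
    move=> e e0; apply: (ultra_sub (h i j e e0)) => t.
    by rewrite subr0 cabs_real ?cabs_ge0 // -(cabsN (F t i j - _)) opprB.
  have := uconv_sum (fun i => uconv_sum (h0 i)); rewrite big1 => [|i _]; last by rewrite big1.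
  move=> /(_ UU UU) hs; apply: (@uconv_ext _ _ _ UU _ _ _ _ hs) => t; rewrite /g rmorph_sum.
  by apply: eq_bigr => i _; rewrite rmorph_sum.
have d2 : 0 < del / 2 by rewrite divr_gt0.
move=> /(_ _ d2) hd; apply: (ultra_sub hd) => t; rewrite subr0 cabs_real => [ht|]; last first.
  by apply: sumr_ge0 => i _; apply: sumr_ge0 => j _; exact: cabs_ge0.
apply: le_lt_trans (opn_le_sum _) _; apply: (@le_lt_trans _ _ (g t)); last lra.
by apply: ler_sum => i _; apply: ler_sum => j _; rewrite !mxE.
Qed.

Lemma ultra_all (T : Type) (U : set_system T) (UU : UltraFilter U) (A : eqType) (s : seq A)
    (P : A -> T -> Prop) : (forall a, a \in s -> U (P a)) -> U (fun t => forall a, a \in s -> P a t).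
Proof.
elim: s => [|a s IH] h; first by apply: filterE.
have h1 : U (P a) by apply: h; rewrite mem_head.
have h2 : U (fun t => forall b, b \in s -> P b t).
  by apply: IH => b bs; apply: h; rewrite inE bs orbT.
apply: (ultra_sub (ultra_and h1 h2)) => t [ha hs] b; rewrite inE => /orP[/eqP ->|/hs] //.
Qed.

(** If no finite family worked, the states far from finitely many given ones would generate a proper
    filter. An ultrafilter above it has a pointwise limit phi, which by [induces_BW] is D_L-close to
    U-many states, although U-many states are far from phi. *)
Lemma CS_cover n (eps : R) : 0 < eps ->
  exists s : seq (V -> 'M[C]_n), forall phi, CS D phi ->
    exists psi, [/\ List.In psi s, CS D psi & (DL L psi phi < eps%:E)%E].
Proof.
move=> e0; apply: contrapT => hno.
pose far (s : seq (V -> 'M[C]_n)) : set (V -> 'M[C]_n) := fun phi =>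
  CS D phi /\ forall psi, List.In psi s -> CS D psi -> ~ (DL L psi phi < eps%:E)%E.
pose F : set_system (V -> 'M[C]_n) := fun A => exists s, forall phi, far s phi -> A phi.
have PF : ProperFilter F.
  apply: Build_ProperFilter_ex.
    move=> A [s hs]; apply: contrapT => hA; apply: hno; exists s => phi hphi.
    apply: contrapT => hn; apply: hA; exists phi; apply: hs; split=> // psi h1 h2 h3.
    by apply: hn; exists psi.
  split.
  - by exists nil.
  - move=> A B [s hs] [s' hs']; exists (s ++ s')%list => phi [h1 h2]; split.
      by apply: hs; split=> // psi hin; apply: h2; apply/List.in_or_app; left.
    by apply: hs'; split=> // psi hin; apply: h2; apply/List.in_or_app; right.
  - by move=> A B AB [s hs]; exists s => phi /hs /AB.
have [U [UU FU]] := ultraFilterLemma PF.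
have UCS : U (fun phi => CS D phi) by apply: FU; exists nil => phi [].
have [phi hphi conv] := CS_compact UU UCS.
have [near _] := HB n; have [s [del [d0 hs]]] := near phi hphi eps e0.
have Unear : U (fun psi => forall a, a \in s -> mxn (phi a - psi a) < del).
  by apply: ultra_all => a _; apply: (uconv_mxn UU d0) => i j; exact: conv.
have Ufar : U (far [:: phi]) by apply: FU; exists [:: phi].
have [psi [[h1 h2] [h3 h4]]] := ultra_ex (ultra_and (ultra_and UCS Unear) Ufar).
by apply: (h4 phi) => //; [left | exact: hs].
Qed.

Lemma ultra_all_list (T : Type) (U : set_system T) (UU : UltraFilter U) (A : Type) (s : list A)
    (P : A -> T -> Prop) : (forall a, U (P a)) -> U (fun t => forall a, List.In a s -> P a t).
Proof.
move=> h; elim: s => [|a s IH]; first by apply: filterE.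
by apply: (ultra_sub (ultra_and (h a) IH)) => t [ha hs] b [<-|/hs].
Qed.

(* Arzela-Ascoli along an ultrafilter: the b t are equi-Lipschitz on the states, which
   finitely many D_L-balls cover. *)
Lemma ultra_precompact (T : Type) (U : set_system T) (UU : UltraFilter U) (b : T -> V) (K eps : R) :
  0 < eps ->
  U (fun t => L (const_mx (b t) : 'M_1) <= K /\ mnorm D (const_mx (b t) : 'M_1) <= K) ->
  exists w : V, L (const_mx w : 'M_1) <= K /\
    U (fun t => mnorm D (const_mx (b t) - const_mx w : 'M_1) <= eps).
Proof.
move=> e0 hb.
have K0 : 0 <= K.
  by have [t [h _]] := ultra_ex hb; apply: le_trans h; exact: (L_ge0 HL).
have K1 : 0 < 2 * K + 1 by rewrite ltr_wpDl // mulr_ge0.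
(* Differences of two b t have L at most 2 K, so moving to a nearby state costs at most eps / 2. The
   [+ 1] keeps the divisor positive when K = 0. *)
have d0 : 0 < eps / 2 / (2 * K + 1) by rewrite !divr_gt0.
have e2 : 0 < eps / 4 by rewrite divr_gt0.
(* Size 1 + 1 is what [mnorm_le] requires for the norm on M_1(V). *)
have [s hs] := @CS_cover (1 + 1) _ d0.
pose close (psi : V -> 'M[C]_(1 + 1)) (w v : V) := CS D psi -> mxn (psi w - psi v) <= eps / 2.
have hl (psi : V -> 'M[C]_(1 + 1)) : exists A : 'M[C]_(1 + 1), CS D psi ->
    U (fun t => mxn (A - psi (b t)) < eps / 4).
  have [hpsi|hpsi] := pselect (CS D psi); last by exists 0.
  have ex i j : exists l, uconv U (fun t => psi (b t) i j) l.
    apply: (@ultra_limit _ _ _ UU _ K); apply: (ultra_sub hb) => t [_ h].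
    exact: le_trans (CS_entry _ _ _ hpsi) h.
  exists (\matrix_(i, j) projT1 (cid (ex i j))) => _; apply: uconv_mxn => // i j.
  by rewrite mxE; exact: projT2 (cid (ex i j)).
pose A psi := projT1 (cid (hl psi)).
have hA psi : U (fun t => CS D psi -> mxn (A psi - psi (b t)) < eps / 4).
  have [hpsi|hpsi] := pselect (CS D psi); last by apply: filterE.
  by apply: (ultra_sub (projT2 (cid (hl psi)) hpsi)).
have hall := @ultra_and _ _ UU _ _ hb (ultra_all_list UU s hA).
have [t0 [[Lt0 nt0] ht0]] := ultra_ex hall.
(* Any index of the good set serves as centre: at each psi of the finite cover both [b t] and [b t0]
   are mapped within eps / 4 of [A psi]. *)
exists (b t0); split=> //; apply: (ultra_sub hall) => t [[Lt nt] ht].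
apply: mnorm_le => //; first exact: ltW.
move=> phi hphi; have [psi [pin hpsi hd]] := hs phi hphi.
set x := const_mx (b t) - const_mx (b t0) : 'M_1.
have Lx : L x <= 2 * K + 1.
  apply: le_trans (L_add HL _ _) _.
  have -> : L (- const_mx (b t0) : 'M_1) = L (const_mx (b t0) : 'M_1).
    by have := L_scale HL (- 1) (const_mx (b t0) : 'M_1); rewrite mxscaleNl mxscale1 cabsN cabs1 mul1r.
  lra.
have h1 := ampl_dist_lt HL (CS_lin hpsi) (CS_lin hphi) K1 Lx hd.
have h2 : opn (ampl psi x) <= eps / 2.
  apply: opn_lub => y z hy hz.
  have ex : x = const_mx (b t - b t0) by apply/matrixP => i j; rewrite !mxE.
  rewrite ex sform_const.
  have red (y' : 'I_1 * 'I_(1 + 1) -> C) : vn2 y' <= 1 -> vn2 (fun k => y' (ord0, k)) <= 1.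
    by rewrite {1}/vn2 pair_sum big_ord1.
  have e i j : psi (b t - b t0) i j = - (A psi - psi (b t)) i j + (A psi - psi (b t0)) i j.
    by rewrite (linB (CS_lin hpsi)) !mxE; ring.
  rewrite (eq_sform _ _ e) sformD sformN; apply: le_trans (cabsD _ _) _; rewrite cabsN.
  have g1 := ltW (ht _ pin hpsi); have g2 := ltW (ht0 _ pin hpsi).
  have := opn_ub (fun i j => (A psi - psi (b t)) i j) (red _ hy) (red _ hz).
  have := opn_ub (fun i j => (A psi - psi (b t0)) i j) (red _ hy) (red _ hz).
  move: g1 g2; rewrite /mxn; lra.
have h3 : opn (ampl phi x) <= opn (ampl psi x) + ampl_dist psi phi x.
  have -> : ampl_dist psi phi x = opn (fun p q => - (ampl psi x p q - ampl phi x p q)) by rewrite opnN.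
  apply: le_trans (opnD _ _); rewrite le_eqVlt; apply/orP; left; apply/eqP.
  by apply: eq_opn => p q; rewrite opprB addrC subrK.
move: h1; rewrite mulrC divfK ?gt_eqF // => h1; lra.
Qed.
End Compactness.

(** * Correspondences *)

Section NearLimits.
Variable R : realType.
Local Notation C := (R[i]).
Variable V : lmodType C.
Variable D : mou_data V.
Hypothesis H : is_mou D.

Section Fixed.
Variable n : nat.
Implicit Types (u w : nat -> 'M[V]_n) (a b : 'M[V]_n).

Lemma near_move u a b (d e : R) : near_lim D u a d -> mnorm D (a - b) <= e ->
  near_lim D u b (d + e).
Proof.
move=> [N h] hab; exists N => k Nk; apply: le_trans (mnorm_triangle H a _ _) _.
by apply: lerD => //; exact: h.
Qed.

Lemma near_dist u a b (d e : R) : near_lim D u a d -> near_lim D u b e ->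
  mnorm D (a - b) <= d + e.
Proof.
move=> [N h] [N' h']; apply: le_trans (mnorm_triangle H (u (maxn N N')) _ _) _.
rewrite mnorm_distC //; apply: lerD; [apply: h|apply: h']; rewrite ?leq_maxl ?leq_maxr //.
Qed.

Lemma near_weak u a (d e : R) : d <= e -> near_lim D u a d -> near_lim D u a e.
Proof. by move=> de [N h]; exists N => k /h /le_trans; apply. Qed.

Lemma nearD u w a b (d e : R) : near_lim D u a d -> near_lim D w b e ->
  near_lim D (fun k => u k + w k) (a + b) (d + e).
Proof.
move=> [N h] [N' h']; exists (maxn N N') => k; rewrite geq_max => /andP[/h h1 /h' h2].
by rewrite opprD addrACA; apply: le_trans (mnormD H _ _) _; exact: lerD.
Qed.

Lemma nearZ u a (c : C) (d : R) : near_lim D u a d ->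
  near_lim D (fun k => mxscale c (u k)) (mxscale c a) (cabs c * d).
Proof.
move=> [N h]; exists N => k /h hk; rewrite -mxscaleB; apply: le_trans (mnormZ H _ _) _.
by apply: ler_wpM2l => //; exact: cabs_ge0.
Qed.

Lemma near_mequiv u w a (d e : R) : mequiv D u w -> 0 < e -> near_lim D u a d ->
  near_lim D w a (e + d).
Proof.
move=> huw e0 [N h]; have [N' h'] := huw e e0; exists (maxn N N') => k.
rewrite geq_max => /andP[/h h1 /h' h2].
apply: le_trans (mnorm_triangle H (u k) _ _) _; rewrite mnorm_distC //; exact: lerD.
Qed.

Lemma near_equiv u w : (forall e : R, 0 < e -> exists a b,
    [/\ near_lim D u a e, near_lim D w b e & mnorm D (a - b) <= e]) -> mequiv D u w.
Proof.
move=> h e e0; have e3 : 0 < e / 3 by rewrite divr_gt0.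
have [a [b [[N h1] [N' h2] h3]]] := h _ e3; exists (maxn N N') => k.
rewrite geq_max => /andP[/h1 k1 /h2 k2].
apply: le_trans (mnorm_triangle H a _ _) _.
apply: le_trans (lerD k1 (mnorm_triangle H b _ _)) _; rewrite [mnorm D (b - w k)]mnorm_distC //.
lra.
Qed.

End Fixed.

Lemma mcauchy_lin n (u w : nat -> 'M[V]_n) (c : C) : mcauchy D u -> mcauchy D w ->
  mcauchy D (fun k => mxscale c (u k) + w k).
Proof.
move=> hu hw e e0; have c1 : 0 < cabs c + 1 by rewrite ltr_wpDl // cabs_ge0.
have e1 : 0 < e / (cabs c + 1) by rewrite divr_gt0.
have [N hN] := hu _ e1; have [N' hN'] := hw _ e1; exists (maxn N N') => k l.
rewrite !geq_max => /andP[k1 k2] /andP[l1 l2]; rewrite opprD addrACA -mxscaleB.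
apply: le_trans (mnormD H _ _) _.
apply: le_trans (lerD (mnormZ H _ _) (hN' _ _ k2 l2)) _.
apply: le_trans (lerD (ler_wpM2l (cabs_ge0 c) (hN _ _ k1 l1)) (lexx _)) _.
by rewrite -[X in _ + X]mul1r -mulrDl mulrC divfK // gt_eqF.
Qed.

Lemma near_matrix n (A : 'I_n -> 'I_n -> nat -> V) (a : 'M[V]_n) (d : R) :
  (forall i j, near_lim D (seq1 (A i j)) (const_mx (a i j)) d) ->
  near_lim D (seqmx A) a (\sum_(i < n) \sum_(j < n) d).
Proof.
move=> h; pose N i j := projT1 (cid (h i j)).
exists (\max_i \max_j N i j)%N => k hk; apply: le_trans (mnorm_entries H _) _.
apply: ler_sum => i _; apply: ler_sum => j _.
have := projT2 (cid (h i j)) k; rewrite -/(N i j) => hN.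
have -> : const_mx ((seqmx A k - a) i j) = seq1 (A i j) k - const_mx (a i j) :> 'M[V]_1.
  by apply/matrixP => s t; rewrite !mxE.
apply: hN; apply: leq_trans hk; apply: leq_trans (leq_bigmax i).
exact: (leq_bigmax (F := fun j => N i j)).
Qed.
End NearLimits.

(* P k n a b stands for the value at (a, b) of a Lip-norm on M_n(V1 + V2) whose weighted
   Hausdorff distance is below 1/(k+1). *)
Record correspondence (R : realType) (V1 V2 : lmodType R[i]) (D1 : mou_data V1) (D2 : mou_data V2)
    (L1 : lipT V1) (L2 : lipT V2) (P : nat -> forall n, 'M[V1]_n -> 'M[V2]_n -> R) : Prop :=
 Correspondence {
  corr_add : forall k n (a a' : 'M[V1]_n) (b b' : 'M[V2]_n),
    P k n (a + a') (b + b') <= P k n a b + P k n a' b';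
  corr_scale : forall k n (c : R[i]) (a : 'M[V1]_n) (b : 'M[V2]_n),
    P k n (mxscale c a) (mxscale c b) <= cabs c * P k n a b;
  corr_adj : forall k n (a : 'M[V1]_n) (b : 'M[V2]_n),
    P k n (adjmx (Defs.inv D1) a) (adjmx (Defs.inv D2) b) <= P k n a b;
  corr_entries : forall k n (a : 'M[V1]_n) (b : 'M[V2]_n),
    P k n a b <= \sum_i \sum_j P k 1%N (const_mx (a i j)) (const_mx (b i j));
  corr_unit : forall k, P k 1%N (const_mx (Defs.unit D1)) (const_mx (Defs.unit D2)) <= 0;
  corr_left : forall k n (a : 'M[V1]_n) (b : 'M[V2]_n), L1 n a <= P k n a b;
  corr_right : forall k n (a : 'M[V1]_n) (b : 'M[V2]_n), L2 n b <= P k n a b;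
  corr_lift_left : forall k n (a : 'M[V1]_n) (d : R), 0 < d ->
    exists b : 'M[V2]_n, P k n a b <= L1 n a + d;
  corr_lift_right : forall k n (b : 'M[V2]_n) (d : R), 0 < d ->
    exists a : 'M[V1]_n, P k n a b <= L2 n b + d;
  corr_state_left : forall k m (phi : V1 -> 'M[R[i]]_m.+1), CS D1 phi ->
    exists2 psi : V2 -> 'M[R[i]]_m.+1, CS D2 psi &
    forall r (a : 'M[V1]_r) (b : 'M[V2]_r) (K : R), 0 < K -> P k r a b <= K ->
      opn (fun p q => ampl phi a p q - ampl psi b p q) <= K * ((m.+1)%:R ^+ 2 / (k.+1)%:R);
  corr_state_right : forall k m (psi : V2 -> 'M[R[i]]_m.+1), CS D2 psi ->
    exists2 phi : V1 -> 'M[R[i]]_m.+1, CS D1 phi &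
    forall r (a : 'M[V1]_r) (b : 'M[V2]_r) (K : R), 0 < K -> P k r a b <= K ->
      opn (fun p q => ampl phi a p q - ampl psi b p q) <= K * ((m.+1)%:R ^+ 2 / (k.+1)%:R) }.

Lemma opn_swap (R : realType) (I J : finType) (A B : I -> J -> R[i]) :
  opn (fun p q => A p q - B p q) = opn (fun p q => B p q - A p q).
Proof. by rewrite -opnN; apply: eq_opn => p q; rewrite opprB. Qed.

Lemma correspondence_sym (R : realType) (V1 V2 : lmodType R[i]) (D1 : mou_data V1)
    (D2 : mou_data V2) (L1 : lipT V1) (L2 : lipT V2) P :
  correspondence D1 D2 L1 L2 P -> correspondence D2 D1 L2 L1 (fun k n b a => P k n a b).
Proof.
case=> ? ? ? ? ? ? ? ? ? sl sr; split=> //.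
  move=> k m phi /(sr k m) [psi h1 h2]; exists psi => // r a b K K0 hP.
  by rewrite opn_swap; exact: h2.
move=> k m phi /(sl k m) [psi h1 h2]; exists psi => // r a b K K0 hP.
by rewrite opn_swap; exact: h2.
Qed.

(** * The limit relation along a free ultrafilter *)

Section Relation.
Variables (R : realType) (U : set_system nat).
Hypothesis UU : UltraFilter U.
Hypothesis Ufree : forall N : nat, U (fun k => (N <= k)%N).

(** The limit of the graphs of the Lip-norms. The bound K may depend on eps, since u represents an
    element of the completion whose approximants need not have bounded Lip-norm, but it must be
    uniform in k. *)
Definition related (V1 V2 : lmodType R[i]) (D1 : mou_data V1) (D2 : mou_data V2)
    (P : nat -> forall n, 'M[V1]_n -> 'M[V2]_n -> R) n (u : nat -> 'M[V1]_n) (w : nat -> 'M[V2]_n) :=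
  forall eps : R, 0 < eps -> exists2 K : R, 0 < K &
    U (fun k => exists a b, [/\ P k n a b <= K, near_lim D1 u a eps & near_lim D2 w b eps]).

Lemma related_sym (V1 V2 : lmodType R[i]) (D1 : mou_data V1) (D2 : mou_data V2) P n u w :
  related D1 D2 P (n := n) u w -> related D2 D1 (fun k n b a => P k n a b) w u.
Proof.
move=> h e /h [K K0 hK]; exists K => //; apply: (ultra_sub hK) => k [a [b [? ? ?]]].
by exists b, a.
Qed.

Section Corr.
Variables (V1 V2 : lmodType R[i]) (D1 : mou_data V1) (D2 : mou_data V2).
Variables (L1 : lipT V1) (L2 : lipT V2) (P : nat -> forall n, 'M[V1]_n -> 'M[V2]_n -> R).
Arguments P : clear implicits.
Hypotheses (H1 : is_mou D1) (H2 : is_mou D2).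
Hypotheses (HL1 : is_mlipsn D1 L1) (HL2 : is_mlipsn D2 L2).
Hypotheses (HB1 : induces_BW D1 L1) (HB2 : induces_BW D2 L2).
Hypothesis cr : correspondence D1 D2 L1 L2 P.
Local Notation related := (related D1 D2 P).

Lemma inv_small (K e : R) : 0 <= K -> 0 < e -> U (fun k => K / k.+1%:R <= e).
Proof.
move=> K0 e0; have [N hN] : exists N : nat, K / e <= N%:R.
  exists (Num.bound (K / e)); apply: ltW; apply: archi_boundP; exact: divr_ge0 K0 (ltW e0).
apply: (ultra_sub (Ufree N)) => k Nk; rewrite ler_pdivrMr // mulrC -ler_pdivrMr //.
by apply: le_trans hN _; rewrite ler_nat; exact: leqW.
Qed.

(** A state of V2 is matched with a state of V1 up to K times the squared size over k + 1. The size
    is fixed here, so this error drops below e for U-many k, uniformly over all pairs with P at most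
    K. *)
Lemma corr_norm n (K e : R) : 0 < K -> 0 < e -> U (fun k => forall a b,
  P k n a b <= K -> mnorm D2 b <= mnorm D1 a + e).
Proof.
move=> K0 e0; case: n => [|m].
  apply: filterE => k a b _.
  have -> : b = 0 by apply/matrixP => -[].
  by rewrite mnorm0 // addr_ge0 ?mnorm_ge0 // ltW.
(* The norm at size n = m + 1 needs states of size n + n, which is the successor of m + (m + 1). *)
have C0 : 0 <= K * ((m + m.+1).+1%:R ^+ 2) by rewrite mulr_ge0 ?(ltW K0).
apply: (ultra_sub (inv_small C0 e0)) => k hk a b hP.
apply: mnorm_le => //; first by rewrite addr_ge0 ?mnorm_ge0 // ltW.
move=> psi hpsi; have [phi hphi hd] := @corr_state_right _ _ _ _ _ _ _ _ cr k (m + m.+1)%N psi hpsi.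
have h1 := hd _ a b K K0 hP; have h2 := opn_mnorm H1 a hphi.
have h3 : opn (ampl psi b) <= opn (ampl phi a) + opn (fun p q => ampl phi a p q - ampl psi b p q).
  rewrite opn_swap; apply: le_trans (opnD _ _); rewrite le_eqVlt; apply/orP; left; apply/eqP.
  by apply: eq_opn => p q; rewrite addrC subrK.
apply: le_trans h3 _; apply: lerD => //; apply: le_trans h1 _.
by rewrite mulrA.
Qed.

Lemma corr_sub k n a a' b b' (K K' : R) : P k n a b <= K -> P k n a' b' <= K' ->
  P k n (a - a') (b - b') <= K + K'.
Proof.
move=> h h'; apply: le_trans (corr_add cr _ _ _ _ _) _; apply: lerD => //.
have := corr_scale cr k (- 1) a' b'; rewrite cabsN cabs1 mul1r !mxscaleNl !mxscale1.
by move=> /le_trans; apply.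
Qed.

(** Subtract two approximating pairs at a common index: P stays below K + K', the first components
    nearly agree, and [corr_norm] makes the second ones nearly agree. This gives well-definedness
    and, with the spaces exchanged, injectivity. *)
Lemma related_equiv n (u u' : nat -> 'M[V1]_n) (w w' : nat -> 'M[V2]_n) :
  related u w -> related u' w' -> mequiv D1 u u' -> mequiv D2 w w'.
Proof.
move=> h h' huu'; apply: near_equiv => // e e0; have e4 : 0 < e / 4 by rewrite divr_gt0.
have [K K0 hK] := h _ e4; have [K' K0' hK'] := h' _ e4.
have KK : 0 < K + K' by exact: addr_gt0.
have [k [[[a [b [h1 h2 h3]]] [a' [b' [h1' h2' h3']]]] hs]] :=
  ultra_ex (ultra_and (ultra_and hK hK') (corr_norm n KK e4)).
exists b, b'; split; [apply: near_weak h3|apply: near_weak h3'|]; try lra.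
have haa := near_dist H1 (near_mequiv H1 huu' e4 h2) h2'.
have := hs _ _ (corr_sub h1 h1'); lra.
Qed.

Lemma related_lin n (u u' : nat -> 'M[V1]_n) (w w' : nat -> 'M[V2]_n) (c : R[i]) :
  related u w -> related u' w' ->
  related (fun k => mxscale c (u k) + u' k) (fun k => mxscale c (w k) + w' k).
Proof.
move=> h h' e e0; have c1 : 0 < cabs c + 1 by rewrite ltr_wpDl // cabs_ge0.
have e1 : 0 < e / 2 / (cabs c + 1) by rewrite !divr_gt0.
have e2 : 0 < e / 2 by rewrite divr_gt0.
have [K K0 hK] := h _ e1; have [K' K0' hK'] := h' _ e2.
exists (cabs c * K + K'); first by rewrite ltr_wpDl // mulr_ge0 ?cabs_ge0 // ltW.
have hc : cabs c * (e / 2 / (cabs c + 1)) + e / 2 <= e.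
  have : cabs c * (e / 2 / (cabs c + 1)) <= e / 2.
    by rewrite mulrCA -[leRHS]mulr1 ler_pM2l // ler_pdivrMr // mul1r lerDl.
  lra.
apply: (ultra_sub (ultra_and hK hK')) => k [[a [b [h1 h2 h3]]] [a' [b' [h1' h2' h3']]]].
exists (mxscale c a + a'), (mxscale c b + b'); split.
- apply: le_trans (corr_add cr _ _ _ _ _) _; apply: lerD => //.
  apply: le_trans (corr_scale cr _ _ _ _) _; apply: ler_wpM2l => //; exact: cabs_ge0.
- by apply: near_weak hc _; apply: nearD => //; exact: nearZ.
- by apply: near_weak hc _; apply: nearD => //; exact: nearZ.
Qed.

Lemma related_matrix n (A : 'I_n -> 'I_n -> nat -> V1) (B : 'I_n -> 'I_n -> nat -> V2) :
  (forall i j, related (seq1 (A i j)) (seq1 (B i j))) -> related (seqmx A) (seqmx B).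
Proof.
move=> h e e0; have n1 : 0 < (n * n)%:R + 1 :> R by rewrite ltr_wpDl.
have d0 : 0 < e / ((n * n)%:R + 1) by rewrite divr_gt0.
set d := e / _ in d0.
have sd : \sum_(i < n) \sum_(j < n) d <= e.
  rewrite !sumr_const !card_ord -mulrnA -mulr_natl.
  have -> : e = ((n * n)%:R + 1) * d by rewrite /d mulrC divfK // gt_eqF.
  by rewrite ler_pM2r // lerDl.
pose K i j : R := projT1 (cid2 (h i j d d0)).
have KU i j : U (fun k => exists a b, [/\ P k 1%N a b <= K i j,
    near_lim D1 (seq1 (A i j)) a d & near_lim D2 (seq1 (B i j)) b d]).
  by rewrite /K; case: cid2.
have Kp i j : 0 < K i j by rewrite /K; case: cid2.
exists (1 + \sum_i \sum_j K i j).
  by rewrite ltr_wpDr // sumr_ge0 // => i _; apply: sumr_ge0 => j _; exact: ltW.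
have all : U (fun k => forall ij : 'I_n * 'I_n, ij \in enum {: 'I_n * 'I_n} ->
    exists a b, [/\ P k 1%N a b <= K ij.1 ij.2,
    near_lim D1 (seq1 (A ij.1 ij.2)) a d & near_lim D2 (seq1 (B ij.1 ij.2)) b d]).
  by apply: ultra_all => ij _; exact: KU.
apply: (ultra_sub all) => k hk.
have {}hk i j : exists ab : V1 * V2, [/\ P k 1%N (const_mx ab.1) (const_mx ab.2) <= K i j,
    near_lim D1 (seq1 (A i j)) (const_mx ab.1) d & near_lim D2 (seq1 (B i j)) (const_mx ab.2) d].
  have [|a [b [h1 h2 h3]]] := hk (i, j); first by rewrite mem_enum.
  have e1 (W : Type) (x : 'M[W]_1) : x = const_mx (x 0 0).
    by apply/matrixP => s t; rewrite !mxE !ord1.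
  by exists (a 0 0, b 0 0) => /=; rewrite -!e1.
pose ab i j := projT1 (cid (hk i j)).
have abP i j := projT2 (cid (hk i j)).
exists (\matrix_(i, j) (ab i j).1), (\matrix_(i, j) (ab i j).2); split.
- apply: le_trans (corr_entries cr _ _ _) _; rewrite -[leLHS]add0r; apply: lerD => //.
  apply: ler_sum => i _; apply: ler_sum => j _; rewrite !mxE; by have [] := abP i j.
- apply: near_weak sd _; apply: near_matrix => // i j; rewrite mxE; by have [] := abP i j.
- apply: near_weak sd _; apply: near_matrix => // i j; rewrite mxE; by have [] := abP i j.
Qed.

Lemma near_cst (V : lmodType R[i]) (D : mou_data V) n (a : 'M[V]_n) (e : R) : is_mou D -> 0 < e ->
  near_lim D (fun=> a) a e.
Proof. by move=> H e0; exists 0%N => k _; rewrite subrr mnorm0 // ltW. Qed.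

Lemma related_unit : related (seq1 (fun=> Defs.unit D1)) (seq1 (fun=> Defs.unit D2)).
Proof.
move=> e e0; exists 1 => //; apply: filterE => k.
exists (const_mx (Defs.unit D1)), (const_mx (Defs.unit D2)); split; try exact: near_cst.
by apply: le_trans (corr_unit cr k) _.
Qed.
End Corr.
End Relation.

(** * Existence of limits, transport of L^c and of positivity *)

Section CorrLimits.
Variables (R : realType) (U : set_system nat).
Hypothesis UU : UltraFilter U.
Hypothesis Ufree : forall N : nat, U (fun k => (N <= k)%N).
Variables (V1 V2 : lmodType R[i]) (D1 : mou_data V1) (D2 : mou_data V2).
Variables (L1 : lipT V1) (L2 : lipT V2) (P : nat -> forall n, 'M[V1]_n -> 'M[V2]_n -> R).
Arguments P : clear implicits.
Hypotheses (H1 : is_mou D1) (H2 : is_mou D2).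
Hypotheses (HL1 : is_mlipsn D1 L1) (HL2 : is_mlipsn D2 L2).
Hypotheses (HB1 : induces_BW D1 L1) (HB2 : induces_BW D2 L2).
Hypothesis cr : correspondence D1 D2 L1 L2 P.
Local Notation related := (related U D1 D2 P).

Lemma near_seq1 (u : nat -> V1) : mcauchy D1 (seq1 u) ->
  exists a : nat -> V1, forall m, near_lim D1 (seq1 u) (const_mx (a m)) (m.+1%:R^-1).
Proof.
move=> hu; have h m : exists a, near_lim D1 (seq1 u) (const_mx a) (m.+1%:R^-1).
  have m0 : 0 < m.+1%:R^-1 :> R by rewrite invr_gt0.
  have [N hN] := hu _ m0; exists (u N), N => k Nk; exact: hN.
by exists (fun m => projT1 (cid (h m))) => m; exact: projT2 (cid (h m)).
Qed.

Lemma inv_nat_small (e : R) : 0 < e -> exists M, forall m, (M <= m)%N -> m.+1%:R^-1 <= e.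
Proof.
move=> e0; exists (Num.bound e^-1) => m hm; rewrite -[leRHS]invrK lef_pV2 ?posrE ?invr_gt0 //.
have h : e^-1 < (Num.bound e^-1)%:R by apply: archi_boundP; rewrite invr_ge0 ltW.
by apply: le_trans (ltW h) _; rewrite ler_nat; exact: leqW.
Qed.

(** For each approximant [a m] of u, precompactness of the Lip-ball of V2 provides an element [w m]
    that is within 1/(m+1) of the lifts of [a m] for U-many k. The sequence of these elements is
    Cauchy by comparing lifts of different approximants at a common k, and it represents the
    image. *)
Lemma related_exists (u : nat -> V1) : mcauchy D1 (seq1 u) ->
  exists2 w : nat -> V2, mcauchy D2 (seq1 w) & related (seq1 u) (seq1 w).
Proof.
move=> /near_seq1 [a ha].
have lift m k : exists v : V2,
    P k 1%N (const_mx (a m)) (const_mx v) <= L1 (const_mx (a m) : 'M_1) + 1.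
  have [b hb] := corr_lift_left cr k (const_mx (a m) : 'M_1) ltr01.
  exists (b 0 0); have -> // : const_mx (b 0 0) = b.
  by apply/matrixP => s t; rewrite !mxE !ord1.
pose v m k := projT1 (cid (lift m k)).
have vP m k : P k 1%N (const_mx (a m)) (const_mx (v m k)) <= L1 (const_mx (a m) : 'M_1) + 1.
  exact: projT2 (cid (lift m k)).
pose c m := L1 (const_mx (a m) : 'M_1) + 1.
have c0 m : 0 < c m by rewrite ltr_wpDl // (L_ge0 HL1).
have lim m : exists w : V2, U (fun k => mnorm D2 (const_mx (v m k) - const_mx w : 'M_1) <= m.+1%:R^-1).
  have m0 : 0 < m.+1%:R^-1 :> R by rewrite invr_gt0.
  have hK : U (fun k => L2 (const_mx (v m k) : 'M_1) <= c m + (mnorm D1 (const_mx (a m) : 'M_1) + 1) /\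
       mnorm D2 (const_mx (v m k) : 'M_1) <= c m + (mnorm D1 (const_mx (a m) : 'M_1) + 1)).
    apply: (ultra_sub (corr_norm UU Ufree H1 H2 cr 1%N (c0 m) ltr01)) => k hk; split.
      apply: le_trans (corr_right cr _ _ _) (le_trans (vP m k) _).
      by rewrite lerDl addr_ge0 // mnorm_ge0.
    apply: le_trans (hk _ _ (vP m k)) _; rewrite lerDr; exact: ltW.
  by have [w [_ hw]] := ultra_precompact H2 HL2 HB2 UU m0 hK; exists w.
pose w m := projT1 (cid (lim m)).
have wP m : U (fun k => mnorm D2 (const_mx (v m k) - const_mx (w m) : 'M_1) <= m.+1%:R^-1).
  exact: projT2 (cid (lim m)).
(* Five errors of size e: one from each of [w m] and [w l] to its lift, two between [a m] and [a l],
   and one from [corr_norm]. *)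
have key (e : R) m l : 0 < e -> m.+1%:R^-1 <= e -> l.+1%:R^-1 <= e ->
    mnorm D2 (const_mx (w m) - const_mx (w l) : 'M_1) <= e *+ 5.
  move=> e0 hm hl; have cc : 0 < c m + c l by exact: addr_gt0.
  have [k [[h1 h2] h3]] := ultra_ex (ultra_and (ultra_and (wP m) (wP l))
     (corr_norm UU Ufree H1 H2 cr 1%N cc e0)).
  have h4 := h3 _ _ (corr_sub cr (vP m k) (vP l k)).
  have h5 := near_dist H1 (ha m) (ha l).
  have h6 := mnorm_triangle H2 (const_mx (v m k)) (const_mx (w m)) (const_mx (w l) : 'M_1).
  have h7 := mnorm_triangle H2 (const_mx (v l k)) (const_mx (v m k)) (const_mx (w l) : 'M_1).
  rewrite (mnorm_distC H2 (const_mx (w m)) (const_mx (v m k))) in h6.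
  apply: (le_trans h6 (le_trans (lerD h1 (le_trans h7
    (lerD (le_trans h4 (lerD h5 (lexx e))) h2))) _)).
  move: (m.+1%:R^-1) (l.+1%:R^-1) hm hl => im il hm hl; rewrite -(mulr_natr e 5).
  clear h1 h2 h3 h4 h5 h6 h7; lra.
exists w.
  move=> e e0; have e5 : 0 < e / 5 by rewrite divr_gt0.
  have [M hM] := inv_nat_small e5; exists M => k l /hM hk /hM hl.
  by apply: le_trans (key _ _ _ e5 hk hl) _; rewrite -(mulr_natr (e / 5) 5) divfK.
move=> e e0; have e6 : 0 < e / 6 by rewrite divr_gt0.
have [M hM] := inv_nat_small e6.
exists (c M); first exact: c0.
apply: (ultra_sub (wP M)) => k hk; exists (const_mx (a M)), (const_mx (v M k)); split.
- exact: vP.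
- by apply: near_weak (ha M); apply: le_trans (hM _ (leqnn _)) _; lra.
exists M => l Ml.
have h1 := key _ _ _ e6 (hM _ Ml) (hM _ (leqnn M)).
apply: le_trans (mnorm_triangle H2 (const_mx (w M)) _ _) _.
rewrite (mnorm_distC H2 (const_mx (w M))).
have h2 := le_trans hk (hM _ (leqnn M)).
apply: le_trans (lerD h1 h2) _; rewrite -mulrSr -(mulr_natr (e / 6) 6) divfK //.
Qed.

(** An element b of the L_D-ball is first replaced by b' in the L-ball, since only L controls
    lifting. The lift y has L at most 1 + d and is rescaled into the ball, and [LD_le1] returns to
    L_D. *)
Lemma related_tclB n (u : nat -> 'M[V1]_n) (w : nat -> 'M[V2]_n) (t : R) : 0 < t -> related u w ->
  in_tclB D1 L1 t u -> in_tclB D2 L2 t w.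
Proof.
(* Six errors: from w to c, three between a and t b', one from [corr_norm], and one from rescaling
   y. *)
move=> t0 h hu e0 e00; pose e := e0 / 6.
have e_gt0 : 0 < e by rewrite divr_gt0.
have sum6 : e + (e + (e + e) + e) + e <= e0 by rewrite /e; lra.
have et : 0 < e / t by rewrite divr_gt0.
have [b [hb nb]] := hu e e_gt0.
have [b' Lb' hbb] := LD_approx H1 HL1 HB1 hb et.
have nb' : near_lim D1 u (mxscale t%:C b') (e + e).
  apply: (near_move H1 nb); rewrite -mxscaleB; apply: le_trans (mnormZ H1 _ _) _.
  by rewrite cabs_real ?(ltW t0) //; move: hbb; rewrite ler_pdivlMr // mulrC.
set M := mnorm D1 b' + 1; have M0 : 0 < M by rewrite ltr_wpDl // mnorm_ge0.
(* The norm of y is at most M, so rescaling t y by the inverse of 1 + d moves it by at most t d M =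
   e. *)
pose d := e / (t * M); have d0 : 0 < d by rewrite divr_gt0 // mulr_gt0.
have d1 : 0 < 1 + d by rewrite ltr_wpDl.
have [K K0 hK] := h _ e_gt0.
have K2 : 0 < K + t * (1 + d) by rewrite addr_gt0 // mulr_gt0.
have [k [[[a [c [hP na nc]]] hs] hs1]] := ultra_ex (ultra_and (ultra_and hK
  (corr_norm UU Ufree H1 H2 cr n K2 e_gt0)) (corr_norm UU Ufree H1 H2 cr n d1 ltr01)).
have [y hy] := corr_lift_left cr k b' d0.
have {}hy : P k n b' y <= 1 + d by apply: le_trans hy _; rewrite lerD2r.
have hty : P k n (mxscale t%:C b') (mxscale t%:C y) <= t * (1 + d).
  apply: le_trans (corr_scale cr _ _ _ _) _; rewrite cabs_real ?(ltW t0) //.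
  by rewrite ler_pM2l.
have h1 := hs _ _ (corr_sub cr hP hty).
have h2 := near_dist H1 na nb'.
have ny : near_lim D2 w (mxscale t%:C y) (e + (e + (e + e) + e)).
  by apply: (near_move H2 nc); apply: le_trans h1 _; rewrite lerD2r.
have di : 0 <= (1 + d)^-1 by rewrite invr_ge0 ltW.
exists (mxscale ((1 + d)^-1)%:C y); split.
  apply: (LD_le1 HL2); rewrite (L_scale HL2) cabs_real // ler_pdivrMl // mulr1.
  exact: le_trans (corr_right cr _ _ _) hy.
have hlast : mnorm D2 (mxscale t%:C y - mxscale t%:C (mxscale ((1 + d)^-1)%:C y)) <= e.
  have -> : mxscale t%:C y - mxscale t%:C (mxscale ((1 + d)^-1)%:C y) =
      mxscale (t * (d * (1 + d)^-1))%:C y.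
    rewrite mxscaleA -rmorphM -mxscaleNl -mxscaleDl -rmorphN -rmorphD; congr (mxscale _%:C _).
    by have d1' : 1 + d != 0 by [rewrite gt_eqF]; field.
  apply: le_trans (mnormZ H2 _ _) _; have dd : 0 <= t * (d * (1 + d)^-1).
    exact: mulr_ge0 (ltW t0) (mulr_ge0 (ltW d0) di).
  rewrite cabs_real //.
  have my : mnorm D2 y <= M by exact: hs1.
  apply: (@le_trans _ _ ((t * d) * M)).
    apply: ler_pM => //; first exact: mnorm_ge0.
    rewrite ler_pM2l // -[leRHS]mulr1 ler_pM2l // invf_le1 //.
    by rewrite lerDl ltW.
  by rewrite /d mulrAC mulrC divfK // mulf_neq0 // gt_eqF.
exact: near_weak sum6 (near_move H2 ny hlast).
Qed.

Lemma related_Lc_le n (u : nat -> 'M[V1]_n) (w : nat -> 'M[V2]_n) : related u w ->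
  (Lc D2 L2 w <= Lc D1 L1 u)%E.
Proof.
move=> h; apply: le_ereal_inf => _ [t [t0 ht ->]]; exists t; split=> //.
exact: related_tclB h ht.
Qed.

Lemma mnorm_one_scale n (t : R) : 0 <= t -> mnorm D2 (mxscale t%:C (one_mx D2 n)) <= t.
Proof.
move=> t0; apply: mnorm_herm => //.
- by rewrite adjmxZr // adj_one.
- by apply: posD => //; apply: posZ => //; exact: pos_one.
- by rewrite subrr; exact: pos0.
Qed.

(** A state of V2 is matched with a state of V1, which is nonnegative at the positive approximant p.
    The value at the partner of p is thus bounded below by - 3 e times the squared norm, and adding
    3 e times the unit gives a positive matrix by [pos_CS]. *)
Lemma related_cpos n (u : nat -> 'M[V1]_n) (w : nat -> 'M[V2]_n) : related u w ->
  cpos D1 u -> cpos D2 w.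
Proof.
case: n u w => [|m] u w h hu.
  move=> e e0; exists 0; split; first exact: pos0.
  exists 0%N => k _; have -> : w k - 0 = 0 by apply/matrixP => -[].
  by rewrite mnorm0 // ltW.
(* The budget is e from w to b, 5 e from b to b', and 3 e for the multiple of the unit added to
   b'. *)
move=> e0 e00; pose e := e0 / 9; have e_gt0 : 0 < e by rewrite divr_gt0.
have sum5 : e + e + (e + e) + e <= e *+ 5 by rewrite -(mulr_natr e 5); lra.
have combine (x y z cy cz N : R) : 0 <= x -> - y <= cy -> 2 * cy <= (e + e) * (N + N) ->
    z <= cz -> 2 * cz <= e * (N + N) -> 0 <= x + y - z + e * 3%:R * N.
  rewrite !mulrDr !mulrDl; lra.
have sum9 : e + e *+ 5 + e *+ 3 <= e0.
  by rewrite -(mulr_natr e 5) -(mulr_natr e 3) /e; lra.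
have [p [pp np]] := hu e e_gt0.
have [K K0 hK] := h e e_gt0; have KK : 0 < K + K by exact: addr_gt0.
have C0 : 0 <= K * (m.+1%:R ^+ 2) by rewrite mulr_ge0 // ltW.
have [k [[[a [b [hP na nb]]] hs] hk]] := ultra_ex (ultra_and (ultra_and hK
  (corr_norm UU Ufree H1 H2 cr m.+1 KK e_gt0)) (inv_small UU Ufree C0 e_gt0)).
have half0 : 0 <= 2^-1 :> R by rewrite invr_ge0.
(* [pos_CS] needs a selfadjoint matrix, so the pair is replaced by its selfadjoint part. Since p is
   selfadjoint, a' is close to a, and [corr_norm] makes b' close to b. *)
pose a' := mxscale (2^-1)%:C (re2 D1 a); pose b' := mxscale (2^-1)%:C (re2 D2 b).
have hP' : P k m.+1 a' b' <= K.
  apply: le_trans (corr_scale cr _ _ _ _) _; rewrite cabs_real // ler_pdivrMl //.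
  apply: le_trans (corr_add cr _ _ _ _ _) _.
  have := corr_adj cr k a b; lra.
have hap := near_dist H1 na np.
have hb' : adjmx (Defs.inv D2) b' = b' by rewrite adjmxZr // adj_re2.
have apE : a' - p = mxscale (2^-1)%:C ((a - p) + adjmx (Defs.inv D1) (a - p)).
  rewrite adjmxB // (pos_herm H1 pp) addrACA -opprD mxscaleB -/(re2 D1 a) -/a'; congr (_ - _).
  rewrite -mxscale2 mxscaleA -(rmorph_nat (real_complex R)) -rmorphM mulVf ?mxscale1 //.
have ha'p : mnorm D1 (a' - p) <= e + e.
  rewrite apE; apply: le_trans (mnormZ H1 _ _) _; rewrite cabs_real // ler_pdivrMl //.
  apply: le_trans (mnormD H1 _ _) _; rewrite mnorm_adj //; lra.
have haa : mnorm D1 (a - a') <= (e + e) + (e + e).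
  apply: le_trans (mnorm_triangle H1 p _ _) _; rewrite (mnorm_distC H1 p); exact: lerD.
have hbb : mnorm D2 (b - b') <= e *+ 5.
  exact: le_trans (hs _ _ (corr_sub cr hP hP')) (le_trans (lerD haa (lexx e)) sum5).
have e3 : 0 <= e *+ 3 by rewrite mulrn_wge0 // ltW.
exists (b' + mxscale (e *+ 3)%:C (one_mx D2 m.+1)); split; last first.
  have hx : mnorm D2 (b' - (b' + mxscale (e *+ 3)%:C (one_mx D2 m.+1))) <= e *+ 3.
    by rewrite opprD addrA subrr add0r mnormN // mnorm_one_scale.
  exact: near_weak sum9 (near_move H2 (near_move H2 nb hbb) hx).
apply: pos_CS => //.
  by rewrite adjmxD // adjmxZr // adj_one // hb'.
move=> psi hpsi; have [phi hphi hd] := corr_state_right cr k hpsi.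
have h1 := hd _ a' b' K K0 hP'.
have h2 := opn_mnorm H1 (a' - p) hphi.
have /CS_cp [hcp _] := hpsi.
apply/psdP => x; rewrite (sform_real H2 _ hcp); last by rewrite adjmxD // adjmxZr // adj_one // hb'.
rewrite ler0c.
have -> : sform (ampl psi (b' + mxscale (e *+ 3)%:C (one_mx D2 m.+1))) x x =
   sform (ampl psi b') x x + (e *+ 3 * vn2 x)%:C.
  rewrite rmorphM /= -(sform_one_CS _ hpsi) -sformZ -sformD; apply: eq_sform => i j.
  by rewrite amplD ?amplZ //; exact: CS_lin hpsi.
have h3 : 0 <= complex.Re (sform (ampl phi p) x x) by exact: CS_pos hphi pp.
have h4 := opn_sform x x h1.
have {}h2 := opn_sform x x (le_trans h2 ha'p).
have eqs : sform (ampl psi b') x x = sform (ampl phi p) x x + sform (ampl phi (a' - p)) x x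
   - sform (fun i j => ampl phi a' i j - ampl psi b' i j) x x.
  rewrite -!sformD -sformB; apply: eq_sform => i j.
  by rewrite (amplB (CS_lin hphi)); ring.
rewrite eqs !ReD ReN /=.
have h5 := Re_le_cabs (sform (fun i j => ampl phi a' i j - ampl psi b' i j) x x).
have h6 := Re_le_cabs (- sform (ampl phi (a' - p)) x x); rewrite ReN cabsN in h6.
have hk' : K * (m.+1%:R ^+ 2 / k.+1%:R) * (vn2 x + vn2 x) <= e * (vn2 x + vn2 x).
  by apply: ler_wpM2r; [rewrite addr_ge0 // vn2_ge0 | rewrite mulrA].
rewrite -(mulr_natr e 3); exact: (combine _ _ _ _ _ _ h3 h6 h2 h5 (le_trans h4 hk')).
Qed.
End CorrLimits.

(** * The isometry *)

Section FromDistance.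
Variables (R : realType) (V1 V2 : lmodType R[i]) (D1 : mou_data V1) (D2 : mou_data V2).
Variables (L1 : lipT V1) (L2 : lipT V2).
Local Notation C := (R[i]).

Definition zipmx n (a : 'M[V1]_n) (b : 'M[V2]_n) : 'M[(V1 * V2)%type]_n :=
  \matrix_(i, j) (a i j, b i j).

Lemma zipmx_fst n (a : 'M[V1]_n) (b : 'M[V2]_n) : map_mx fst (zipmx a b) = a.
Proof. by apply/matrixP => i j; rewrite !mxE. Qed.

Lemma zipmx_snd n (a : 'M[V1]_n) (b : 'M[V2]_n) : map_mx snd (zipmx a b) = b.
Proof. by apply/matrixP => i j; rewrite !mxE. Qed.

Lemma zipmx_eta n (x : 'M[(V1 * V2)%type]_n) : zipmx (map_mx fst x) (map_mx snd x) = x.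
Proof. by apply/matrixP => i j; rewrite !mxE; case: (x i j). Qed.

Lemma hausdorff_lt (T : Type) (d : T -> T -> \bar R) (A B : set T) (c : \bar R) :
  (hausdorff d A B < c)%E ->
  (forall a, A a -> exists2 b, B b & (d a b < c)%E) /\
  (forall b, B b -> exists2 a, A a & (d a b < c)%E).
Proof.
rewrite /hausdorff gt_max => /andP[h1 h2]; split.
  move=> a Aa; have h : (ereal_inf [set y | exists b, B b /\ y = d a b] < c)%E.
    by apply: le_lt_trans h1; apply: ereal_sup_ubound; exists a.
  have [_ [b [Bb ->]] hb] := ereal_inf_lt h; by exists b.
move=> b Bb; have h : (ereal_inf [set y | exists a, A a /\ y = d a b] < c)%E.
  by apply: le_lt_trans h2; apply: ereal_sup_ubound; exists b.
have [_ [a [Aa ->]] ha] := ereal_inf_lt h; by exists a.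
Qed.

Lemma distNC_eq0 : distNC D1 D2 L1 L2 = 0%E -> forall k : nat,
  exists L : lipT (V1 * V2)%type, [/\ is_mlipnorm (sum_mou D1 D2) L, induces_both L1 L2 L &
   forall n, (hausdorff (@DL _ _ L n.+1) (@CS1img _ _ _ D1 n.+1) (@CS2img _ _ _ D2 n.+1) <
     ((n.+1)%:R ^+ 2 / k.+1%:R)%:E)%E].
Proof.
move=> h0 k; have h : (distNC D1 D2 L1 L2 < (k.+1%:R^-1)%:E)%E.
  by rewrite h0 lte_fin invr_gt0.
have [_ [L [HL Hi ->]] hs] := ereal_inf_lt h; exists L; split=> // n.
have n0 : 0 < (n.+1%:R ^- 2 : R) by rewrite invr_gt0 exprn_gt0.
have : ((n.+1%:R ^- 2 : R)%:E *
   hausdorff (@DL _ _ L n.+1) (@CS1img _ _ _ D1 n.+1) (@CS2img _ _ _ D2 n.+1) < (k.+1%:R^-1)%:E)%E.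
  by apply: le_lt_trans hs; apply: ereal_sup_ubound; exists n.
case: (hausdorff _ _ _) => [r| |].
- rewrite -EFinM !lte_fin => hr; rewrite -ltr_pdivrMl ?exprn_gt0 //.
- by rewrite gt0_muley ?lte_fin.
- by move=> _; rewrite ltNyr.
Qed.

Lemma ampl_dist_zip n (phi : V1 -> 'M[C]_n) (psi : V2 -> 'M[C]_n) r (a : 'M[V1]_r) (b : 'M[V2]_r) :
  ampl_dist (phi \o fst) (psi \o snd) (zipmx a b) =
  opn (fun p q => ampl phi a p q - ampl psi b p q).
Proof. by apply: eq_opn => p q; rewrite /ampl !mxE. Qed.

Lemma distNC_correspondence : is_mlipsn D1 L1 -> is_mlipsn D2 L2 ->
  distNC D1 D2 L1 L2 = 0%E -> exists P, correspondence D1 D2 L1 L2 P.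
Proof.
move=> HL1 HL2 /distNC_eq0 h; pose L k := projT1 (cid (h k)).
have LP k : [/\ is_mlipnorm (sum_mou D1 D2) (L k), induces_both L1 L2 (L k) &
   forall n, (hausdorff (@DL _ _ (L k) n.+1) (@CS1img _ _ _ D1 n.+1) (@CS2img _ _ _ D2 n.+1) <
     ((n.+1)%:R ^+ 2 / k.+1%:R)%:E)%E] by exact: projT2 (cid (h k)).
have HL k : is_mlipsn (sum_mou D1 D2) (L k) by have [[]] := LP k.
have linc1 m (phi : V1 -> 'M[C]_m) : lin phi -> lin (phi \o @fst V1 V2).
  by move=> hl c v w; rewrite /= -hl.
have linc2 m (phi : V2 -> 'M[C]_m) : lin phi -> lin (phi \o @snd V1 V2).
  by move=> hl c v w; rewrite /= -hl.
exists (fun k n a b => L k n (zipmx a b)); split.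
- move=> k n a a' b b'; apply: le_trans (L_add (HL k) _ _).
  rewrite le_eqVlt; apply/orP; left; apply/eqP; congr (L k n _).
  by apply/matrixP => i j; rewrite !mxE.
- move=> k n c a b; rewrite -(L_scale (HL k)).
  rewrite le_eqVlt; apply/orP; left; apply/eqP; congr (L k n _).
  by apply/matrixP => i j; rewrite !mxE.
- move=> k n a b; rewrite -[leRHS](L_adj (HL k)).
  rewrite le_eqVlt; apply/orP; left; apply/eqP; congr (L k n _).
  by apply/matrixP => i j; rewrite !mxE.
- move=> k n a b; apply: le_trans (L_entries (HL k) _) _.
  apply: ler_sum => i _; apply: ler_sum => j _.
  rewrite le_eqVlt; apply/orP; left; apply/eqP; congr (L k _ _).
  by apply/matrixP => s t; rewrite !mxE.
- move=> k; have -> : zipmx (const_mx (Defs.unit D1)) (const_mx (Defs.unit D2)) =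
      scmx (1%:M : 'M[C]_1) (Defs.unit (sum_mou D1 D2)).
    by apply/matrixP => s t; rewrite !mxE !ord1 eqxx scale1r.
  by rewrite (L_scmx (HL k)).
- move=> k n a b; have [_ [-> _] _] := LP k; apply: ge_inf.
    by exists 0 => _ [x [_ ->]]; exact: (L_ge0 (HL k)).
  by exists (zipmx a b); rewrite zipmx_fst.
- move=> k n a b; have [_ [_ ->] _] := LP k; apply: ge_inf.
    by exists 0 => _ [x [_ ->]]; exact: (L_ge0 (HL k)).
  by exists (zipmx a b); rewrite zipmx_snd.
- move=> k n a d d0; have [_ [-> _] _] := LP k.
  (* Nonemptiness and the lower bound 0 ensure that [inf] is a genuine infimum and not its default
     value. *)
  set S := (X in inf X); have hS : has_inf S.
    split; first by exists (L k n (zipmx a 0)), (zipmx a 0); rewrite zipmx_fst.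
    by exists 0 => _ [x [_ ->]]; exact: (L_ge0 (HL k)).
  have [_ [x [<- ->]] hx] := inf_adherent d0 hS.
  by exists (map_mx snd x); rewrite zipmx_eta ltW.
- move=> k n a d d0; have [_ [_ ->] _] := LP k.
  set S := (X in inf X); have hS : has_inf S.
    split; first by exists (L k n (zipmx 0 a)), (zipmx 0 a); rewrite zipmx_snd.
    by exists 0 => _ [x [_ ->]]; exact: (L_ge0 (HL k)).
  have [_ [x [<- ->]] hx] := inf_adherent d0 hS.
  by exists (map_mx fst x); rewrite zipmx_eta ltW.
- move=> k m phi hphi; have [_ _ /(_ m) /hausdorff_lt [h1 _]] := LP k.
  have [_ [psi [hpsi ->]] hd] := h1 (phi \o fst) (ex_intro _ phi (conj hphi erefl)).
  exists psi => // r a b K K0 hP; rewrite -ampl_dist_zip.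
  by apply: (ampl_dist_lt (HL k)) => //; [exact: linc1 (CS_lin hphi)|exact: linc2 (CS_lin hpsi)].
- move=> k m psi hpsi; have [_ _ /(_ m) /hausdorff_lt [_ h2]] := LP k.
  have [_ [phi [hphi ->]] hd] := h2 (psi \o snd) (ex_intro _ psi (conj hpsi erefl)).
  exists phi => // r a b K K0 hP; rewrite -ampl_dist_zip.
  by apply: (ampl_dist_lt (HL k)) => //; [exact: linc1 (CS_lin hphi)|exact: linc2 (CS_lin hpsi)].
Qed.
End FromDistance.

(** Any ultrafilter above the filter of tails contains every tail. *)
Lemma free_ultrafilter : exists U : set_system nat,
  UltraFilter U /\ forall N : nat, U (fun k => (N <= k)%N).
Proof.
pose F : set_system nat := fun A => exists N, forall k, (N <= k)%N -> A k.
have PF : ProperFilter F.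
  apply: Build_ProperFilter_ex.
    by move=> A [N hN]; exists N; exact: hN.
  split.
  - by exists 0%N.
  - move=> A B [N hN] [N' hN']; exists (maxn N N') => k; rewrite geq_max => /andP[h1 h2].
    by split; [exact: hN | exact: hN'].
  - by move=> A B AB [N hN]; exists N => k /hN /AB.
have [U [UU FU]] := ultraFilterLemma PF; exists U; split=> // N.
by apply: FU; exists N.
Qed.

Theorem theorem5p6 (R : realType) (V1 V2 : lmodType R[i])
  (D1 : mou_data V1) (D2 : mou_data V2) (L1 : lipT V1) (L2 : lipT V2) :
  qms D1 L1 -> qms D2 L2 ->
  distNC D1 D2 L1 L2 = 0%E ->
  exists F : (nat -> V1) -> (nat -> V2), complete_isometry D1 D2 L1 L2 F.
Proof.
move=> [H1 [HL1 HB1]] [H2 [HL2 HB2]] /(distNC_correspondence HL1 HL2) [P cr].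
(* The symmetric correspondence yields the reverse inequality for L^c, injectivity, surjectivity and
   the reverse implication for positivity. *)
have cr' := correspondence_sym cr.
have [U [UU Ufree]] := free_ultrafilter.
(* Outside the Cauchy sequences the value is the constant sequence 0, which no clause of the
   conclusion sees. *)
have ex u : exists w, mcauchy D1 (seq1 u) ->
    mcauchy D2 (seq1 w) /\ related U D1 D2 P (seq1 u) (seq1 w).
  have [hu|hu] := pselect (mcauchy D1 (seq1 u)); last by exists (fun=> 0).
  by have [w h1 h2] := related_exists UU Ufree H1 H2 HL1 HL2 HB2 cr hu; exists w.
(* The representative is chosen freely for each u, so F need not be linear on sequences; the
   required identities hold up to [mequiv] because related sequences are unique up to it. *)
pose F u := projT1 (cid (ex u)).
have FP u : mcauchy D1 (seq1 u) -> mcauchy D2 (seq1 (F u)) /\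
  related U D1 D2 P (seq1 u) (seq1 (F u)) by exact: projT2 (cid (ex u)).
have FR u : in_Vc D1 L1 u -> related U D1 D2 P (seq1 u) (seq1 (F u)).
  by move=> [/FP[]].
have LcE n (u : nat -> 'M_n) (w : nat -> 'M_n) : related U D1 D2 P u w ->
    Lc D1 L1 u = Lc D2 L2 w.
  move=> h; apply/eqP; rewrite eq_le; apply/andP; split.
    exact: (related_Lc_le UU Ufree H2 H1 HL2 HL1 HB2 cr' (related_sym UU h)).
  exact: (related_Lc_le UU Ufree H1 H2 HL1 HL2 HB1 cr h).
have mrefl (V : lmodType R[i]) (D : mou_data V) n (u : nat -> 'M[V]_n) : is_mou D -> mequiv D u u.
  by move=> H e e0; exists 0%N => k _; rewrite subrr mnorm0 // ltW.
exists F; split; [|split; [|split; [|split; [|split; [|split]]]]].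
- move=> u hu; have [hc _] := hu; split; first by have [] := FP _ hc.
  by rewrite -(LcE _ _ _ (FR _ hu)); case: hu.
- move=> u w hu hw; exact: (related_equiv UU Ufree H1 H2 cr (FR _ hu) (FR _ hw)).
- move=> c u w hu hw; have [hcu _] := hu; have [hcw _] := hw.
  have seq1E (V : lmodType R[i]) (x y : nat -> V) :
      seq1 (fun k => c *: x k + y k) = fun k => mxscale c (seq1 x k) + seq1 y k.
    by apply/funext => k; apply/matrixP => s t; rewrite !mxE.
  have hcl : mcauchy D1 (seq1 (fun k => c *: u k + w k)).
    by rewrite seq1E; exact: mcauchy_lin.
  have [_ hF] := FP _ hcl.
  apply: (related_equiv UU Ufree H1 H2 cr hF _ (mrefl _ _ _ _ H1)).
  by rewrite !seq1E; exact: (related_lin UU H1 H2 cr c (FR _ hu) (FR _ hw)).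
- move=> u w hu hw.
  exact: (related_equiv UU Ufree H2 H1 cr' (related_sym UU (FR _ hu)) (related_sym UU (FR _ hw))).
- move=> w [hw Lw].
  have [u hu hr] := related_exists UU Ufree H2 H1 HL2 HL1 HB1 cr' hw.
  have {}hr := related_sym UU hr.
  have uV : in_Vc D1 L1 u by split=> //; rewrite (LcE _ _ _ hr).
  by exists u; split=> //; exact: (related_equiv UU Ufree H1 H2 cr (FR _ uV) hr (mrefl _ _ _ _ H1)).
- have hc : mcauchy D1 (seq1 (fun=> Defs.unit D1)).
    by move=> e e0; exists 0%N => k l _ _; rewrite subrr mnorm0 // ltW.
  have [_ hF] := FP _ hc.
  exact: (related_equiv UU Ufree H1 H2 cr hF (related_unit UU H1 H2 cr) (mrefl _ _ _ _ H1)).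
move=> n A hA.
have hr : related U D1 D2 P (seqmx A) (seqmx (fun i j => F (A i j))).
  by apply: (related_matrix UU H1 H2 cr) => i j; exact: FR.
split; last exact: LcE.
split; first exact: (related_cpos UU Ufree H1 H2 cr hr).
exact: (related_cpos UU Ufree H2 H1 cr' (related_sym UU hr)).
Qed.
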